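(* Assume the two standing assumptions on $P$ (with parameter $s$) stated in the context, and let $s<1$. Then for $P$-a.e. environment $\omega$ there exist random subsequences $t_m=t_m(\omega)$ and $u_m=u_m(\omega)$ such that for every $\delta>0$, $$\lim_{m\to\infty}P_\omega\left(\frac{X_{t_m}-u_m}{(\log t_m)^2}\in[-\delta,\delta]\right)=1.$$
   Context: Setting. $\Omega=[0,1]^{\mathbb Z}$ with its Borel $\sigma$-algebra; a random environment is $\omega=(\omega_i)_{i\in\mathbb Z}\in\Omega$ with law $P$. For fixed $\omega$, $P_\omega$ is the (quenched) law of the Markov chain $(X_n)_{n\ge 0}$ on $\mathbb Z$ with $X_0=0$, $P_\omega(X_{n+1}=i+1\mid X_n=i)=\omega_i$, $P_\omega(X_{n+1}=i-1\mid X_n=i)=1-\omega_i$. $E_P$ is expectation under $P$. Put $\rho_i=(1-\omega_i)/\omega_i$ and $\rho=\rho_0$. Standing assumptions: (1) $P$ is an i.i.d. product measure on $\Omega$ with $E_P\log\rho<0$ and $E_P\rho^s=1$ for some $s>0$; (2) the distribution of $\log\rho$ under $P$ is nonlattice and $E_P(\rho^s\log\rho)<\infty$. Random subsequences are sequences depending only on the environment $\omega$ (not on the walk) and tending to infinity with $m$; for non-integer $t\ge0$, $X_t$ means $X_{\lfloor t\rfloor}$. *)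

(* Defs.v *)
From HB Require Import structures.
From mathcomp Require Import all_boot all_order all_algebra.
From mathcomp Require Import all_classical all_reals all_analysis.
From mathcomp Require Import lra.

Set Implicit Arguments.
Unset Strict Implicit.
Unset Printing Implicit Defensive.

Import Order.TTheory GRing.Theory Num.Theory.
Import numFieldNormedType.Exports.

Local Open Scope classical_set_scope.
Local Open Scope ring_scope.

Definition unit_itv (R : realType) : Type := set_type (`[0, 1]%classic : set R).

HB.instance Definition _ (R : realType) := Topological.on (unit_itv R).

Fact unit_itv0 (R : realType) : (0 : R) \in (`[0, 1]%classic : set R).
Proof. by rewrite inE /= in_itv /= lexx ler01. Qed.

HB.instance Definition _ (R : realType) :=
  isPointed.Build (unit_itv R) (exist _ 0 (unit_itv0 R)).

Definition env (R : realType) : measurableType _ :=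
  g_sigma_algebraType (@open {ptws int -> unit_itv R}).

Definition site (R : realType) (w : env R) (i : int) : R := set_val (w i).

Definition iid_env (R : realType) (P : probability (env R) R) : Prop :=
  exists mu : probability R R,
    forall (J : seq int) (B : int -> set R),
      uniq J -> (forall i, measurable (B i)) ->
      P [set w | forall i, i \in J -> B i (site w i)] =
      (\prod_(i <- J) mu (B i))%E.

(* rho = +oo when the site value is 0; log rho = -oo when it is 1. *)
Definition rho (R : realType) (w : env R) : \bar R :=
  if site w 0 == 0 then +oo%E else ((1 - site w 0) / site w 0)%:E.

Definition log_rho (R : realType) (w : env R) : \bar R := lne (rho w).

(* Any mass of log rho at -oo is disregarded: the distribution is lattice when
   its restriction to the reals is concentrated on h Z for some h > 0. *)
Definition nonlattice_log_rho (R : realType) (P : probability (env R) R) :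
    Prop :=
  ~ exists h : R, 0 < h /\
      {ae P, forall w, log_rho w = -oo%E \/
        exists k : int, log_rho w = (k%:~R * h)%:E}.

Definition cylinder (n : nat) (x : nat -> int) : set (nat -> int) :=
  [set p | forall k, (k <= n)%N -> p k = x k].

HB.instance Definition _ := isPointed.Build int 0.

Definition path_space : measurableType _ :=
  g_sigma_algebraType [set A | exists n x, A = cylinder n x].

Definition jump (R : realType) (w : env R) (i j : int) : R :=
  if j == i + 1 then site w i
  else if j == i - 1 then 1 - site w i else 0.

Definition is_quenched_law (R : realType) (w : env R)
    (Q : probability path_space R) : Prop :=
  Q [set p | p 0%N = 0] = 1%E /\
  forall (n : nat) (x : nat -> int),
    Q (cylinder n.+1 x) = (Q (cylinder n x) * (jump w (x n) (x n.+1))%:E)%E.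

Lemma site_itv (R : realType) (w : env R) (i : int) : 0 <= site w i <= 1.
Proof.
by have := set_valP (w i); rewrite /= in_itv.
Qed.

(* Existence of the quenched law: the walk is driven by one uniform point x of
   [0, 1[, which at each step is located in one of the two halves, of relative
   lengths w_i and 1 - w_i, of the current interval [a, a + l[. *)
Fixpoint split_state (R : realType) (w : env R) (x : R) (n : nat) :
    int * (R * R) :=
  if n is m.+1 then
    let: (i, (a, l)) := split_state w x m in
    if x < a + l * site w i then (i + 1, (a, l * site w i))
    else (i - 1, (a + l * site w i, l * (1 - site w i)))
  else (0, (0, 1)).

Definition split_path (R : realType) (w : env R) (x : R) : nat -> int :=
  fun n => if 0 <= x < 1 then (split_state w x n).1 else 0.

(* Left end and length of the set of points whose walk follows y up to n. *)
Fixpoint split_itv (R : realType) (w : env R) (y : nat -> int) (n : nat) :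
    R * R :=
  if n is m.+1 then
    let: (a, l) := split_itv w y m in
    (if y m.+1 == y m + 1 then a else a + l * site w (y m),
     l * jump w (y m) (y m.+1))
  else (0, (y 0%N == 0)%:R).

Lemma jump_ge0 (R : realType) (w : env R) i j : 0 <= jump w i j.
Proof.
by rewrite /jump; have /andP[? ?] := site_itv w i; case: ifP => // _;
   case: ifP => // _; rewrite subr_ge0.
Qed.

Lemma split_itv_ge0 (R : realType) (w : env R) y n :
  0 <= (split_itv w y n).2.
Proof.
elim: n => [|n] /=; first by rewrite ler0n.
by case: split_itv => a l /= l0; rewrite mulr_ge0 ?jump_ge0.
Qed.

Lemma split_pathP (R : realType) (w : env R) y n x : 0 <= x < 1 ->
  let al := split_itv w y n in
  (cylinder n y (split_path w x) <-> al.1 <= x < al.1 + al.2) /\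
  (cylinder n y (split_path w x) -> split_state w x n = (y n, al)).
Proof.
move=> x01; have -> : split_path w x = (fun k => (split_state w x k).1).
  by apply/funext => k; rewrite /split_path x01.
set p := fun k => _; elim: n => [|n] /=.
  have E : cylinder 0 y p <-> y 0%N = 0.
    by split=> [/(_ 0%N isT)|y0 [|k]//].
  split; last by move=> /E y0; rewrite y0 eqxx.
  rewrite E; split=> [->|]; first by rewrite eqxx add0r.
  by case: eqP => // _; rewrite add0r => /andP[/le_lt_trans h /h]; rewrite ltxx.
have EC : cylinder n.+1 y p <->
    cylinder n y p /\ p n.+1 = y n.+1.
  split=> [h|[h1 h2] k]; first by split=> [k kn|]; apply: h => //; exact: leqW.
  by rewrite leq_eqVlt => /orP[/eqP ->//|]; rewrite ltnS; exact: h1.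
rewrite EC (_ : p n.+1 = (split_state w x n.+1).1) //=.
have := split_itv_ge0 w y n; case: (split_itv w y n) => a l /= l0 [I S].
have /andP[p0 p1] := site_itv w (y n).
have lp0 : 0 <= l * site w (y n) by rewrite mulr_ge0.
have lp1 : l * site w (y n) <= l by rewrite ler_piMr.
have ne (i : int) : (i - 1 == i + 1) = false.
  by apply/eqP => /addrI /eqP.
split.
- split.
    move=> [c]; rewrite (S c); move/I: c => /andP[ax xl].
    case: ltP => [xs|sx] /= <-; rewrite /jump.
      by rewrite eqxx ax.
    rewrite ne eqxx sx /=; rewrite mulrBr mulr1; lra.
  rewrite /jump; case: ifP => [/eqP yn /andP[ax xs]|yn].
    have c : cylinder n y p by apply I; rewrite ax /=; lra.
    by split=> //; rewrite (S c) xs.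
  case: ifP => [/eqP yn'|yn'] /andP[ax xs]; last first.
    move: ax xs; rewrite ?mulr0 ?addr0 => ax xs; have := le_lt_trans ax xs; rewrite ltxx; done.
  have c : cylinder n y p.
    by apply I; rewrite mulrBr mulr1 in xs; apply/andP; split; lra.
  by split=> //; rewrite (S c) ltNge ax /=.
- move=> [c]; rewrite (S c) /jump.
  by case: ltP => _ /= <-; rewrite ?ne ?eqxx.
Qed.

Lemma split_path_cylinder (R : realType) (w : env R) n y :
  let al := split_itv w y n in
  split_path w @^-1` cylinder n y `&` `[0, 1[ = `[al.1, al.1 + al.2[ `&` `[0, 1[.
Proof.
move=> al; apply/seteqP; split=> x [h x01]; split=> //; have := x01;
  rewrite /= in_itv /= => x01'; have [I _] := split_pathP w y n x01'.
- by rewrite in_itv /=; apply I.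
- by apply I; move: h; rewrite /= in_itv.
Qed.

Lemma split_itv_sub (R : realType) (w : env R) n y :
  let al := split_itv w y n in 0 <= al.1 /\ al.1 + al.2 <= 1.
Proof.
elim: n => [|n] /=; first by case: eqP => _ /=; rewrite add0r.
have := split_itv_ge0 w y n; case: (split_itv w y n) => a l /= l0 [a0 al1].
have /andP[p0 p1] := site_itv w (y n).
have lp0 : 0 <= l * site w (y n) by rewrite mulr_ge0.
have lp1 : l * site w (y n) <= l by rewrite ler_piMr.
rewrite /jump; case: ifP => _; first by split => //; lra.
by case: ifP => _; rewrite ?mulrBr ?mulr0 ?mulr1; split; lra.
Qed.

Lemma measurable_split_path (R : realType) (w : env R) :
  measurable_fun setT (split_path w : measurableTypeR R -> path_space).
Proof.
apply: (@measurability _ _ _ path_space setT (split_path w) [set A | exists n x, A = cylinder n x] erefl).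
move=> _ [_ [n [y ->]] <-]; rewrite setTI.
rewrite -(setUIDK (split_path w @^-1` cylinder n y) (`[0, 1[ : set R)).
apply: measurableU; first by rewrite split_path_cylinder; exact: measurableI.
have out x : ~ (`[0, 1[%classic : set R) x -> split_path w x = (fun=> 0).
  rewrite /= in_itv /= => /negP x01; apply/funext => k.
  by rewrite /split_path (negbTE x01).
case: (pselect (cylinder n y (fun=> 0))) => c0.
- rewrite (_ : _ `\` _ = ~` (`[0, 1[%classic : set R)); first exact: measurableC.
  apply/seteqP; split=> x; first by case.
  by move=> x01; split=> //; rewrite /preimage /= out.
- rewrite (_ : _ `\` _ = set0) // -subset0 => x [+ x01].
  by rewrite /preimage /= out.
Qed.

Definition unif01 (R : realType) : set (measurableTypeR R) -> \bar R :=
  mrestr (@lebesgue_measure R) (measurable_itv `[0, 1[).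

HB.instance Definition _ (R : realType) :=
  Measure.copy (@unif01 R) (mrestr (@lebesgue_measure R) (measurable_itv `[0, 1[)).

Lemma unif01_setT (R : realType) : @unif01 R setT = 1%E.
Proof.
by rewrite /unif01 /mrestr setTI lebesgue_measure_itv /= lte_fin ltr01 oppr0 adde0.
Qed.

HB.instance Definition _ (R : realType) :=
  Measure_isProbability.Build _ _ R (@unif01 R) (@unif01_setT R).

Lemma quenched_law_exists (R : realType) (w : env R) :
  exists Q : probability path_space R, is_quenched_law w Q.
Proof.
pose f : {mfun measurableTypeR R >-> path_space} := mfun_Sub (mem_set (measurable_split_path w)).
exists (distribution (@unif01 R) f).
have E n y : distribution (@unif01 R) f (cylinder n y) =
    (split_itv w y n).2%:E.
  rewrite /distribution /pushforward /= /unif01 /mrestr split_path_cylinder.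
  have := split_itv_ge0 w y n; have := split_itv_sub w n y.
  case: (split_itv w y n) => a l /= [a0 al1] l0.
  rewrite setIidl; last first.
    by move=> x /=; rewrite !in_itv /= => /andP[? ?]; apply/andP; split; lra.
  rewrite lebesgue_measure_itv /= lte_fin ltrDl -EFinD addrAC subrr add0r.
  by case: ltP => // ?; congr EFin; apply/eqP; rewrite eq_le l0.
split=> [|n y]; last first.
  by rewrite [LHS](E n.+1 y) [X in (X * _)%E](E n y) /= -EFinM; case: split_itv.
have -> : [set p : nat -> int | p 0%N = 0] = cylinder 0 (fun=> 0).
  by apply/seteqP; split=> [p p0 k|p /(_ 0%N isT)//]; rewrite leqn0 => /eqP ->.
by rewrite [LHS](E 0%N).
Qed.
Lemma quenched_law_unique (R : realType) (w : env R)
    (Q1 Q2 : probability path_space R) :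
  is_quenched_law w Q1 -> is_quenched_law w Q2 ->
  forall A, measurable A -> Q1 A = Q2 A.
Proof.
move=> [Q10 Q1S] [Q20 Q2S].
have mC n x : measurable (cylinder n x : set path_space).
  by apply: sub_sigma_algebra; exists n, x.
have C0 x : cylinder 0 x = [set p | p 0%N = x 0%N].
  by apply/seteqP; split=> [p /(_ 0%N isT)//|p p0 k]; rewrite leqn0 => /eqP ->.
have Q0 (Q : probability path_space R) x : Q [set p | p 0%N = 0] = 1%E ->
    Q (cylinder 0 x) = (x 0%N == 0)%:R%:E.
  move=> QE; case: eqP => [x0|x0]; first by rewrite C0 x0.
  have QC : Q (~` cylinder 0 (fun=> 0)) = 0%E.
    by rewrite probability_setC // C0 QE subee.
  apply: (subset_measure0 _ _ _ QC) => //; first exact: measurableC.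
  by move=> p; rewrite !C0 /= => ->.
have E n x : Q1 (cylinder n x) = Q2 (cylinder n x).
  by elim: n => [|n IH]; rewrite ?Q0 // Q1S Q2S IH.
pose G : set (set path_space) := [set A | exists n x, A = cylinder n x].
pose H := [set A | (G `|` [set set0; setT]) A /\ A `<=` [set: path_space]].
have HE : H = G `|` [set set0; setT].
  by apply/seteqP; split=> A; [case|split].
have QT : Q1 [set: path_space] = Q2 [set: path_space].
  by rewrite [LHS]probability_setT [RHS]probability_setT.
have HmE A : H A -> measurable A /\ Q1 A = Q2 A.
  rewrite HE => -[[n [x ->]]|[->|->]]; first by split.
  - by rewrite !measure0.
  - by split.
have sub n m x y p : (n <= m)%N -> (cylinder n x `&` cylinder m y) p ->
    cylinder n x `&` cylinder m y = cylinder m y.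
  move=> nm [pn pm]; apply: setIidr => q qy k kn.
  by rewrite qy ?(leq_trans kn) // -pm ?(leq_trans kn) // pn.
have HI : setI_closed H.
  move=> A B; rewrite HE => -[[n [x ->]]|[->|->]]; rewrite ?set0I ?setTI //.
    move=> [[m [y ->]]|[->|->]]; rewrite ?setI0 ?setIT; [|by right; left|].
    - have [->|/set0P[p pI]] := eqVneq (cylinder n x `&` cylinder m y) set0.
        by right; left.
      left; case/orP: (leq_total n m) => nm.
      + by exists m, y; apply: sub nm pI.
      + by exists n, x; rewrite setIC; rewrite setIC in pI; apply: sub nm pI.
    - by left; exists n, x.
  by move=> _; right; left.
move=> A mA.
apply: (g_sigma_algebra_measure_unique_trace (G `|` [set set0; setT]) setT) => //.
- by move=> B /HmE[].
- by move=> B /HmE[].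
- by rewrite [ltLHS]probability_setT ltry.
- rewrite -/H HE; apply: sub_smallest2r mA; last by left.
  exact: smallest_sigma_algebra.
Qed.

Definition quenched_law (R : realType) (w : env R) : probability path_space R :=
  sval (cid (quenched_law_exists w)).

Lemma quenched_lawP (R : realType) (w : env R) :
  is_quenched_law w (quenched_law w).
Proof. exact: svalP (cid (quenched_law_exists w)). Qed.

(* Main.v *)
Require Import Defs.
From HB Require Import structures.
From mathcomp Require Import all_boot all_order all_algebra.
From mathcomp Require Import all_classical all_reals all_analysis.
From mathcomp Require Import measurable_realfun.
From mathcomp Require Import ring lra zify.
Import Order.TTheory GRing.Theory Num.Theory.
Import numFieldNormedType.Exports.
Local Open Scope classical_set_scope.
Local Open Scope ring_scope.
Set Implicit Arguments.
Unset Strict Implicit.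
Unset Printing Implicit Defensive.

(** The idea is that the walk is caught at the foot of a single high barrier.
    Along the sites, the products of [rho] over consecutive sites decay, because
    [log rho] has negative mean, but they exceed [y] with probability of order
    [y ^ -s]. As [s < 1], among [t ^ s] consecutive sites one finds, with a
    probability bounded away from 0, a site [u] whose right side carries a barrier
    of height [y >= K t], although the walk needs a time at most [t / K] to reach
    [u]: both are events of the same scale, because the time to reach [u] is a sum
    of products of [rho], with the same tail of exponent [s]. At time [t] the walk
    has then reached [u], has not crossed the barrier, and has not gone far back to
    the left either.

    For a fixed environment ([quenched_valley]), the probability that the walk is at
    distance more than [L] from [u] at time [t] is at most the expected hitting time
    of [u] divided by [t], plus [t * (1 / y + q)], where [y] is a value reached by
    the products of [rho] on the first [L] sites from [u] on, and [q] is the product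
    over the [L] sites left of [u]. This is shown with two explicit functions of the
    position: the expected hitting time of [u], and a function vanishing at [u],
    superharmonic elsewhere and at least 1 beyond both walls of the valley.

    For the law of the environment, the products of [rho] form a multiplicative
    random walk whose power [s] is a martingale, since [E rho^s = 1].
    - Upper bound ([psum_tail]): by Doob's inequality a product ever exceeds [a] with
      probability at most [a ^ -s]; as [E rho^(s/2) < 1], the expected number of
      visits to a dyadic level is of the same order, and summing over the levels
      gives, for [s < 1], the tail [a ^ -s] for the sums of products.
    - Lower bound ([prob_ramp]): stopping the martingale when it leaves the interval
      between 1 and [y] shows that it leaves it upwards with probability at least
      [c y ^ -s], provided that the overshoot carries little mass; this is where
      [E rho^s log rho < oo] is used ([tail_moment_small]).

    A site is called a trap if it is reached fast, if all the products of [rho] over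
    at most [L] sites to its left are at most 1, and if it has a high barrier on its
    right. Two sites of
    the same stretch cannot both be traps ([trap_unique]), so that the probabilities,
    of order [t ^ -s] each, add up over [t ^ s] candidates to a constant
    ([prob_trapped]). The traps of a stretch are determined by a bounded window of
    sites, and the slowdown due to the sites left of the window is negligible for
    large [t] ([prob_excess]). Disjoint windows being independent, almost surely the
    attempt succeeds at arbitrarily large scales, for every given precision
    ([negligible_not_good]); [t_m] and [u_m] are then chosen with precision [1 / m].
    The barrier and the products [q] need a width of order [log t] only, hence the
    room left by the normalization [(log t) ^ 2]. *)

(** * Cylinders and independence *)

Definition ratcyl (R : realType) (c : seq (int * (rat * rat))) : set (env R) :=
  [set w | forall x, x \in c -> ratr x.2.1 < site w x.1 < ratr x.2.2].

(** Rational cylinders are countably many and form a base of the product topology: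
    hence an open set is a countable union of cylinders, and the Borel sets of the
    environment space are those generated by the cylinders. *)
Lemma open_ratcyl (R : realType) (O : set {ptws int -> unit_itv R})
    (w : {ptws int -> unit_itv R}) :
  open O -> O w -> exists2 c, @ratcyl R c w & @ratcyl R c `<=` O.
Proof.
move=> oO Ow; have : nbhs w O by apply: open_nbhs_nbhs; split.
move=> [Q [[B sB <-] [C BC Cw] sUBA]].
have sCO : C `<=` O by apply: subset_trans sUBA => x Cx; exists C.
have /sB [D sD IDeC] := BC.
have cD : forall s : seq _, {subset s <= finmap.enum_fset D} -> exists2 c, @ratcyl R c w &
      forall w', @ratcyl R c w' -> forall E, E \in s -> E w'.
  elim=> [|E s IH] sDs; first by exists [::].
  have [|c cw cs] := IH; first by move=> x xs; apply: sDs; rewrite inE xs orbT.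
  have ED : E \in finmap.enum_fset D by apply: sDs; rewrite inE eqxx.
  have [i _ [V oV VE]] := set_mem (sD _ ED).
  have [V' oV' V'V] := oV.
  have V'w : V' (@site R w i).
    have : E w by move: Cw; rewrite -IDeC; apply.
    by rewrite -VE -V'V.
  have /nbhs_ballP[e /= e0 eV'] : nbhs (@site R w i) V' by apply: open_nbhs_nbhs; split.
  have [a /itvP a1] : exists a : rat, ratr a \in `]@site R w i - e, @site R w i[.
    by apply: rat_in_itvoo; rewrite ltrBlDr ltrDl.
  have [b /itvP b1] : exists b : rat, ratr b \in `]@site R w i, @site R w i + e[.
    by apply: rat_in_itvoo; rewrite ltrDl.
  exists ((i, (a, b)) :: c).
    move=> x; rewrite inE => /orP[/eqP -> /=|/cw //].
    by rewrite a1 b1.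
  move=> w' cw' F; rewrite inE => /orP[/eqP ->|Fs]; last first.
    by apply: (cs w') => // x xc; apply: cw'; rewrite inE xc orbT.
  have /= /andP[aw wb] := cw' (i, (a, b)) (mem_head _ _).
  rewrite -VE -V'V; apply: eV'; rewrite /ball /=.
  rewrite -[X in `|_ - X|]/(@site R w' i) ltr_distlC.
  by rewrite (le_lt_trans _ aw) ?(lt_le_trans wb) // ?a1 ?b1.
have [|c cw cD'] := cD (finmap.enum_fset D); first by move=> x.
exists c => // w' cw'; apply: sCO; rewrite -IDeC => E ED.
exact: cD' cw' E ED.
Qed.

(** The sets whose probability is prescribed by [iid_env]; they are stable under
    intersection, so that they determine a law on the environments. *)
Definition cyl_system (R : realType) : set (set (env R)) :=
  [set A | exists (J : seq int) (B : int -> set R), [/\ uniq J,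
     forall i, measurable (B i) &
     A = [set w | forall i, i \in J -> B i (site w i)]]].

Lemma cyl_systemI (R : realType) : setI_closed (@cyl_system R).
Proof.
move=> _ _ [J [B [uJ mB ->]]] [K [C [uK mC ->]]].
exists (undup (J ++ K)), (fun i => (if i \in J then B i else setT) `&`
  (if i \in K then C i else setT)); split; first exact: undup_uniq.
- by move=> i; apply: measurableI; case: ifP.
- apply/seteqP; split=> w /=.
    move=> [wJ wK] i _; split; case: ifP => // h; [exact: wJ|exact: wK].
  move=> h; split=> i iJ; have := h i; rewrite mem_undup mem_cat iJ ?orbT;
    by move=> /(_ isT) [].
Qed.

Lemma measurable_site (R : realType) i :
  measurable_fun setT (fun w : env R => site w i).
Proof.
apply: (@measurability _ _ (env R) _ setT _ _ (measurable_realfun.RGenOInfty.measurableE R)).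
move=> _ [_ [x ->] <-]; rewrite setTI.
apply: sub_sigma_algebra.
have -> : (fun w : env R => site w i) @^-1` `]x, +oo[ =
   (@proj int (fun=> unit_itv R) i) @^-1` (set_val @^-1` `]x, +oo[) by [].
apply: open_comp => [w _|]; first exact: proj_continuous.
by exists `]x, +oo[%classic => //; exact: interval_open.
Qed.

Lemma measurable_cyl_system (R : realType) :
  (measurable : set (set (env R))) = <<s @cyl_system R >>.
Proof.
apply/seteqP; split; last first.
  apply: smallest_sub; first exact: sigma_algebra_measurable.
  move=> _ [J [B [uJ mB ->]]].
  have -> : [set w : env R | forall i, i \in J -> B i (site w i)] =
      \big[setI/setT]_(i <- J) ((fun w : env R => site w i) @^-1` B i).
    by rewrite -bigcap_seq; apply/seteqP; split => w /= h i; exact: h.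
  apply: big_ind => // [A A'|i _]; first exact: measurableI.
  have := @measurable_site R i.
  by move=> /(_ measurableT (B i) (mB i)); rewrite setTI.
apply: smallest_sub; first exact: smallest_sigma_algebra.
move=> O oO.
have -> : O = \bigcup_c (if `[< @ratcyl R c `<=` O >] then @ratcyl R c else set0).
  apply/seteqP; split=> [w Ow|w [c _]]; last by case: asboolP => // cO /cO.
  by have [c cw cO] := open_ratcyl oO Ow; exists c => //; case: asboolP.
apply: (@countable_bigcupT_measurable _ (g_sigma_algebraType (@cyl_system R))).
  exact: countableP.
move=> c; case: asboolP => _; last exact: measurable0.
have -> : @ratcyl R c = \big[setI/setT]_(x <- c)
    [set w : env R | ratr x.2.1 < site w x.1 < ratr x.2.2].
  by rewrite -bigcap_seq; apply/seteqP; split => w /= h i; exact: h.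
apply: big_ind => // [A A'|x _]; first exact: measurableI.
apply: sub_sigma_algebra; exists [:: x.1], (fun=> `]ratr x.2.1, ratr x.2.2[%classic).
split => //; apply/seteqP; split => w /=.
  by move=> h i; rewrite inE => /eqP ->; rewrite in_itv.
by move=> /(_ x.1 (mem_head _ _)); rewrite in_itv.
Qed.

Definition depends_on (R : realType) T (I : set int) (f : env R -> T) :=
  forall w w', (forall i, I i -> site w i = site w' i) -> f w = f w'.

(** A map [f] which depends on the sites of [I] only factors through [freeze I], so
    that [freeze I] plays the role of the sigma-algebra of these sites. *)
Definition freeze (R : realType) (I : set int) (w : env R) : env R :=
  fun i => if `[< I i >] then w i else point.

Lemma site_freeze (R : realType) (I : set int) (w : env R) i :
  site (freeze I w) i = if `[< I i >] then site w i else site (fun=> point) i.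
Proof. by rewrite /site /freeze; case: asboolP. Qed.

Lemma freeze_dep (R : realType) (I : set int) T (f : env R -> T) w :
  depends_on I f -> f (freeze I w) = f w.
Proof. by move=> d; apply: d => i Ii; rewrite site_freeze; case: asboolP. Qed.

Lemma measurable_freeze (R : realType) (I : set int) :
  measurable_fun setT (freeze I : env R -> env R).
Proof.
apply: (@measurability _ _ _ _ _ _ _ (@measurable_cyl_system R)).
move=> _ [_ [J [B [uJ mB ->]]] <-]; rewrite setTI measurable_cyl_system.
apply: sub_sigma_algebra.
exists J, (fun i => if `[< I i >] then B i else [set _ | B i (site ((fun=> point) : env R) i)]).
split=> //.
  move=> i; case: ifP => // _.
  have [h|h] := pselect (B i (site ((fun=> point) : env R) i)).
    by rewrite (_ : mkset _ = setT) //; apply/seteqP; split.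
  by rewrite (_ : mkset _ = set0) //; apply/seteqP; split.
by apply/seteqP; split => w /= h i /h; rewrite site_freeze; case: asboolP.
Qed.

Lemma measure_cyl_unique (R : realType) (m1 m2 : {measure set (env R) -> \bar R}) :
  (m1 setT < +oo)%E -> (forall A, @cyl_system R A -> m1 A = m2 A) ->
  forall A, measurable A -> m1 A = m2 A.
Proof.
move=> fin eqc A; rewrite measurable_cyl_system => mA.
have cT : @cyl_system R setT.
  by exists [::], (fun=> setT); split => //; apply/seteqP; split.
apply: (@g_sigma_algebra_measure_unique _ R (env R) (@cyl_system R) _ (fun=> setT)) => //.
- by rewrite measurable_cyl_system; exact: sub_sigma_algebra.
- by apply/seteqP; split => // x _; exists 0%N.
- exact: cyl_systemI.
Qed.

Section independence.
Variables (R : realType) (P : probability (env R) R) (P_iid : iid_env P).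

(** At each site one of the two constraints is trivial, because [freeze I] or
    [freeze (~` I)] makes the site constant; the product formula then splits. *)
Lemma indep_cyl I A B : @cyl_system R A -> @cyl_system R B ->
  P (freeze I @^-1` A `&` freeze (~` I) @^-1` B) =
  (P (freeze I @^-1` A) * P (freeze (~` I) @^-1` B))%E.
Proof.
case: P_iid => mu Pmu [J [B1 [uJ mB1 ->]]] [K [B2 [uK mB2 ->]]].
pose C I B i := if `[< I i >] then B i else [set _ : R | B i (site ((fun=> point) : env R) i)].
have mC I0 B0 : (forall i, measurable (B0 i)) -> forall i, measurable (C I0 B0 i).
  move=> mB0 i; rewrite /C; case: ifP => // _.
  have [h|h] := pselect (B0 i (site ((fun=> point) : env R) i)).
    by rewrite (_ : mkset _ = setT) //; apply/seteqP; split.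
  by rewrite (_ : mkset _ = set0) //; apply/seteqP; split.
have E I0 (B0 : int -> set R) L : freeze I0 @^-1` [set w : env R | forall i, i \in L -> B0 i (site w i)]
    = [set w | forall i, i \in L -> C I0 B0 i (site w i)].
  by apply/seteqP; split => w /= h i /h; rewrite site_freeze /C; case: asboolP.
rewrite !E !Pmu //; try exact: mC.
pose S := undup (J ++ K).
pose D1 i := if i \in J then C I B1 i else setT.
pose D2 i := if i \in K then C (~` I) B2 i else setT.
have mD1 i : measurable (D1 i) by rewrite /D1; case: ifP => // _; exact: mC.
have mD2 i : measurable (D2 i) by rewrite /D2; case: ifP => // _; exact: mC.
have uS : uniq S by exact: undup_uniq.
have -> : [set w : env R | forall i, i \in J -> C I B1 i (site w i)] `&`
   [set w | forall i, i \in K -> C (~` I) B2 i (site w i)] =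
   [set w | forall i, i \in S -> (D1 i `&` D2 i) (site w i)].
  apply/seteqP; split=> w /=.
    by move=> [h1 h2] i _; rewrite /D1 /D2; split; case: ifP => //; [move/h1|move/h2].
  move=> h; split=> i iJ; have := h i; rewrite /S mem_undup mem_cat iJ ?orbT => /(_ isT) [];
    by rewrite /D1 /D2 iJ.
rewrite (Pmu S (fun i => D1 i `&` D2 i)) //; last by move=> i; exact: measurableI.
have key L D0 D : uniq L -> {subset L <= S} ->
    (forall i, D i = if i \in L then D0 i else setT) ->
    (\prod_(i <- L) mu (D0 i) = \prod_(i <- S) mu (D i))%E.
  move=> uL LS DE.
  rewrite [RHS](bigID (fun i => i \in L)) /= [X in (_ * X)%E]big1 ?mule1; last first.
    by move=> i /negbTE iL; rewrite DE iL probability_setT.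
  rewrite -[RHS]big_filter; rewrite (perm_big [seq i <- S | i \in L]) /=.
    rewrite !big_seq; apply: eq_bigr => i; rewrite mem_filter DE => /andP[-> _] //.
  apply: uniq_perm => //; first exact: filter_uniq.
  by move=> i; rewrite mem_filter; case: (boolP (i \in L)) => // /LS ->.
rewrite (key J _ D1) //; last by move=> i iJ; rewrite mem_undup mem_cat iJ.
rewrite (key K _ D2) //; last by move=> i iJ; rewrite mem_undup mem_cat iJ orbT.
rewrite -big_split /=; apply: eq_bigr => i _.
have full (D : set R) : D = setT \/ D = set0 -> forall D', mu (D `&` D') = (mu D * mu D')%E.
  by move=> [->|->] D'; rewrite ?setTI ?set0I ?probability_setT ?mul1e ?measure0 ?mul0e.
have triv I0 B0 L : ~ I0 i ->
    (fun i => if i \in L then C I0 B0 i else setT) i = setT \/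
    (fun i => if i \in L then C I0 B0 i else setT) i = set0.
  move=> nI /=; case: ifP => _; last by left.
  rewrite /C; case: asboolP => // _.
  have [h|h] := pselect (B0 i (site ((fun=> point) : env R) i)); [left|right];
    by apply/seteqP; split.
have [Ii|nI] := pselect (I i); last exact/full/triv.
rewrite setIC muleC; apply/full/triv; exact.
Qed.

(** Passes from cylinders to measurable sets, in one argument and then in the other,
    by uniqueness of a finite measure with given values on the cylinders. *)
Lemma indep_freeze I A B : measurable A -> measurable B ->
  P (freeze I @^-1` A `&` freeze (~` I) @^-1` B) =
  (P (freeze I @^-1` A) * P (freeze (~` I) @^-1` B))%E.
Proof.
have mf I0 C : measurable C -> measurable (freeze I0 @^-1` C : set (env R)).
  by move=> mC; rewrite -[X in measurable X]setTI; exact: measurable_freeze.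
have step I0 (A0 : set (env R)) : measurable A0 ->
   (forall B, @cyl_system R B -> P (freeze I0 @^-1` B `&` A0) = (P A0 * P (freeze I0 @^-1` B))%E) ->
   forall B, measurable B -> P (freeze I0 @^-1` B `&` A0) = (P A0 * P (freeze I0 @^-1` B))%E.
  move=> mA h B0 mB0.
  have mf0 : measurable_fun setT (freeze I0 : env R -> env R) by exact: measurable_freeze.
  pose m1' := pushforward (mrestr P mA) (freeze I0) : {measure set (env R) -> \bar R}.
  pose m1 := m1' mf0.
  have r0 : 0 <= fine (P A0) by rewrite fine_ge0.
  pose m2' := mscale (NngNum r0) (pushforward P (freeze I0)) : {measure set (env R) -> \bar R}.
  pose m2 := m2' mf0.
  have m2E C : m2 C = (P A0 * P (freeze I0 @^-1` C))%E.
    by rewrite /m2 /m2' /= /mscale /= fineK //; exact: (fin_num_measure P A0 mA).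
  rewrite -m2E; apply: (@measure_cyl_unique R m1 m2) => //.
    rewrite /m1 /m1' /= /pushforward /= /mrestr preimage_setT setTI.
    exact: le_lt_trans (probability_le1 P mA) (ltry _).
  by move=> C cC; rewrite m2E -h.
move=> mA mB; rewrite muleC; apply: (step _) => //; first exact: mf.
move=> C cC; rewrite setIC muleC; apply: (step _) => //.
  by apply: mf; rewrite measurable_cyl_system; exact: sub_sigma_algebra.
by move=> D cD; rewrite setIC indep_cyl // muleC setIC.
Qed.

Lemma indep_sets I (A B : set (env R)) : measurable A -> measurable B ->
  depends_on I A -> depends_on (~` I) B -> P (A `&` B) = (P A * P B)%E.
Proof.
move=> mA mB dA dB.
have E (J : set int) (C : set (env R)) : depends_on J C -> freeze J @^-1` C = C.
  by move=> dC; apply/funext => w; exact: freeze_dep.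
by have := @indep_freeze I A B mA mB; rewrite !E.
Qed.

End independence.

(** * The multiplicative walk of odds *)

Definition odds (R : realType) (w : env R) (i : int) : R :=
  (1 - site w i) / site w i.

Lemma oddsE (R : realType) (w : env R) i :
  odds w i = (1 - site w i) * site w i `^ (-1).
Proof. by have /andP[h0 h1] := site_itv w i; rewrite powR_inv1. Qed.

Lemma odds_ge0 (R : realType) (w : env R) i : 0 <= odds w i.
Proof. by have /andP[h0 h1] := site_itv w i; rewrite divr_ge0 ?subr_ge0. Qed.

Lemma measurable_odds (R : realType) i : measurable_fun setT (fun w : env R => odds w i).
Proof.
have -> : (fun w : env R => odds w i) =
    (fun w => (1 - site w i) * site w i `^ (-1)) by apply/funext => w; exact: oddsE.
apply: measurable_funM.
  by apply: measurable_funB => //; exact: measurable_site.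
apply: (measurableT_comp (measurable_powR _)); exact: measurable_site.
Qed.

(** Nonnegative measurable functions, for which integrals need no integrability
    condition. *)
Definition nnm (R : realType) (phi : R -> \bar R) :=
  measurable_fun setT phi /\ forall x, (0 <= phi x)%E.

Section transition.
Variables (R : realType) (P : probability (env R) R) (P_iid : iid_env P).
Local Open Scope ereal_scope.

(** Transition operator of the Markov chain [x -> x * rho]. *)
Definition trans (phi : R -> \bar R) (x : R) : \bar R :=
  \int[P]_w phi (x * odds w 0)%R.

Lemma measurable_mulodds x i : measurable_fun setT (fun w : env R => x * odds w i)%R.
Proof. by apply: measurable_funM => //; exact: measurable_odds. Qed.

Lemma nnm_comp phi x i : nnm phi -> measurable_fun setT (fun w : env R => phi (x * odds w i)%R).
Proof.
by move=> [m _]; apply: (measurableT_comp m); exact: measurable_mulodds.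
Qed.

Lemma trans_nnm phi : nnm phi -> nnm (trans phi).
Proof.
move=> [m p]; split; last by move=> x; exact: integral_ge0.
have -> : trans phi = fubini_F P (fun z : R * env R => phi (z.1 * odds z.2 0)%R) by [].
apply: measurable_fun_fubini_tonelli_F => //.
apply: (measurableT_comp m); apply: measurable_funM => //.
exact: (measurableT_comp (@measurable_odds R 0) measurable_snd).
Qed.

Lemma iter_trans_nnm n phi : nnm phi -> nnm (iter n trans phi).
Proof. by move=> h; elim: n => // n IH; exact: trans_nnm. Qed.

Lemma le_trans_op phi psi : nnm phi -> nnm psi ->
  (forall x, (0 <= x)%R -> phi x <= psi x) ->
  forall x, (0 <= x)%R -> trans phi x <= trans psi x.
Proof.
move=> hp hq le x x0; apply: ge0_le_integral => //.
- by move=> w _; case: hp.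
- exact: nnm_comp.
- exact: nnm_comp.
- by move=> w _; apply: le; rewrite mulr_ge0 ?odds_ge0.
Qed.

Lemma trans_add phi psi x : nnm phi -> nnm psi ->
  trans (fun y => phi y + psi y) x = trans phi x + trans psi x.
Proof.
move=> hp hq; apply: ge0_integralD => //.
- by move=> w _; case: hp.
- exact: nnm_comp.
- by move=> w _; case: hq.
- exact: nnm_comp.
Qed.

Lemma trans_scale phi (k : R) x : (0 <= k)%R -> nnm phi ->
  trans (fun y => k%:E * phi y) x = k%:E * trans phi x.
Proof.
move=> k0 hp; apply: ge0_integralZl_EFin => //; last exact: nnm_comp.
by move=> w _; case: hp.
Qed.

Lemma trans_sum (I : Type) (s : seq I) (phi : I -> R -> \bar R) x :
  (forall i, nnm (phi i)) ->
  trans (fun y => \sum_(i <- s) phi i y) x = \sum_(i <- s) trans (phi i) x.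
Proof.
move=> hp; apply: ge0_integral_sum => //; last by move=> i w _; case: (hp i).
by move=> i; exact: nnm_comp.
Qed.

Lemma odds_ident i (B : set R) : measurable B ->
  P [set w | B (odds w i)] = P [set w | B (odds w 0)].
Proof.
move=> mB; case: P_iid => mu Pmu.
pose f (v : R) : R := ((1 - v) * v `^ (-1))%R.
have mf : measurable (f @^-1` B).
  rewrite -[X in measurable X]setTI.
  suff : measurable_fun setT f by apply.
  apply: measurable_funM; first exact: measurable_funB.
  exact: measurable_powR.
have E j : P [set w | B (odds w j)] = mu (f @^-1` B).
  have := Pmu [:: j] (fun=> f @^-1` B) isT (fun=> mf).
  rewrite big_seq1 => <-; congr (P _); apply/seteqP; split => w /=.
    by move=> h k; rewrite inE => /eqP ->; rewrite /f -oddsE.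
  by move=> /(_ j (mem_head _ _)); rewrite /f -oddsE.
by rewrite !E.
Qed.

(** The law of [(Z, odds w i)] is a product measure, and the site [i] is integrated
    first; by stationarity it can be replaced by the site 0. *)
Lemma indep_odds (I : set int) i (Z : env R -> R) (phi : R * R -> \bar R) :
  ~ I i -> measurable_fun setT Z -> depends_on I Z ->
  measurable_fun setT phi -> (forall z, 0 <= phi z) ->
  \int[P]_w phi (Z w, odds w i) = \int[P]_w \int[P]_w' phi (Z w, odds w' 0).
Proof.
move=> nIi mZ dZ mphi phi0.
have mo j := @measurable_odds R j.
have mp : measurable_fun setT (fun w => (Z w, odds w i)).
  exact/measurable_fun_pair.
pose f : {mfun env R >-> R} := mfun_Sub (mem_set mZ).
pose g : {mfun env R >-> R} := mfun_Sub (mem_set (mo 0%R)).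
pose m1 := distribution P f.
pose m2 := distribution P g.
pose J' := pushforward P (fun w => (Z w, odds w i)) : {measure set (R * R) -> \bar R}.
pose J := J' mp.
have JE A : measurable A -> (m1 \x m2) A = J A.
  apply: product_measure_unique => A0 B0 mA0 mB0.
  transitivity (P [set w | A0 (Z w)] * P [set w | B0 (odds w 0%R)])%E; last by [].
  rewrite -(odds_ident i mB0).
  have mA' : measurable [set w | A0 (Z w)].
    by have := mZ measurableT _ mA0; rewrite setTI.
  have mB' : measurable [set w | B0 (odds w i)].
    by have := mo i measurableT _ mB0; rewrite setTI.
  have := @indep_sets R P P_iid I [set w | A0 (Z w)] [set w | B0 (odds w i)] mA' mB'.
  apply.
    by move=> w w' /dZ /= ->.
  by move=> w w' h /=; rewrite /odds h.
have -> : \int[P]_w phi (Z w, odds w i) = \int[J]_z phi z.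
  by rewrite /J /J' /= ge0_integral_pushforward.
have -> : \int[J]_z phi z = \int[m1 \x m2]_z phi z.
  by apply: eq_measure_integral => A mA _; rewrite -JE.
rewrite fubini_tonelli1 // /m1 /distribution ge0_integral_pushforward //=.
- apply: eq_integral => w _ /=; rewrite /fubini_F.
  rewrite /m2 /distribution ge0_integral_pushforward //=.
  exact: measurableT_comp.
- exact: measurable_fun_fubini_tonelli_F.
- by move=> x _; exact: integral_ge0.
Qed.

Lemma integral_odds phi i : nnm phi -> \int[P]_w phi (odds w i) = trans phi 1.
Proof.
move=> [m p].
have := @indep_odds set0 i (cst 1%R) (phi \o snd) (fun h => h) _ _ _ _.
rewrite /= => -> //.
- rewrite integral_cst //= [X in _ * X]probability_setT mule1.
  by apply: eq_integral => w _; rewrite mul1r.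
- exact: measurableT_comp.
Qed.

(** The chain of [trans], realized in the environment along the sites listed by [e]
    and stopped when it enters [d]. Taking [e] arbitrary covers the walks to the right
    and to the left of any site. *)
Fixpoint chain (d : R -> bool) (X0 : env R -> R) (e : nat -> int) (k : nat) (w : env R) : R :=
  if k is k'.+1 then
    let z := chain d X0 e k' w in if d z then z else (z * odds w (e k'))%R
  else X0 w.

Definition stoptrans (d : R -> bool) (phi : R -> \bar R) (x : R) : \bar R :=
  if d x then phi x else trans phi x.

Lemma stoptrans_nnm d phi : measurable_fun setT d -> nnm phi -> nnm (stoptrans d phi).
Proof.
move=> md hp; have [mt pt] := trans_nnm hp; case: hp => m p; split.
  exact: measurable_fun_ifT.
by move=> x; rewrite /stoptrans; case: ifP.
Qed.

Lemma measurable_chain d X0 e k : measurable_fun setT d -> measurable_fun setT X0 ->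
  measurable_fun setT (chain d X0 e k).
Proof.
move=> md mX; elim: k => // k IH /=; apply: measurable_fun_ifT => //.
  exact: measurableT_comp.
by apply: measurable_funM => //; exact: measurable_odds.
Qed.

Lemma chain_dep d X0 e k (I : set int) : depends_on I X0 ->
  depends_on (I `|` [set i | exists2 j, (j < k)%N & i = e j]) (chain d X0 e k).
Proof.
move=> dX; elim: k => [|k IH] w w' h /=.
  by apply: dX => i Ii; apply: h; left.
rewrite (IH w w'); last first.
  move=> i [Ii|[j jk ->]]; apply: h; first by left.
  by right; exists j => //; exact: ltnW.
by case: ifP => // _; rewrite /odds h //; right; exists k.
Qed.

(** Markov property: the last site read is integrated first. *)
Lemma integral_chain d X0 e k phi (I : set int) :
  measurable_fun setT d -> measurable_fun setT X0 -> depends_on I X0 ->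
  injective e -> (forall j, ~ I (e j)) -> nnm phi ->
  \int[P]_w phi (chain d X0 e k w) = \int[P]_w (iter k (stoptrans d) phi) (X0 w).
Proof.
move=> md mX dX ie nI; elim: k phi => // k IH phi hp.
rewrite iterSr -IH /=; last exact: stoptrans_nnm.
pose Phi (z : R * R) := phi (if d z.1 then z.1 else z.1 * z.2)%R.
have [m p] := hp.
transitivity (\int[P]_w Phi (chain d X0 e k w, odds w (e k))).
  by apply: eq_integral => w _; rewrite /Phi /=.
rewrite (@indep_odds (I `|` [set i | exists2 j, (j < k)%N & i = e j])) //.
- apply: eq_integral => w _; rewrite /Phi /stoptrans /=; case: ifP => // _.
  by rewrite integral_cst //= [X in _ * X]probability_setT mule1.
- by move=> [/nI //|[j jk /ie kj]]; rewrite kj ltnn in jk.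
- exact: measurable_chain.
- exact: chain_dep.
- apply: (measurableT_comp m); apply: measurable_fun_ifT => //.
    exact: measurableT_comp.
  exact: measurable_funM.
- by move=> z; exact: p.
Qed.

End transition.

(** * Maximal inequality and occupation bounds *)

Section potential.
Variables (R : realType) (P : probability (env R) R).
Local Open Scope ereal_scope.
Local Notation T := (trans P).

Lemma nnm_ge0 (phi : R -> \bar R) x : nnm phi -> 0 <= phi x.
Proof. by case. Qed.

Lemma one_powR (a : R) : (1 `^ a = 1 :> R)%R.
Proof. by rewrite powR1. Qed.

Definition pw (a : R) (x : R) : \bar R := (x `^ a)%:E.

Lemma pw_nnm a : nnm (pw a).
Proof.
split; last by move=> x; rewrite lee_fin powR_ge0.
by apply/measurable_EFinP; exact: measurable_powR.
Qed.

Lemma nnm_scale (k : R) (phi : R -> \bar R) : (0 <= k)%R -> nnm phi -> nnm (fun x => k%:E * phi x).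
Proof.
move=> k0 [m p]; split; first exact: measurable_funeM.
by move=> x; rewrite mule_ge0 // lee_fin.
Qed.

Lemma nnm_add (phi psi : R -> \bar R) : nnm phi -> nnm psi -> nnm (fun x => phi x + psi x).
Proof.
move=> [m p] [m' p']; split; first exact: emeasurable_funD.
by move=> x; rewrite adde_ge0.
Qed.

Lemma nnm_sum (I : Type) (l : seq I) (phi : I -> R -> \bar R) : (forall i, nnm (phi i)) ->
  nnm (fun x => \sum_(i <- l) phi i x).
Proof.
move=> h; split; first by apply: emeasurable_sum => i; case: (h i).
by move=> x; apply: sume_ge0 => i _; case: (h i).
Qed.

Lemma trans_pw a x : (0 <= x)%R -> T (pw a) x = pw a x * T (pw a) 1.
Proof.
move=> x0; rewrite /trans /pw -ge0_integralZl_EFin ?powR_ge0 //.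
- by apply: eq_integral => w _; rewrite mul1r -EFinM powRM ?odds_ge0.
- by move=> w _; rewrite lee_fin powR_ge0.
- exact: (nnm_comp 1 0 (pw_nnm a)).
Qed.

Lemma trans_cst k x : T (fun=> k%:E) x = k%:E.
Proof. by rewrite /trans integral_cst //= [X in _ * X]probability_setT mule1. Qed.

Variables (s r : R).
Hypotheses (s_gt0 : (0 < s)%R) (s_lt1 : (s < 1)%R) (r_ge0 : (0 <= r)%R) (r_lt1 : (r < 1)%R).
Hypotheses (Es : T (pw s) 1 = 1) (Er : T (pw (s / 2)) 1 = r%:E).

Lemma iter_trans_pw_le phi (c : R) k x : nnm phi -> (0 <= c)%R ->
  (forall x, (0 <= x)%R -> phi x <= (c * x `^ (s / 2))%:E) -> (0 <= x)%R ->
  iter k T phi x <= (c * r ^+ k * x `^ (s / 2))%:E.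
Proof.
move=> hp c0 le; elim: k x => [|k IH] x x0; first by rewrite /= expr0 mulr1; exact: le.
have ck : (0 <= c * r ^+ k)%R by rewrite mulr_ge0 ?exprn_ge0.
rewrite iterS; apply: (@le_trans _ _ (T (fun y => (c * r ^+ k)%:E * pw (s / 2) y) x)).
  apply: le_trans_op => //; first exact: iter_trans_nnm.
  exact/nnm_scale/pw_nnm.
rewrite trans_scale //; last exact: pw_nnm.
by rewrite trans_pw // Er /pw -!EFinM lee_fin exprS; nra.
Qed.

Lemma powR_half (x : R) : (x `^ s = x `^ (s / 2) * x `^ (s / 2))%R.
Proof. by rewrite -powRD -splitr // gt_eqF. Qed.

(** A superharmonic majorant of the probability of ever reaching the level [l]. *)
Definition minpw (l : R) (x : R) : \bar R := (Num.min 1 ((x / l) `^ s))%:E.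

Lemma minpw_nnm (l : R) : nnm (minpw l).
Proof.
split; last by move=> x; rewrite lee_fin le_min ler01 powR_ge0.
apply/measurable_EFinP/measurable_minr => //.
by apply: (measurableT_comp (measurable_powR _)); exact: measurable_funM.
Qed.

Lemma minpw1_le x : minpw 1 x <= pw (s / 2) x.
Proof.
rewrite /minpw /pw divr1 lee_fin powR_half.
have := powR_ge0 x (s / 2); move: (x `^ (s / 2))%R => z z0.
by rewrite ge_min; have [z1|z1] := leP 1%R z; [rewrite ?z1 ?orTb //|apply/orP; right; nra].
Qed.

(** The minimum of two harmonic functions, [1] and [(x / l) ^ s]; the second is
    harmonic because [E rho^s = 1]. *)
Lemma trans_minpw (l x : R) : (0 < l)%R -> (0 <= x)%R -> T (minpw l) x <= minpw l x.
Proof.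
move=> l0 x0; rewrite /minpw; have [h|h] := leP 1%R ((x / l) `^ s)%R.
  rewrite -[leRHS](trans_cst 1%R x); apply: le_trans_op => //.
  - exact: minpw_nnm.
  - by move=> y _; rewrite lee_fin ge_min lexx.
have li : (0 <= l^-1)%R by rewrite invr_ge0 ltW.
have -> : ((x / l) `^ s)%:E = T (fun y => (l^-1 `^ s)%:E * pw s y) x.
  rewrite trans_scale ?powR_ge0 //; last exact: pw_nnm.
  by rewrite trans_pw // Es mule1 /pw -EFinM mulrC -powRM // mulrC.
apply: le_trans_op => //.
- exact: minpw_nnm.
- by apply: nnm_scale; [exact: powR_ge0|exact: pw_nnm].
- by move=> y y0; rewrite /pw -EFinM lee_fin -powRM // ge_min mulrC lexx orbT.
Qed.

Definition ind (d : R -> bool) (x : R) : \bar R := if d x then 1 else 0.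

Lemma ind_nnm (d : R -> bool) : measurable_fun setT d -> nnm (ind d).
Proof.
by move=> md; split; [exact: measurable_fun_ifT|move=> x; rewrite /ind; case: ifP].
Qed.

Lemma iter_stoptrans_nnm (d : R -> bool) k phi : measurable_fun setT d -> nnm phi ->
  nnm (iter k (stoptrans P d) phi).
Proof. by move=> md hp; elim: k => // k; exact: stoptrans_nnm. Qed.

(** Doob's maximal inequality for the martingale of the powers [s]: the bound holds
    on [d] and it is superharmonic, hence it propagates through the stopped chain. *)
Lemma doob (d : R -> bool) (a : R) k (x : R) : measurable_fun setT d -> (0 < a)%R -> (forall y, d y -> (a <= y)%R) ->
  (0 <= x)%R -> iter k (stoptrans P d) (ind d) x <= minpw a x.
Proof.
move=> md a0 da; elim: k x => [|k IH] x x0.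
  rewrite /= /ind /minpw; case: ifP => [/da ax|_]; last first.
    by rewrite lee_fin le_min ler01 powR_ge0.
  rewrite lee_fin le_min lexx /= -[leLHS](one_powR s).
  by rewrite ge0_ler_powR ?nnegrE ?(ltW s_gt0) ?divr_ge0 ?(ltW a0) // ler_pdivlMr // mul1r.
rewrite iterS {1}/stoptrans; case: ifP => _; first exact: IH.
apply: le_trans (trans_minpw a0 x0); apply: le_trans_op => //.
  exact/iter_stoptrans_nnm/ind_nnm.
exact: minpw_nnm.
Qed.

Definition lvl (l : R) := ind (fun x => (l <= x) && (x < 2 * l))%R.

Lemma lvl_nnm l : nnm (lvl l).
Proof.
apply: ind_nnm; apply: measurable_and.
  exact: (measurable_fun_ler (measurable_cst l) (@measurable_id _ _ setT)).
exact: (measurable_fun_ltr (@measurable_id _ _ setT) (measurable_cst (2 * l)%R)).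
Qed.

Lemma geo_sum_le m : (\sum_(k < m) r ^+ k <= (1 - r)^-1)%R.
Proof.
have h : (0 < 1 - r)%R by rewrite subr_gt0.
rewrite -(ler_pM2l h) mulfV ?gt_eqF // -opprB mulNr.
have -> : ((r - 1) * \sum_(k < m) r ^+ k)%R = (r ^+ m - 1)%R by rewrite subrX1.
by rewrite opprB lerBlDr lerDl exprn_ge0.
Qed.

Definition green m phi x := \sum_(k < m) iter k T phi x.

Lemma green_nnm m phi : nnm phi -> nnm (green m phi).
Proof. by move=> h; apply: nnm_sum => k; exact: iter_trans_nnm. Qed.

Lemma greenS m phi x : nnm phi -> green m.+1 phi x = phi x + T (green m phi) x.
Proof.
move=> h; rewrite /green big_ord_recl /= trans_sum //.
by move=> k; exact: iter_trans_nnm.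
Qed.

Definition visit_bound : R := (2 / (1 - r))%R.

Lemma visit_bound_ge0 : (0 <= visit_bound)%R.
Proof. by rewrite divr_ge0 // subr_ge0 ltW. Qed.

(** From a point of the dyadic level, the powers [s / 2] decay geometrically in mean,
    since [E rho^(s/2) = r < 1], which bounds the number of visits by a constant; from
    other points, the bound propagates because [minpw] is superharmonic. *)
Lemma visits m (l x : R) : (0 < l)%R -> (0 <= x)%R ->
  green m (lvl l) x <= visit_bound%:E * minpw l x.
Proof.
move=> l0; elim: m x => [|m IH] x x0.
  by rewrite /green big_ord0 mule_ge0 ?lee_fin ?visit_bound_ge0 //; exact: (nnm_ge0 _ (minpw_nnm l)).
have s2 : (0 <= s / 2)%R by rewrite divr_ge0 // ltW.
have li : (0 <= l^-1)%R by rewrite invr_ge0 ltW.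
have [xl|xl] := boolP ((l <= x) && (x < 2 * l))%R.
  have [lx x2l] := andP xl.
  have xl1 : (1 <= x / l)%R by rewrite ler_pdivlMr // mul1r.
  have -> : minpw l x = 1.
    rewrite /minpw min_l // -[leLHS](one_powR s) ge0_ler_powR ?nnegrE ?(ltW s_gt0) //.
    by rewrite divr_ge0 // ltW.
  rewrite mule1.
  apply: (@le_trans _ _ (\sum_(k < m.+1) ((l^-1 `^ (s/2) * r ^+ k * x `^ (s / 2))%R%:E))).
    apply: lee_sum => k _; apply: iter_trans_pw_le => //.
    - exact: lvl_nnm.
    - exact: powR_ge0.
    - move=> y y0; rewrite /lvl /ind; case: ifP => [/andP[ly _]|_]; last first.
        by rewrite lee_fin mulr_ge0 ?powR_ge0.
      rewrite lee_fin -powRM // -[leLHS](one_powR (s/2)) ge0_ler_powR // ?nnegrE ?mulr_ge0 //.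
      by rewrite mulrC ler_pdivlMr // mul1r.
  rewrite sumEFin lee_fin -mulr_suml -mulr_sumr mulrAC -powRM //.
  apply: ler_pM; rewrite ?powR_ge0 ?sumr_ge0 //; last exact: geo_sum_le.
  - by move=> k _; exact: exprn_ge0.
  - apply: (@le_trans _ _ ((2 : R) `^ (s / 2))%R).
      rewrite ge0_ler_powR // ?nnegrE ?mulr_ge0 //.
      by rewrite mulrC ler_pdivrMr // ltW.
    rewrite -[leRHS]powRr1 // ler_powR //; move: s_lt1 s_gt0; lra.
rewrite greenS; last exact: lvl_nnm.
rewrite {1}/lvl /ind (negbTE xl) add0e.
apply: (@le_trans _ _ (T (fun y => visit_bound%:E * minpw l y) x)).
  apply: le_trans_op => //; first exact/green_nnm/lvl_nnm.
  by apply: nnm_scale; [exact: visit_bound_ge0|exact: minpw_nnm].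
rewrite trans_scale ?visit_bound_ge0 //; last exact: minpw_nnm.
by apply: lee_wpmul2l; [rewrite lee_fin visit_bound_ge0|exact: trans_minpw].
Qed.

Definition trunc (J : nat) (x : R) : \bar R :=
  if ((0 <= x) && (x < 2 ^+ J))%R then x%:E else 0.

Lemma trunc_nnm J : nnm (trunc J).
Proof.
split; last by move=> x; rewrite /trunc; case: ifP => // /andP[x0 _]; rewrite lee_fin.
have mE : measurable_fun setT (EFin \o @id R) by apply/measurable_EFinP.
have h1 : measurable_fun setT (fun x : R => 0 <= x)%R by apply: measurable_fun_ler.
have h2 : measurable_fun setT (fun x : R => x < 2 ^+ J)%R by apply: measurable_fun_ltr.
by apply: measurable_fun_ifT => //; exact: measurable_and.
Qed.

Lemma dyadic (J : nat) (x : R) : (1 <= x)%R -> (x < 2 ^+ J)%R ->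
  exists2 j : 'I_J, (2 ^+ j <= x)%R & (x < 2 * 2 ^+ j)%R.
Proof.
move=> x1; elim: J => [|J IH] xJ; first by rewrite expr0 ltNge x1 in xJ.
have [h|h] := ltP x (2 ^+ J)%R; last by exists ord_max => //; rewrite -exprS.
by have [j h1 h2] := IH h; exists (widen_ord (leqnSn J) j).
Qed.

(** The products below 1 are controlled by their power [s / 2], whose expected sum is
    geometric; the others are controlled by the number of visits to their dyadic
    level. *)
Lemma trunc_le J x : (0 <= x)%R ->
  trunc J x <= pw (s / 2) x + \sum_(j < J) (2 ^+ j.+1)%:E * lvl (2 ^+ j) x.
Proof.
move=> x0.
have sum0 : 0 <= \sum_(j < J) (2 ^+ j.+1)%:E * lvl (2 ^+ j) x.
  by apply: sume_ge0 => j _; rewrite mule_ge0 ?lee_fin ?exprn_ge0 //; exact: (nnm_ge0 _ (lvl_nnm (2 ^+ j))).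
rewrite /trunc x0 /=; case: ifPn => [xJ|_]; last first.
  by rewrite adde_ge0 // lee_fin powR_ge0.
have [x1|x1] := ltP x 1%R.
  apply: le_trans (leeDl _ sum0); rewrite lee_fin.
  have [->|xn0] := eqVneq x 0%R; first exact: powR_ge0.
  by rewrite ger1_powR ?lt0r ?xn0 ?x0 ?(ltW x1) //; move: s_lt1; lra.
have [j h1 h2] := dyadic x1 xJ.
rewrite (bigD1 j) //= {1}/lvl /ind h1 h2 /= mule1.
have sum1 : 0 <= \sum_(i < J | i != j) (2 ^+ i.+1)%:E * lvl (2 ^+ i) x.
  by apply: sume_ge0 => i _; rewrite mule_ge0 ?lee_fin ?exprn_ge0 //; exact: (nnm_ge0 _ (lvl_nnm (2 ^+ i))).
rewrite addeA -[leLHS]adde0 leeD // -[leLHS]add0e leeD //; first by rewrite lee_fin powR_ge0.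
by rewrite lee_fin exprS ltW.
Qed.

End potential.

(** * Truncated sums of products and completion of a ramp *)

Section renewal.
Variables (R : realType) (P : probability (env R) R).
Local Open Scope ereal_scope.
Local Notation T := (trans P).

Lemma trans_eq phi psi x : (forall y, (0 <= y)%R -> phi y = psi y) -> (0 <= x)%R ->
  T phi x = T psi x.
Proof.
by move=> h x0; apply: eq_integral => w _; apply: h; rewrite mulr_ge0 ?odds_ge0.
Qed.

Section stopped.
Variable d : R -> bool.
Hypothesis md : measurable_fun setT d.
Local Notation S := (stoptrans P d).

Lemma iter_stoptrans_le k phi psi x : nnm phi -> nnm psi ->
  (forall y, (0 <= y)%R -> phi y <= psi y) -> (0 <= x)%R ->
  iter k S phi x <= iter k S psi x.
Proof.
move=> hp hq le; elim: k x => [|k IH] x x0; first exact: le.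
rewrite !iterS /stoptrans; case: ifP => _; first exact: IH.
by apply: le_trans_op => //; exact: iter_stoptrans_nnm.
Qed.

Lemma iter_stoptransD k phi psi x : nnm phi -> nnm psi ->
  iter k S (fun y => phi y + psi y) x = iter k S phi x + iter k S psi x.
Proof.
move=> hp hq; elim: k x => [//|k IH] x.
rewrite !iterS /stoptrans; case: ifP => _; first exact: IH.
rewrite -trans_add; [|exact: iter_stoptrans_nnm..].
by congr (trans P _ x); apply/funext => y; exact: IH.
Qed.

Lemma iter_stoptransZ k phi (c : R) x : (0 <= c)%R -> nnm phi ->
  iter k S (fun y => c%:E * phi y) x = c%:E * iter k S phi x.
Proof.
move=> c0 hp; elim: k x => [//|k IH] x.
rewrite !iterS /stoptrans; case: ifP => _; first exact: IH.
rewrite -trans_scale //; last exact: iter_stoptrans_nnm.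
by congr (trans P _ x); apply/funext => y; exact: IH.
Qed.

Lemma iter_stoptrans_stop k phi x : d x -> iter k S phi x = phi x.
Proof. by move=> dx; elim: k => // k IH; rewrite iterS /stoptrans dx. Qed.

End stopped.

Let m0 : measurable_fun setT (pred0 : R -> bool).
Proof. exact: measurable_cst. Qed.

Lemma green_le m phi psi x : nnm phi -> nnm psi ->
  (forall y, (0 <= y)%R -> phi y <= psi y) -> (0 <= x)%R ->
  green P m phi x <= green P m psi x.
Proof.
by move=> hp hq le x0; apply: lee_sum => k _; exact: (iter_stoptrans_le m0).
Qed.

Lemma greenD m phi psi x : nnm phi -> nnm psi ->
  green P m (fun y => phi y + psi y) x = green P m phi x + green P m psi x.
Proof.
move=> hp hq; rewrite /green -big_split /=; apply: eq_bigr => k _.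
exact: (iter_stoptransD m0).
Qed.

Lemma greenZ m phi (c : R) x : (0 <= c)%R -> nnm phi ->
  green P m (fun y => c%:E * phi y) x = c%:E * green P m phi x.
Proof.
move=> c0 hp; rewrite /green ge0_sume_distrr; last first.
  by move=> k _; exact/nnm_ge0/iter_trans_nnm.
by apply: eq_bigr => k _; exact: (iter_stoptransZ m0).
Qed.

Lemma green_sum m (I : Type) (l : seq I) (phi : I -> R -> \bar R) x :
  (forall i, nnm (phi i)) ->
  green P m (fun y => \sum_(i <- l) phi i y) x = \sum_(i <- l) green P m (phi i) x.
Proof.
move=> h; elim: l => [|a l IH].
  rewrite big_nil; under eq_fun do rewrite big_nil.
  have -> : (fun=> 0) = (fun y : R => 0%:E * pw 1 y) by apply/funext => y; rewrite mul0e.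
  by rewrite greenZ ?mul0e //; exact: pw_nnm.
rewrite big_cons -IH -greenD //; last exact: nnm_sum.
by congr (green _ _ _ _); apply/funext => y; rewrite big_cons.
Qed.

Variables (s r : R).
Hypotheses (s_gt0 : (0 < s)%R) (s_lt1 : (s < 1)%R) (r_ge0 : (0 <= r)%R) (r_lt1 : (r < 1)%R).
Hypotheses (Es : T (pw s) 1 = 1) (Er : T (pw (s / 2)) 1 = r%:E).
Let visit_bound := visit_bound r.
Let Cv0 : (0 <= visit_bound)%R. Proof. exact: visit_bound_ge0. Qed.

Lemma green_lvl m j : green P m (lvl (2 ^+ j)) 1 <= (visit_bound * (2 ^+ j) `^ (- s))%:E.
Proof.
have p2 : (0 < 2 ^+ j :> R)%R by rewrite exprn_gt0.
apply: (le_trans (visits s_gt0 s_lt1 r_ge0 r_lt1 Es Er m p2 ler01)).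
rewrite -EFinM lee_fin ler_wpM2l // ge_min; apply/orP; right.
by rewrite mul1r -powR_inv1 ?(ltW p2) // -powRrM mulN1r.
Qed.

Let lam : R := (2 `^ (1 - s))%R.

Let lam1 : (1 < lam)%R.
Proof.
rewrite /lam -[ltLHS](powRr0 2) /powR gt_eqF // ltr_expR ltr_pM2r ?subr_gt0 //.
by rewrite ln_gt0 // ltr1n.
Qed.

Lemma pow2_powR (j : nat) (a : R) : ((2 ^+ j) `^ a = (2 `^ a) ^+ j :> R)%R.
Proof.
have h2 : (0 <= 2 :> R)%R by [].
by rewrite -(powR_mulrn j h2) -(powR_mulrn j (powR_ge0 2 a)) -!powRrM mulrC.
Qed.

Definition green_bound : R := ((1 - r)^-1 + 2 * visit_bound / (2 `^ (1 - s) - 1))%R.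

Lemma green_bound_ge0 : (0 <= green_bound)%R.
Proof.
apply: addr_ge0; first by rewrite invr_ge0 subr_ge0 ltW.
apply: divr_ge0; first by rewrite mulr_ge0.
by rewrite subr_ge0 ltW.
Qed.

(** The dyadic level [2 ^ j] is visited [O(2 ^ (- j s))] times in mean and contributes
    [O(2 ^ (j (1 - s)))]. As [s < 1] the last level dominates the sum. *)
Lemma green_trunc m J : green P m (trunc J) 1 <= (green_bound * (2 `^ (1 - s)) ^+ J)%:E.
Proof.
have hl j : nnm (fun y : R => (2 ^+ j.+1)%:E * lvl (2 ^+ j) y).
  by apply: nnm_scale; [exact: exprn_ge0|exact: lvl_nnm].
have hs := @nnm_sum R _ (index_enum 'I_J) _ (fun j : 'I_J => hl j).
apply: (@le_trans _ _ (green P m (fun x => pw (s / 2) x +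
   \sum_(j < J) (2 ^+ j.+1)%:E * lvl (2 ^+ j) x) 1)).
  apply: green_le => //; first exact: trunc_nnm.
    by apply: nnm_add => //; exact: pw_nnm.
  by move=> y y0; exact: trunc_le.
rewrite greenD //; last exact: pw_nnm.
have lamJ : (1 <= lam ^+ J)%R by rewrite exprn_ege1 // ltW.
have lam1' : (0 < lam - 1)%R by rewrite subr_gt0.
rewrite /green_bound mulrDl EFinD; apply: leeD.
  apply: (@le_trans _ _ (\sum_(k < m) (1 * r ^+ k * 1 `^ (s / 2))%R%:E)).
    apply: lee_sum => k _; apply: iter_trans_pw_le => //; first exact: pw_nnm.
    by move=> y y0; rewrite mul1r /pw.
  rewrite sumEFin lee_fin (eq_bigr (fun k : 'I_m => r ^+ k)%R); last first.
    by move=> k _; rewrite one_powR mulr1 mul1r.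
  apply: (le_trans (geo_sum_le r_ge0 r_lt1 m)).
  by rewrite ler_peMr // invr_ge0 subr_ge0 ltW.
rewrite green_sum //.
apply: (@le_trans _ _ (\sum_(j < J) (2 * visit_bound * lam ^+ j)%R%:E)).
  apply: lee_sum => j _; rewrite greenZ ?exprn_ge0 //; last exact: lvl_nnm.
  apply: (@le_trans _ _ ((2 ^+ j.+1)%:E * (visit_bound * (2 ^+ j) `^ (- s))%:E)).
    by apply: lee_wpmul2l; [rewrite lee_fin exprn_ge0|exact: green_lvl].
  rewrite -EFinM lee_fin exprS -mulrA (mulrCA (2 ^+ j)%R) -mulrA ler_pM2l //.
  rewrite ler_wpM2l // -[X in (X * _ <= _)%R]powRr1 ?exprn_ge0 //.
  by rewrite -powRD ?pow2_powR //; apply/implyP => _; rewrite expf_neq0.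
rewrite sumEFin lee_fin -mulr_sumr -/lam [leRHS]mulrAC -[leRHS]mulrA.
have c0 : (0 <= 2 * visit_bound)%R by rewrite mulr_ge0.
apply: ler_wpM2l => //.
by rewrite ler_pdivlMr // mulrC -subrX1 gerBl.
Qed.

Definition cutpw (z x : R) : \bar R := if (z <= x)%R then pw s x else 0.

Lemma cutpw_nnm z : nnm (cutpw z).
Proof.
have [m p] := pw_nnm s; split; last by move=> x; rewrite /cutpw; case: ifP.
by apply: measurable_fun_ifT => //; apply: measurable_fun_ler.
Qed.

(** The part of [E rho^s] carried by [rho >= z]. Its summability along the powers of
    two expresses that [rho^s log rho] is integrable at infinity. *)
Definition tail_moment (z : R) : \bar R := T (cutpw z) 1.

Lemma tail_moment_ge0 z : 0 <= tail_moment z.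
Proof. exact: (nnm_ge0 1 (trans_nnm P (cutpw_nnm z))). Qed.

Lemma tail_moment_fin z : tail_moment z \is a fin_num.
Proof.
rewrite ge0_fin_numE; last exact: tail_moment_ge0.
apply: (@le_lt_trans _ _ 1); last by rewrite ltry.
rewrite -Es; apply: le_trans_op => //; [exact: cutpw_nnm|exact: pw_nnm|].
by move=> x _; rewrite /cutpw; case: ifP => // _; exact/nnm_ge0/pw_nnm.
Qed.

(** Jumping from [x <= b] beyond [z * b] requires a factor [rho >= z]. *)
Lemma trans_cutpw z x b : (0 <= x)%R -> (x <= b)%R -> (0 < b)%R ->
  T (cutpw (z * b)) x <= (b `^ s)%:E * tail_moment z.
Proof.
move=> x0 xb b0; rewrite /tail_moment /trans -ge0_integralZl_EFin ?powR_ge0 //; last 2 first.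
  by move=> w _; exact/nnm_ge0/cutpw_nnm.
  exact: (nnm_comp 1 0 (cutpw_nnm z)).
have h2 : nnm (fun y => (b `^ s)%:E * cutpw z y).
  by apply: nnm_scale; [exact: powR_ge0|exact: cutpw_nnm].
apply: ge0_le_integral => //.
- by move=> w _; exact/nnm_ge0/cutpw_nnm.
- exact: (nnm_comp x 0 (cutpw_nnm (z * b))).
- exact: (nnm_comp 1 0 h2).
- move=> w _; rewrite mul1r /cutpw; have o0 := odds_ge0 w 0.
  case: ifPn => [h|_]; last first.
    by apply: mule_ge0; rewrite ?lee_fin ?powR_ge0 //; case: ifP => // _; exact/nnm_ge0/pw_nnm.
  rewrite ifT; last first.
    rewrite -(ler_pM2r b0); apply: (le_trans h); rewrite mulrC ler_wpM2l //.
  rewrite /pw -EFinM lee_fin powRM // ler_wpM2r ?powR_ge0 //.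
  by rewrite ge0_ler_powR ?nnegrE ?(ltW s_gt0) // ltW.
Qed.

Hypothesis tail_moment_small : forall eps : R, (0 < eps)%R ->
  exists B : nat, forall J, \sum_(i < J) tail_moment (2 ^+ (B + i)) <= eps%:E.

(** The ramp is lost at the levels at most 1, and completed from [2 ^ J] on. *)
Definition outside J (x : R) : bool := ((x <= 1) || (2 ^+ J <= x))%R.

Lemma measurable_outside J : measurable_fun setT (outside J).
Proof.
have h1 : measurable_fun setT (fun x : R => x <= 1)%R by apply: measurable_fun_ler.
have h2 : measurable_fun setT (fun x : R => 2 ^+ J <= x)%R by apply: measurable_fun_ler.
exact: measurable_or.
Qed.

(** The martingale of the powers [s] has mean 1 at all times. When it is stopped on
    leaving the interval between 1 and [y = 2 ^ J], its mass splits into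
    - the part at levels at most 1, of mean at most [E min(1, rho^s) <= r];
    - the part still inside the interval, small after [k] steps;
    - the part beyond [2 ^ B * y]: such an overshoot from the dyadic level [2 ^ j] takes
      a factor of at least [2 ^ (B + J - j - 1)], and summing over [j] the visits to
      this level times its cost gives a tail of the sum of [tail_moment];
    - the part between [y] and [2 ^ B * y], at most [(2 ^ B * y) ^ s] times the
      probability of completing the ramp.
    The first three do not exhaust the mass, whence a lower bound for the last one.
    One step is made before stopping, because the walk starts at the level 1. *)
Lemma ramp_lower : exists2 c : R, (0 < c)%R & forall J k,
  ((2 ^+ J) `^ s * r ^+ k.+1 <= (1 - r) / 4)%R ->
  (c * (2 ^+ J) `^ (- s))%:E <=
    T (iter k (stoptrans P (outside J)) (ind (fun x => 2 ^+ J <= x)%R)) 1.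
Proof.
have r1 : (0 < 1 - r)%R by rewrite subr_gt0.
have [C C0 hC] : exists2 C : R, (0 <= C)%R &
    forall m j, green P m (lvl (2 ^+ j)) 1 <= (C * (2 ^+ j) `^ (- s))%:E.
  by exists visit_bound => // m j; exact: green_lvl.
pose eps := ((1 - r) / 4 / (2 * C + 1))%R.
have D0 : (0 < 2 * C + 1)%R by move: C0; lra.
have eps0 : (0 < eps)%R by rewrite /eps !divr_gt0.
have [B HB] := tail_moment_small eps0.
exists ((1 - r) / 2 * (2 ^+ B) `^ (- s))%R.
  by rewrite mulr_gt0 ?divr_gt0 // powR_gt0 // exprn_gt0.
move=> J k hk.
set d := outside J; have md : measurable_fun setT d by exact: measurable_outside.
set S := stoptrans P d; set y : R := (2 ^+ J)%R; set ytop : R := (2 ^+ (B + J))%R.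
have y0 : (0 < y)%R by rewrite exprn_gt0.
have ytop0 : (0 < ytop)%R by rewrite exprn_gt0.
have y1 : (1 <= y)%R by rewrite exprn_ege1 // ler1n.
have [mpw ppw] := pw_nnm s.
have mle (c : R) : measurable_fun setT (fun x : R => x <= c)%R by apply: measurable_fun_ler.
have mge (c : R) : measurable_fun setT (fun x : R => c <= x)%R by apply: measurable_fun_ler.
have mlt (c : R) : measurable_fun setT (fun x : R => x < c)%R by apply: measurable_fun_ltr.
have mgt (c : R) : measurable_fun setT (fun x : R => c < x)%R by apply: measurable_fun_ltr.
pose mid (x : R) := (1 < x)%R && (x < y)%R.
have mmid : measurable_fun setT mid by exact: measurable_and.
pose a1 (x : R) := if (x <= 1)%R then pw s x else 0.
pose a2 (x : R) := if mid x then pw s x else 0.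
pose a4 := cutpw ytop.
pose a3 := ind (fun x => y <= x)%R.
have h1 : nnm a1 by split; [exact: measurable_fun_ifT|move=> x; rewrite /a1; case: ifP].
have h2 : nnm a2 by split; [exact: measurable_fun_ifT|move=> x; rewrite /a2; case: ifP].
have h4 : nnm a4 by exact: cutpw_nnm.
have h3 : nnm a3 by exact: ind_nnm.
have hI phi : nnm phi -> nnm (iter k S phi) by move=> h; exact: iter_stoptrans_nnm.
have b30 : (0 <= ytop `^ s)%R by exact: powR_ge0.
have h3' : nnm (fun x => (ytop `^ s)%:E * a3 x) by exact: nnm_scale.
pose phih (x : R) := if mid x then T a4 x else 0.
have [mT4 pT4] := trans_nnm P h4.
have hh : nnm phih by split; [exact: measurable_fun_ifT|move=> x; rewrite /phih; case: ifP].
(* [pw s] is harmonic, hence its mass survives the stopping. *)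
have tot x : (0 <= x)%R -> pw s x <= iter k S (pw s) x.
  move: x; elim: (k) => [//|k' IH] x x0; rewrite iterS /S /stoptrans; case: ifP => _; first exact: IH.
  rewrite -[leLHS]mule1 -Es -trans_pw //; apply: le_trans_op => //.
  exact: iter_stoptrans_nnm.
(* The four parts [a1], [a2], [a4], [a3] correspond to the levels at most 1, inside
   the interval, beyond [ytop], and between [y] and [ytop]. *)
have dec x : (0 <= x)%R -> pw s x <= (a1 x + a2 x) + (a4 x + (ytop `^ s)%:E * a3 x).
  move=> x0.
  have q1 := nnm_ge0 x h1; have q2 := nnm_ge0 x h2; have q4 := nnm_ge0 x h4.
  have q3 := nnm_ge0 x h3'.
  rewrite [a1 x]/a1; case: ifPn => [_|x1].
    by rewrite -addeA leeDl // !adde_ge0.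
  rewrite add0e [a2 x]/a2 /mid ltNge x1 /=; case: ifPn => [_|xy]; first by rewrite leeDl // adde_ge0.
  rewrite add0e /a4 /cutpw /a3 /ind; have [bx|bx] := leP ytop x; first by rewrite leeDl.
  rewrite -leNgt in xy; rewrite xy add0e mule1 lee_fin.
  by rewrite ge0_ler_powR ?nnegrE ?(ltW s_gt0) // ltW.
have b1 x : (0 <= x)%R -> iter k S a1 x <= minpw s 1 x.
  move: x; elim: (k) => [|k' IH] x x0.
    rewrite /= /a1 /minpw; case: ifPn => [x1|_]; last by rewrite lee_fin le_min ler01 powR_ge0.
    rewrite lee_fin divr1 le_min lexx andbT -[leRHS](one_powR s).
    by rewrite ge0_ler_powR ?nnegrE ?(ltW s_gt0).
  rewrite iterS {1}/S /stoptrans; case: ifP => _; first exact: IH.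
  apply: le_trans (trans_minpw Es ltr01 x0); apply: le_trans_op => //.
    exact/iter_stoptrans_nnm.
  exact: minpw_nnm.
have b2 x : (0 <= x)%R -> iter k S a2 x <= (y `^ s * r ^+ k)%:E * pw (s / 2) x.
  move: x; elim: (k) => [|k' IH] x x0.
    rewrite /= /a2 expr0 mulr1; case: ifPn => [/andP[x1 xy]|_]; last first.
      by rewrite mule_ge0 ?lee_fin ?powR_ge0.
    rewrite /pw -EFinM lee_fin -[leLHS]mulr1; apply: ler_pM => //; first exact: powR_ge0.
      by rewrite ge0_ler_powR ?nnegrE ?(ltW s_gt0) // ltW.
    by rewrite -[leLHS](one_powR (s / 2)) ge0_ler_powR ?nnegrE ?divr_ge0 ?(ltW s_gt0) // ltW.
  have e0 : (0 <= y `^ s * r ^+ k')%R by rewrite mulr_ge0 ?powR_ge0 ?exprn_ge0.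
  rewrite iterS {1}/S /stoptrans; case: ifP => [dx|_].
    have mx : mid x = false.
      by apply/negbTE; rewrite negb_and -!leNgt.
    rewrite (iter_stoptrans_stop _ _ dx) /a2 mx.
    by rewrite mule_ge0 ?lee_fin ?mulr_ge0 ?powR_ge0 ?exprn_ge0.
  apply: (@le_trans _ _ (T (fun z => (y `^ s * r ^+ k')%:E * pw (s / 2) z) x)).
    apply: le_trans_op => //; first exact: iter_stoptrans_nnm.
    by apply: nnm_scale => //; exact: pw_nnm.
  rewrite trans_scale //; last exact: pw_nnm.
  by rewrite trans_pw // Er exprSr mulrA [X in _ <= X * _]EFinM -muleA (muleC r%:E).
(* The chain jumps beyond [ytop] from inside the interval, at the mean cost [phih]
   for each visit. *)
have b4 x : (0 <= x)%R -> iter k S a4 x <= a4 x + green P k phih x.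
  move: x; elim: (k) => [|k' IH] x x0.
    by rewrite /= leeDl // /green big_ord0.
  have g0 := nnm_ge0 x (green_nnm P k'.+1 hh).
  rewrite iterS {1}/S /stoptrans; case: ifPn => [dx|ndx].
    by rewrite (iter_stoptrans_stop _ _ dx) leeDl.
  apply: (@le_trans _ _ (T (fun z => a4 z + green P k' phih z) x)).
    apply: le_trans_op => //; first exact: iter_stoptrans_nnm.
    by apply: nnm_add => //; exact: green_nnm.
  rewrite trans_add //; last exact: green_nnm.
  rewrite greenS // [leRHS]addeA; apply: leeD => //.
  have mx : mid x by move: ndx; rewrite /d /outside negb_or -!ltNge.
  by rewrite [phih x]/phih mx leeDr // (nnm_ge0 x h4).
(* [phih] on the level [2 ^ j]: [trans_cutpw] with [b = 2 ^ j.+1], whose quotient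
   [ytop / b] is a power of two. *)
pose cj (j : nat) : R := ((2 ^+ j.+1) `^ s * fine (tail_moment (2 ^+ (B + (J - j.+1)))))%R.
have cj0 j : (0 <= cj j)%R.
  by apply: mulr_ge0; [exact: powR_ge0|apply: fine_ge0; exact: tail_moment_ge0].
have bph x : (0 <= x)%R -> phih x <=
   \sum_(j < J) (cj j)%:E * lvl (2 ^+ j) x.
  move=> x0.
  have q j : 0 <= (cj j)%:E * lvl (2 ^+ j) x.
    apply: mule_ge0; last exact: (nnm_ge0 _ (lvl_nnm (2 ^+ j))).
    by rewrite lee_fin.
  rewrite /phih; case: ifPn => [/andP[x1 xy]|_]; last by apply: sume_ge0 => j _.
  have [j j1 j2] := dyadic (ltW x1) xy.
  rewrite (bigD1 j) //= -[leLHS]adde0; apply: leeD; last by apply: sume_ge0 => i _.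
  rewrite {1}/lvl /ind j1 j2 /= mule1 /cj EFinM fineK ?tail_moment_fin //.
  have -> : a4 = cutpw (2 ^+ (B + (J - j.+1)) * 2 ^+ j.+1).
    rewrite -exprD /a4 /ytop; congr (cutpw (_ ^+ _)).
    by rewrite -addnA subnK.
  by apply: trans_cutpw; rewrite ?exprn_gt0 // exprS ltW.
have gph : green P k.+1 phih 1 <= (2 * C * eps)%:E.
  apply: (@le_trans _ _ (\sum_(j < J) (2 * C)%:E * tail_moment (2 ^+ (B + (J - j.+1))))).
    apply: (le_trans (green_le k.+1 hh _ bph ler01)).
      by apply: nnm_sum => j; apply: nnm_scale => //; exact: lvl_nnm.
    rewrite green_sum; last by move=> j; apply: nnm_scale => //; exact: lvl_nnm.
    apply: lee_sum => j _; rewrite greenZ //; last exact: lvl_nnm.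
    have le2 : ((2 ^+ j.+1) `^ s * (2 ^+ j) `^ (- s) <= 2 :> R)%R.
      rewrite exprS powRM ?exprn_ge0 // -mulrA -powRD; last first.
        by apply/implyP => _; rewrite expf_neq0.
      rewrite subrr powRr0 mulr1 -[leRHS]powRr1 // ler_powR ?ler1n //; exact: ltW.
    have f0 : (0 <= C * fine (tail_moment (2 ^+ (B + (J - j.+1)))))%R.
      by apply: mulr_ge0 => //; apply: fine_ge0; exact: tail_moment_ge0.
    apply: (@le_trans _ _ ((cj j)%:E * (C * (2 ^+ j) `^ (- s))%:E)).
      by apply: lee_wpmul2l => //; rewrite lee_fin.
    rewrite -[X in _ <= _ * X]fineK ?tail_moment_fin // -!EFinM lee_fin /cj.
    have := ler_wpM2r f0 le2.
    by congr (_ <= _)%R; ring.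
  rewrite -ge0_sume_distrr; last by move=> j _; exact: tail_moment_ge0.
  rewrite (EFinM (2 * C)) lee_wpmul2l ?lee_fin ?mulr_ge0 //.
  apply: le_trans (HB J).
  rewrite (reindex_inj rev_ord_inj) /=; apply: lee_sum => j _.
  by rewrite subnSK ?subKn // ltnW.
have tby : tail_moment ytop <= eps%:E.
  apply: le_trans (HB J.+1); rewrite big_ord_recr /= leeDr //.
  by apply: sume_ge0 => j _; exact: tail_moment_ge0.
set X := T (iter k S a3) 1.
have X0 : 0 <= X by exact: (nnm_ge0 1 (trans_nnm P (hI _ h3))).
have main : 1 <= (r%:E + ((1 - r) / 4)%:E) + ((eps + 2 * C * eps)%:E + (ytop `^ s)%:E * X).
  rewrite -[leLHS]Es.
  apply: (@le_trans _ _ (T (iter k S (pw s)) 1)).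
    by apply: le_trans_op => //; exact: hI.
  apply: (@le_trans _ _ (T (iter k S (fun x => (a1 x + a2 x) + (a4 x + (ytop `^ s)%:E * a3 x))) 1)).
    apply: le_trans_op => //; [exact: hI|by apply: hI; do ![apply: nnm_add => //]|].
    move=> x x0; apply: iter_stoptrans_le => //.
    by do ![apply: nnm_add => //].
  have -> : iter k S (fun x => (a1 x + a2 x) + (a4 x + (ytop `^ s)%:E * a3 x)) =
     (fun x => (iter k S a1 x + iter k S a2 x) + (iter k S a4 x + (ytop `^ s)%:E * iter k S a3 x)).
    apply/funext => x; rewrite iter_stoptransD //; [|exact: nnm_add..].
    by rewrite iter_stoptransD // iter_stoptransD // iter_stoptransZ.
  have hs3 : nnm (fun x => (ytop `^ s)%:E * iter k S a3 x) by apply: nnm_scale => //; exact: hI.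
  rewrite trans_add; [|by apply: nnm_add; exact: hI|by apply: nnm_add => //; exact: hI].
  rewrite trans_add; [|exact: hI|exact: hI].
  rewrite trans_add; [|exact: hI|by []].
  rewrite trans_scale //; last exact: hI.
  apply: leeD; apply: leeD => //.
  - apply: (@le_trans _ _ (T (pw (s / 2)) 1)); last by rewrite Er.
    apply: le_trans_op => //; [exact: hI|exact: pw_nnm|].
    by move=> x x0; apply: (le_trans (b1 _ x0)); exact: minpw1_le.
  - apply: (@le_trans _ _ (T (fun x => (y `^ s * r ^+ k)%:E * pw (s / 2) x) 1)).
      apply: le_trans_op => //; first exact: hI.
      apply: nnm_scale; last exact: pw_nnm.
      by rewrite mulr_ge0 ?powR_ge0 ?exprn_ge0.
    rewrite trans_scale ?mulr_ge0 ?powR_ge0 ?exprn_ge0 //; last exact: pw_nnm.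
    by rewrite Er -EFinM lee_fin -mulrA -exprSr.
  - apply: (@le_trans _ _ (T (fun x => a4 x + green P k phih x) 1)).
      apply: le_trans_op => //; first exact: hI.
      by apply: nnm_add => //; exact: green_nnm.
    rewrite trans_add //; last exact: green_nnm.
    rewrite EFinD; apply: leeD => //.
    by apply: le_trans gph; rewrite greenS // leeDr //; exact: nnm_ge0.
have epsE : (eps + 2 * C * eps = (1 - r) / 4)%R.
  by rewrite -{1}(mul1r eps) -mulrDl addrC /eps mulrC divfK // gt_eqF.
rewrite epsE in main.
have ytop_s : (0 < ytop `^ s)%R by rewrite powR_gt0.
have [Xfin|] := boolP (X \is a fin_num); last first.
  rewrite ge0_fin_numE // -leNgt leye_eq => /eqP Xy.
  by rewrite -/X Xy leey.
rewrite -/X -(fineK Xfin) lee_fin.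
move: main; rewrite -(fineK Xfin) -EFinM -!EFinD lee_fin => main.
have -> : ((1 - r) / 2 * (2 ^+ B) `^ (- s) * (2 ^+ J) `^ (- s) =
    (1 - r) / 2 * ytop `^ (- s))%R by rewrite /ytop exprD powRM ?exprn_ge0 // mulrA.
rewrite powRN.
by rewrite ler_pdivrMr // mulrC; lra.
Qed.

End renewal.

(** * Products of odds in the environment *)

Lemma measurable_setb (R : realType) (b : env R -> bool) :
  measurable_fun setT b -> measurable [set w | b w].
Proof.
move=> mb; have m1 : measurable ([set true] : set bool) by [].
by have := mb measurableT [set true] m1; rewrite setTI.
Qed.

Lemma measurable_forall (R : realType) (I : finType) (f : I -> env R -> bool) :
  (forall i, measurable_fun setT (f i)) ->
  measurable_fun setT (fun w => [forall i, f i w]).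
Proof.
move=> mf.
rewrite (_ : (fun w => _) = fun w => all (fun i => f i w) (enum I)); last first.
  apply/funext => w; apply/forallP/allP => h i; first by move=> _; exact: h.
  by apply: h; rewrite mem_enum.
elim: (enum I) => [|i l IH] /=; first exact: measurable_cst.
exact: measurable_and.
Qed.

Lemma measurable_exists (R : realType) (I : finType) (f : I -> env R -> bool) :
  (forall i, measurable_fun setT (f i)) ->
  measurable_fun setT (fun w => [exists i, f i w]).
Proof.
move=> mf; rewrite (_ : (fun w => _) = fun w => ~~ [forall i, ~~ f i w]); last first.
  by apply/funext => w; rewrite negb_forall; apply: eq_existsb => i; rewrite negbK.
by apply: measurable_neg; apply: measurable_forall => i; exact: measurable_neg.
Qed.

(** Sites are listed by a function [e], so that the same bounds serve for the products
    to the left and to the right of a site. Starting the sum at the product of one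
    factor makes [psum] the usual series [W] of the expected crossing times. *)
Definition pprod (R : realType) (e : nat -> int) (w : env R) (k : nat) : R :=
  \prod_(j < k) odds w (e j).
Definition psum (R : realType) (e : nat -> int) (w : env R) (m : nat) : R :=
  \sum_(k < m) pprod e w k.+1.

Section products.
Variable R : realType.
Implicit Types (e : nat -> int) (w : env R).

Lemma pprod0 e w : pprod e w 0 = 1. Proof. by rewrite /pprod big_ord0. Qed.

Lemma pprodS e w k : pprod e w k.+1 = pprod e w k * odds w (e k).
Proof. by rewrite /pprod big_ord_recr. Qed.

Lemma pprod_ge0 e w k : 0 <= pprod e w k.
Proof. by apply: prodr_ge0 => j _; exact: odds_ge0. Qed.

Lemma psum_ge0 e w m : 0 <= psum e w m.
Proof. by apply: sumr_ge0 => k _; exact: pprod_ge0. Qed.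

Lemma measurable_pprod e k : measurable_fun setT (fun w => pprod e w k).
Proof.
elim: k => [|k IH].
  rewrite (_ : (fun w => _) = cst 1) //; by apply/funext => w; rewrite pprod0.
rewrite (_ : (fun w => _) = (fun w => pprod e w k * odds w (e k))).
  by apply: measurable_funM => //; exact: measurable_odds.
by apply/funext => w; rewrite pprodS.
Qed.

Lemma measurable_psum e m : measurable_fun setT (fun w => psum e w m).
Proof. by apply: measurable_sum => k; exact: measurable_pprod. Qed.

Lemma pprod_dep e k (I : set int) : (forall j, (j < k)%N -> I (e j)) ->
  depends_on I (fun w => pprod e w k).
Proof.
move=> h w w' ww'; apply: eq_bigr => j _; rewrite /odds ww' //; exact: h.
Qed.

Lemma psum_dep e m (I : set int) : (forall j, (j < m)%N -> I (e j)) ->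
  depends_on I (fun w => psum e w m).
Proof.
move=> h w w' ww'; apply: eq_bigr => k _; apply: (pprod_dep _ ww') => j jk.
by apply: h; exact: leq_trans jk (ltn_ord k).
Qed.

Lemma chain_pred0 e k w : chain pred0 (cst 1) e k w = pprod e w k.
Proof. by elim: k => [|k IH] /=; rewrite ?pprod0 // pprodS IH. Qed.

Lemma chain_hit (d : R -> bool) e m k w : (k <= m)%N -> d (pprod e w k) ->
  d (chain d (cst 1) e m w).
Proof.
have H n : d (chain d (cst 1) e n w) \/ (chain d (cst 1) e n w = pprod e w n /\
    forall j, (j < n)%N -> ~~ d (pprod e w j)).
  elim: n => [|n [IH|[IH nd]]] /=; first by right; split => //; rewrite pprod0.
    by left; rewrite IH.
  case: ifPn => dn; [by left|right; split; first by rewrite pprodS IH].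
  by move=> j; rewrite ltnS leq_eqVlt => /orP[/eqP ->|/nd //]; rewrite -IH.
move=> km dk; case: (H m) => // -[E nd].
by move: km; rewrite leq_eqVlt => /orP[/eqP km|/nd /negP //]; rewrite E -km.
Qed.

(** A barrier of the potential of height [ln y], met within [L] sites, and such that
    the potential does not return to its initial value in between. *)
Definition ramp e (y : R) L w : bool :=
  [exists k : 'I_L, (y <= pprod e w k.+1) && [forall j : 'I_L, (j <= k)%N ==> (1 < pprod e w j.+1)]].

Lemma rampP e y L w : reflect
  (exists k, [/\ (k < L)%N, y <= pprod e w k.+1 & forall j, (j <= k)%N -> 1 < pprod e w j.+1])
  (ramp e y L w).
Proof.
apply: (iffP existsP) => [[k /andP[yk /forallP h]]|[k [kL yk h]]].
  exists k; split => // j jk; have jL := leq_ltn_trans jk (ltn_ord k).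
  by have := h (Ordinal jL); rewrite /= jk.
exists (Ordinal kL); rewrite yk /=; apply/forallP => j; apply/implyP; exact: h.
Qed.

(** The first site is read before stopping, as the level 1 at which the products start
    is a stopping level. *)
Lemma chain_ramp e (y : R) L w : 1 < y ->
  y <= chain (fun x => (x <= 1) || (y <= x)) (fun w => odds w (e 0%N)) (e \o S) L w ->
  ramp e y L.+1 w.
Proof.
move=> y1; set d := fun x : R => _; set c := chain _ _ _.
have H n : [\/ c n w <= 1, ramp e y n.+1 w |
    c n w = pprod e w n.+1 /\ forall j, (j <= n)%N -> 1 < pprod e w j.+1 < y].
  elim: n => [|n IH].
    rewrite /c /=; have -> : odds w (e 0%N) = pprod e w 1 by rewrite pprodS pprod0 mul1r.
    have [h|h] := leP (pprod e w 1) 1; first by constructor 1.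
    have [h'|h'] := leP y (pprod e w 1).
      by constructor 2; apply/rampP; exists 0%N; split => // j; rewrite leqn0 => /eqP ->.
    by constructor 3; split => // j; rewrite leqn0 => /eqP ->; rewrite h.
  case: IH => [h|/rampP[k [kn yk h]]|[E h]].
  - by constructor 1; rewrite /c /= -/(c n w) /d h.
  - by constructor 2; apply/rampP; exists k; split => //; exact: ltnW.
  have /andP[h1 h2] := h n (leqnn n).
  have Ec : c n.+1 w = pprod e w n.+2.
    rewrite /c /= -/(c n w) E /d leNgt h1 leNgt h2 /=; by rewrite [RHS]pprodS.
  have [h3|h3] := leP (pprod e w n.+2) 1; first by constructor 1; rewrite Ec.
  have hj j : (j <= n.+1)%N -> 1 < pprod e w j.+1.
    by rewrite leq_eqVlt => /orP[/eqP -> //|]; rewrite ltnS => /h/andP[].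
  have [h4|h4] := leP y (pprod e w n.+2).
    by constructor 2; apply/rampP; exists n.+1.
  constructor 3; split => // j; rewrite leq_eqVlt => /orP[/eqP ->|]; first by rewrite h3.
  by rewrite ltnS; exact: h.
case: (H L) => [h|//|[E h]] yc; first by have := le_lt_trans (le_trans yc h) y1; rewrite ltxx.
by have /andP[_] := h L (leqnn L); rewrite -E ltNge yc.
Qed.

End products.

Section events.
Variables (R : realType) (P : probability (env R) R) (P_iid : iid_env P).
Local Open Scope ereal_scope.
Local Notation T := (trans P).

Lemma expect_cst (c : \bar R) : \int[P]_w c = c.
Proof. by rewrite (integral_cst P measurableT c) [X in _ * X]probability_setT mule1. Qed.

Lemma integral_ind (d : R -> bool) (f : env R -> R) :
  measurable_fun setT d -> measurable_fun setT f ->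
  \int[P]_w ind d (f w) = P [set w | d (f w)].
Proof.
move=> md mf.
have mA : measurable [set w | d (f w)].
  by apply: (@measurable_setb R (d \o f)); exact: measurableT_comp.
rewrite -[X in P X]setIT -integral_indic //; apply: eq_integral => w _.
rewrite /ind indicE; case: ifPn => h; first by rewrite mem_set.
by rewrite memNset //; exact/negP.
Qed.

Lemma markov_ge (f : env R -> R) (a : R) : measurable_fun setT f ->
  (forall w, (0 <= f w)%R) -> (0 < a)%R ->
  P [set w | (a <= f w)%R] <= (a^-1)%:E * \int[P]_w (f w)%:E.
Proof.
move=> mf f0 a0.
have md : measurable_fun setT (fun x : R => a <= x)%R by apply: measurable_fun_ler.
have mfE : measurable_fun setT (EFin \o f) by exact/measurable_EFinP.
rewrite -(integral_ind md mf) -ge0_integralZl_EFin ?invr_ge0 ?(ltW a0) //; last first.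
  by move=> w _; rewrite lee_fin.
have [mi _] := ind_nnm md.
apply: ge0_le_integral => //.
- by move=> w _; exact: (nnm_ge0 _ (ind_nnm md)).
- exact: measurableT_comp.
- exact: measurable_funeM.
- move=> w _; rewrite /ind -EFinM; case: ifPn => [h|_]; last first.
    by rewrite lee_fin mulr_ge0 // invr_ge0 ltW.
  by rewrite lee_fin mulrC ler_pdivlMr // mul1r.
Qed.

Lemma integral_pprod (e : nat -> int) k phi : injective e -> nnm phi ->
  \int[P]_w phi (pprod e w k) = iter k T phi 1%R.
Proof.
move=> ie hp.
transitivity (\int[P]_w phi (chain pred0 (cst 1%R) e k w)).
  by apply: eq_integral => w _; rewrite chain_pred0.
rewrite (@integral_chain R P P_iid pred0 (cst 1%R) e k phi set0) //.
- exact: (expect_cst (iter k T phi 1%R)).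
- exact: measurable_cst.
- by move=> j [].
Qed.

Lemma prob_chain (d : R -> bool) (e : nat -> int) k : injective e -> measurable_fun setT d ->
  P [set w | d (chain d (cst 1%R) e k w)] = iter k (stoptrans P d) (ind d) 1%R.
Proof.
move=> ie md; rewrite -integral_ind //; last exact: measurable_chain.
rewrite (@integral_chain R P P_iid d (cst 1%R) e k (ind d) set0) //; [|by move=> j []|exact: ind_nnm].
exact: (expect_cst (iter k (stoptrans P d) (ind d) 1%R)).
Qed.

Variables (s r : R).
Hypotheses (s_gt0 : (0 < s)%R) (s_lt1 : (s < 1)%R) (r_ge0 : (0 <= r)%R) (r_lt1 : (r < 1)%R).
Hypotheses (Es : T (pw s) 1 = 1) (Er : T (pw (s / 2)) 1 = r%:E).

Lemma prob_chain_ge (a : R) (e : nat -> int) m : injective e -> (0 < a)%R ->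
  P [set w | (a <= chain (fun x => a <= x)%R (cst 1%R) e m w)%R] <= (a `^ (- s))%:E.
Proof.
move=> ie a0.
have md : measurable_fun setT (fun x : R => a <= x)%R by apply: measurable_fun_ler.
rewrite (prob_chain m ie md).
apply: (le_trans (doob s_gt0 Es m md a0 (fun y h => h) ler01)).
rewrite lee_fin ge_min; apply/orP; right.
by rewrite mul1r -powR_inv1 ?(ltW a0) // -powRrM mulN1r.
Qed.

Lemma trans_minpw1 : T (minpw s 1) 1 <= r%:E.
Proof.
rewrite -Er; apply: le_trans_op => //; [exact: minpw_nnm|exact: pw_nnm|].
by move=> x _; exact: minpw1_le.
Qed.

Definition ladder (e : nat -> int) L (w : env R) : bool :=
  [forall k : 'I_L.+1, (pprod e w k <= 1)%R].

(** After one step, the maximal inequality at level 1 bounds the probability by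
    [E min(1, rho^s)], and [min(1, x^2) <= x]. *)
Lemma prob_not_ladder (e : nat -> int) L : injective e ->
  P [set w | ~~ ladder e L w] <= r%:E.
Proof.
move=> ie; set d := fun x : R => (1 < x)%R.
have md : measurable_fun setT d by apply: measurable_fun_ltr.
have h1 : P [set w | d (chain d (cst 1%R) e L w)] <= r%:E.
  rewrite (prob_chain L ie md); case: L => [|L].
    by rewrite /= /ind /d ltxx lee_fin.
  rewrite iterS {1}/stoptrans {1}/d ltxx.
  apply: le_trans trans_minpw1; apply: le_trans_op => //.
  - exact/iter_stoptrans_nnm/ind_nnm.
  - exact: minpw_nnm.
  - by move=> x x0; apply: doob => // y; exact: ltW.
apply: le_trans h1; apply: le_measure; rewrite ?inE.
- apply: (@measurable_setb R (fun w => ~~ ladder e L w)).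
  apply: measurable_neg; apply: measurable_forall => k.
  by apply: measurable_fun_ler => //; exact: measurable_pprod.
- by apply: (@measurable_setb R (d \o chain d (cst 1%R) e L)); apply: measurableT_comp => //; exact: measurable_chain.
- move=> w /=; rewrite negb_forall => /existsP[k]; rewrite -ltNge.
  by apply: chain_hit; rewrite -ltnS.
Qed.

Lemma prob_pprod_gt (e : nat -> int) L (c : R) : injective e -> (0 < c)%R ->
  P [set w | (c <= pprod e w L)%R] <= (c `^ (- (s / 2)) * r ^+ L)%:E.
Proof.
move=> ie c0.
have cp : (0 < c `^ (s / 2))%R by rewrite powR_gt0.
have s2 : (0 <= s / 2)%R by rewrite divr_ge0 // ltW.
have mp : measurable_fun setT (fun w => pprod e w L `^ (s / 2))%R.
  exact: (measurableT_comp (measurable_powR _) (@measurable_pprod R e L)).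
apply: (@le_trans _ _ (P [set w | (c `^ (s / 2) <= pprod e w L `^ (s / 2))%R])).
  apply: le_measure; rewrite ?inE.
  - by apply: measurable_setb; apply: measurable_fun_ler => //; exact: measurable_pprod.
  - by apply: measurable_setb; apply: measurable_fun_ler.
  - move=> w /= h; rewrite ge0_ler_powR ?nnegrE ?(ltW c0) //; exact: pprod_ge0.
apply: (le_trans (markov_ge mp _ cp)); first by move=> w; exact: powR_ge0.
rewrite (integral_pprod L ie (pw_nnm (s / 2))) powRN EFinM.
apply: lee_wpmul2l; first by rewrite lee_fin invr_ge0 ltW.
apply: (@le_trans _ _ (1 * r ^+ L * 1 `^ (s / 2))%R%:E).
  by apply: iter_trans_pw_le => // [|x x0]; [exact: pw_nnm|rewrite mul1r].
by rewrite mul1r one_powR mulr1.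
Qed.

(** Either some product exceeds [2 ^ J], which [doob] bounds, or the sums are equal to
    their truncations at [2 ^ J], to which Markov's inequality and [green_trunc] apply.
    Only union bounds and linearity are used, so that the lists [E i] may overlap. *)
Lemma psum_tail_pow2 n (E : nat -> nat -> int) (m : nat -> nat) J :
  (forall i, injective (E i)) ->
  P [set w | (2 ^+ J <= \sum_(i < n) psum (E i) w (m i))%R] <=
    (n%:R * ((1 + green_bound s r) * (2 ^+ J) `^ (- s)))%:E.
Proof.
move=> iE; set a : R := (2 ^+ J)%R.
have a0 : (0 < a)%R by rewrite exprn_gt0.
pose d (x : R) := (a <= x)%R.
have md : measurable_fun setT d by apply: measurable_fun_ler.
pose tr (x : R) : R := if ((0 <= x) && (x < a))%R then x else 0%R.
have trE x : (tr x)%:E = trunc J x by rewrite /tr /trunc -/a; case: ifP.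
have tr0 x : (0 <= tr x)%R by rewrite /tr; case: ifP => // /andP[].
have mtr : measurable_fun setT tr.
  have [m1 _] := trunc_nnm R J; apply/measurable_EFinP.
  by rewrite (_ : EFin \o tr = trunc J) //; apply/funext => x /=; rewrite trE.
pose B i := [set w | d (chain d (cst 1%R) (E i) (m i) w)].
pose F w := (\sum_(i < n) \sum_(k < m i) tr (pprod (E i) w k.+1))%R.
pose C := [set w | (a <= F w)%R].
have mF : measurable_fun setT F.
  apply: measurable_sum => i; apply: measurable_sum => k.
  exact: (measurableT_comp mtr (@measurable_pprod R _ _)).
have mB i : measurable (B i).
  by apply: (@measurable_setb R (d \o chain d (cst 1%R) (E i) (m i))); apply: measurableT_comp => //; exact: measurable_chain.
have mC : measurable C by apply: measurable_setb; apply: measurable_fun_ler.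
have mBs : measurable (\big[setU/set0]_(i < n) B i) by apply: bigsetU_measurable.
set A := [set w | _].
have mA : measurable A.
  apply: measurable_setb; apply: measurable_fun_ler => //.
  by apply: measurable_sum => i; exact: measurable_psum.
have sub : A `<=` (\big[setU/set0]_(i < n) B i) `|` C.
  move=> w /= Aw.
  have [[i hi]|nB] := pselect (exists i : 'I_n, B i w).
    by left; rewrite -bigcup_mkord; exists (val i) => //=.
  right; rewrite /C /F /=; apply: (le_trans Aw); apply: ler_sum => i _; apply: ler_sum => k _.
  rewrite /tr pprod_ge0 /=; case: ltP => // h; exfalso; apply: nB; exists i.
  by apply: (chain_hit (k := k.+1)).
apply: (le_trans (le_measure P _ _ sub)); rewrite ?inE //; first exact: measurableU.
apply: (le_trans (measureU2 _ mBs mC)).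
have h1 : P (\big[setU/set0]_(i < n) B i) <= (n%:R * a `^ (- s))%:E.
  apply: (le_trans (Boole_inequality P (fun i _ => mB i))).
  apply: (@le_trans _ _ (\sum_(i < n) (a `^ (- s))%:E)).
    by apply: lee_sum => i _; exact: prob_chain_ge.
  by rewrite sumEFin lee_fin sumr_const card_ord -[leLHS]mulr_natl.
have h2 : P C <= (n%:R * (green_bound s r * a `^ (- s)))%:E.
  apply: (le_trans (markov_ge mF _ a0)).
    by move=> w; apply: sumr_ge0 => i _; apply: sumr_ge0.
  have -> : \int[P]_w (F w)%:E = \sum_(i < n) \sum_(k < m i) \int[P]_w trunc J (pprod (E i) w k.+1).
    have mt i k : measurable_fun setT (fun w : env R => trunc J (pprod (E i) w k)).
      have [mtr' _] := trunc_nnm R J.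
      exact: (measurableT_comp mtr' (@measurable_pprod R (E i) k)).
    transitivity (\int[P]_w \sum_(i < n) \sum_(k < m i) trunc J (pprod (E i) w k.+1)).
      apply: eq_integral => w _; rewrite /F -sumEFin; apply: eq_bigr => i _.
      by rewrite -sumEFin; apply: eq_bigr => k _; rewrite trE.
    rewrite ge0_integral_sum //.
    - apply: eq_bigr => i _; rewrite ge0_integral_sum // => k w _.
      exact: (nnm_ge0 _ (trunc_nnm R J)).
    - by move=> i; apply: emeasurable_sum => k.
    - by move=> i w _; apply: sume_ge0 => k _; exact: (nnm_ge0 _ (trunc_nnm R J)).
  apply: (@le_trans _ _ ((a^-1)%:E * \sum_(i < n) (green_bound s r * (2 `^ (1 - s)) ^+ J)%:E)).
    apply: lee_wpmul2l; first by rewrite lee_fin invr_ge0 ltW.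
    apply: lee_sum => i _.
    apply: (@le_trans _ _ (green P (m i).+1 (trunc J) 1)); last exact: green_trunc.
    rewrite /green big_ord_recl /=.
    rewrite -[leLHS]add0e; apply: leeD; first exact: (nnm_ge0 _ (trunc_nnm R J)).
    apply: lee_sum => k _.
    by rewrite (integral_pprod _ (iE i) (trunc_nnm R J)).
  rewrite sumEFin sumr_const card_ord -[X in _ * X%:E]mulr_natl -EFinM lee_fin.
  rewrite mulrCA ler_wpM2l // mulrCA ler_wpM2l ?green_bound_ge0 //.
  rewrite -pow2_powR -/a -powR_inv1 ?(ltW a0) // -powRD; last first.
    by apply/implyP => _; rewrite gt_eqF.
  by rewrite (_ : (-1 + (1 - s) = - s)%R) //; ring.
apply: (le_trans (leeD h1 h2)); rewrite -EFinD lee_fin.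
by rewrite -mulrDr ler_wpM2l // [leRHS]mulrDl mul1r.
Qed.

Definition tail_bound : R := (2 * (1 + green_bound s r))%R.

Lemma tail_bound_ge0 : (0 <= tail_bound)%R.
Proof. by rewrite mulr_ge0 // addr_ge0 // green_bound_ge0. Qed.

(** Rounding [a] down to a power of two costs at most a factor [2 ^ s <= 2]. *)
Lemma psum_tail n (E : nat -> nat -> int) (m : nat -> nat) (a : R) :
  (forall i, injective (E i)) -> (1 <= a)%R ->
  P [set w | (a <= \sum_(i < n) psum (E i) w (m i))%R] <= (n%:R * (tail_bound * a `^ (- s)))%:E.
Proof.
move=> iE a1.
have [J Ja aJ] : exists2 J, (2 ^+ J <= a)%R & (a <= 2 * 2 ^+ J)%R.
  have [N aN] : exists N, (a < 2 ^+ N)%R.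
    exists (Num.truncn a).+1; apply: lt_le_trans (truncnS_gt a) _.
    by rewrite -natrX ler_nat ltnW // ltn_expl.
  by have [j h1 h2] := dyadic a1 aN; exists j => //; exact: ltW.
apply: (@le_trans _ _ (P [set w | (2 ^+ J <= \sum_(i < n) psum (E i) w (m i))%R])).
  apply: le_measure; rewrite ?inE.
  - apply: measurable_setb; apply: measurable_fun_ler => //.
    by apply: measurable_sum => i; exact: measurable_psum.
  - apply: measurable_setb; apply: measurable_fun_ler => //.
    by apply: measurable_sum => i; exact: measurable_psum.
  - by move=> w /=; exact: le_trans.
apply: (le_trans (psum_tail_pow2 n m J iE)); rewrite lee_fin ler_wpM2l //.
have K0 : (0 <= 1 + green_bound s r)%R by rewrite addr_ge0 // green_bound_ge0.
suff h : ((2 ^+ J) `^ (- s) <= 2 * a `^ (- s))%R.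
  by apply: (le_trans (ler_wpM2l K0 h)); rewrite /tail_bound mulrCA mulrA.
have a0 : (0 < a)%R by exact: lt_le_trans a1.
rewrite !powRN ler_pdivlMr ?powR_gt0 // mulrC ler_pdivrMr ?powR_gt0 ?exprn_gt0 //.
apply: (@le_trans _ _ ((2 * 2 ^+ J) `^ s)%R).
  by rewrite ge0_ler_powR ?nnegrE ?(ltW s_gt0) ?(ltW a0) ?mulr_ge0 ?exprn_ge0.
rewrite powRM ?exprn_ge0 // ler_wpM2r ?powR_ge0 //.
by rewrite -[leRHS]powRr1 // ler_powR ?ler1n // ltW.
Qed.

Hypothesis tail_moment_small : forall eps : R, (0 < eps)%R ->
  exists B : nat, forall J, \sum_(i < J) tail_moment P s (2 ^+ (B + i)) <= eps%:E.

Lemma measurable_ramp e y L : measurable_fun setT (ramp e y L : env R -> bool).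
Proof.
apply: measurable_exists => k; apply: measurable_and.
  by apply: measurable_fun_ler => //; exact: measurable_pprod.
apply: measurable_forall => j; case: (j <= k)%N => //=.
by apply: measurable_fun_ltr => //; exact: measurable_pprod.
Qed.

Lemma prob_ramp : exists2 c : R, (0 < c)%R & forall (e : nat -> int) J k,
  injective e -> (0 < J)%N -> ((2 ^+ J) `^ s * r ^+ k.+1 <= (1 - r) / 4)%R ->
  (c * (2 ^+ J) `^ (- s))%:E <= P [set w | ramp e (2 ^+ J) k.+1 w].
Proof.
have [c c0 hc] := ramp_lower s_gt0 s_lt1 r_ge0 r_lt1 Es Er tail_moment_small.
exists c => // e J k ie J0 hk; apply: (le_trans (hc J k hk)).
have mge : measurable_fun setT (fun x : R => 2 ^+ J <= x)%R by apply: measurable_fun_ler.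
have md := @measurable_outside R J.
have mo := @measurable_odds R (e 0%N).
have ieS : injective (e \o S) by move=> x y /ie [].
rewrite -(@integral_odds R P P_iid _ (e 0%N)); last exact/iter_stoptrans_nnm/ind_nnm.
rewrite -(@integral_chain R P P_iid (outside J) (fun w => odds w (e 0%N)) (e \o S) k _ [set e 0%N]) //; last 3 first.
- by move=> w w' h; rewrite /odds h.
- by move=> j /= /ie.
- exact: ind_nnm.
rewrite integral_ind //; last exact: measurable_chain.
apply: le_measure; rewrite ?inE.
- apply: (@measurable_setb R ((fun x => 2 ^+ J <= x)%R \o _)); apply: measurableT_comp => //.
  exact: measurable_chain.
- by apply: measurable_setb; exact: measurable_ramp.
- move=> w /=; apply: chain_ramp.
  by rewrite exprn_egt1 ?ltr1n // -lt0n.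
Qed.

End events.

(** * The quenched walk in a valley *)

Definition leftw (z : int) (k : nat) : int := z - 1 - k%:Z.
Definition rightw (z : int) (k : nat) : int := z + k%:Z.

Section onestep.
Variables (R : realType) (w : env R).

Definition step (phi : int -> R) (x : int) : R :=
  site w x * phi (x + 1) + (1 - site w x) * phi (x - 1).

Lemma step_le (phi psi : int -> R) x : phi (x + 1) <= psi (x + 1) ->
  phi (x - 1) <= psi (x - 1) -> step phi x <= step psi x.
Proof.
have /andP[p0 p1] := site_itv w x => h1 h2; apply: lerD; apply: ler_wpM2l => //.
by rewrite subr_ge0.
Qed.

Lemma stepDc (phi : int -> R) (c : R) x : step (fun y => phi y + c) x = step phi x + c.
Proof. by rewrite /step; ring. Qed.

Lemma measurable_cylinder n x : measurable (cylinder n x : set path_space).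
Proof. by apply: sub_sigma_algebra; exists n, x. Qed.

Lemma measurable_coord n (A : pred int) : measurable ([set X | A (X n)] : set path_space).
Proof.
have -> : [set X : nat -> int | A (X n)] =
    \bigcup_(l : seq int) (if A (nth 0 l n) then cylinder n (nth 0 l) else set0).
  apply/seteqP; split=> X /=.
    move=> AX; exists (mkseq X n.+1) => //; rewrite nth_mkseq // AX => k kn.
    by rewrite nth_mkseq.
  by move=> [l _]; case: ifPn => // Al h; rewrite h.
apply: countable_bigcupT_measurable; first exact: countableP.
by move=> l; case: ifP => _; [exact: measurable_cylinder|exact: measurable0].
Qed.

Definition extend (n : nat) (x : nat -> int) (y : int) : nat -> int :=
  fun j => if (j <= n)%N then x j else y.

Lemma cylinder_extend n x y : cylinder n (extend n x y) = cylinder n x.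
Proof. by apply/seteqP; split=> X h k kn; rewrite h // /extend kn. Qed.

Lemma cylinder_sub n x y : cylinder n.+1 (extend n x y) `<=` cylinder n x.
Proof. by move=> X h k kn; rewrite h ?(leqW kn) // /extend kn. Qed.

(** The coordinates are described by the operator [step] on functions of the position:
    everything that follows bounds its iterates, without reference to paths. *)
Lemma quenched_markov k n x (A : pred int) :
  quenched_law w (cylinder n x `&` [set X | A (X (n + k)%N)]) =
  (quenched_law w (cylinder n x) * (iter k step (fun y => (A y)%:R) (x n))%:E)%E.
Proof.
have [Q0 QS] := quenched_lawP w; set Q := quenched_law w in Q0 QS *.
have QU (C D : set path_space) : measurable C -> measurable D -> C `&` D = set0 ->
    Q (C `|` D) = (Q C + Q D)%E by exact: measureU.
elim: k n x => [|k IH] n x.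
  rewrite addn0 /=; case: (boolP (A (x n))) => Ax; rewrite ?mule1 ?mule0.
    by congr (Q _); apply: setIidl => X h /=; rewrite h.
  rewrite -(measure0 Q); congr (Q _); apply/seteqP; split => // X [h /=].
  by rewrite h // (negbTE Ax).
pose E : set path_space := [set X | A (X (n + k.+1)%N)]; rewrite -/E.
have mE : measurable (E : set path_space) by exact: measurable_coord.
have mC := @measurable_cylinder.
pose cp := cylinder n.+1 (extend n x (x n + 1)) : set path_space.
pose cm := cylinder n.+1 (extend n x (x n - 1)) : set path_space.
pose c0 := cylinder n x : set path_space.
have mcp : measurable cp by exact: mC.
have mcm : measurable cm by exact: mC.
have mc0 : measurable c0 by exact: mC.
have nn : extend n x (x n + 1) n = x n by rewrite /extend leqnn.
have nm : extend n x (x n - 1) n = x n by rewrite /extend leqnn.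
have np1 y : extend n x y n.+1 = y by rewrite /extend ltnn.
have Qp : Q cp = (Q c0 * (site w (x n))%:E)%E.
  by rewrite /cp QS cylinder_extend nn np1 /jump eqxx.
have Qm : Q cm = (Q c0 * (1 - site w (x n))%:E)%E.
  rewrite /cm QS cylinder_extend nm np1 /jump eqxx.
  by case: eqP => // /addrI.
have dpm : cp `&` cm = set0.
  apply/seteqP; split => // X [hp hm].
  have := hp n.+1 (leqnn _); rewrite (hm n.+1 (leqnn _)) !np1 => /addrI //.
have Qpm : Q (cp `|` cm) = Q c0.
  rewrite QU // Qp Qm -ge0_muleDr ?lee_fin //.
  - by rewrite -EFinD addrCA subrr addr0 mule1.
  - by have /andP[] := site_itv w (x n).
  - by rewrite subr_ge0; have /andP[] := site_itv w (x n).
have sub : cp `|` cm `<=` c0 by move=> X [] /cylinder_sub.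
have Qr : Q (c0 `\` (cp `|` cm)) = 0%E.
  rewrite measureD //; last by rewrite ltey_eq fin_num_measure.
    by rewrite setIidr // [X in (_ - X)%E]Qpm subee // fin_num_measure.
  exact: measurableU.
have mpm : measurable (cp `|` cm) by exact: measurableU.
have -> : (c0 `&` E) = ((cp `&` E) `|` (cm `&` E)) `|` ((c0 `\` (cp `|` cm)) `&` E).
  rewrite -setIUl -setIUl; congr (_ `&` _); rewrite setDUK //.
rewrite QU; last 3 first.
- by apply: measurableU; exact: measurableI.
- by apply: measurableI => //; exact: measurableD.
- apply/seteqP; split => // X [[[h _]|[h _]] [[_ nh] _]]; apply: nh; [left|right]; exact: h.
have -> : Q ((c0 `\` (cp `|` cm)) `&` E) = 0%E.
  apply: (subset_measure0 _ _ _ Qr).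
  - by apply: measurableI => //; exact: measurableD.
  - exact: measurableD.
  - exact: subIsetl.
rewrite QU; last 3 first.
- exact: measurableI.
- exact: measurableI.
- by rewrite setIACA dpm set0I.
have EE : E = [set X | A (X (n.+1 + k)%N)] by rewrite /E addSnnS.
rewrite adde0 [X in (Q (_ `&` X) + _)%E]EE [X in (_ + Q (_ `&` X))%E]EE.
rewrite [X in (X + _)%E]IH [X in (_ + X)%E]IH -/cp -/cm Qp Qm !np1 iterS.
have /fineK <- : Q c0 \is a fin_num by rewrite fin_num_measure.
set f := fine _; set phi := iter k _ _.
apply: (congr1 EFin (x := f * site w (x n) * phi (x n + 1) +
  f * (1 - site w (x n)) * phi (x n - 1)) (y := f * step phi (x n))).
by rewrite /step; ring.
Qed.

Lemma quenched_coord n (A : pred int) :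
  quenched_law w [set X | A (X n)] = (iter n step (fun y => (A y)%:R) 0)%:E.
Proof.
have [Q0 QS] := quenched_lawP w.
have C0 : cylinder 0 (fun=> 0) = [set X | X 0%N = 0].
  by apply/seteqP; split=> [X /(_ 0%N isT)//|X X0 k]; rewrite leqn0 => /eqP ->.
have := quenched_markov n 0 (fun=> 0) A; rewrite C0 add0n [X in (_ = X * _)%E]Q0 mul1e => <-.
pose E : set path_space := [set X | A (X n)]; rewrite -/E.
have mE : measurable (E : set path_space) by exact: measurable_coord.
have mC : measurable ([set X | X 0%N = 0] : set path_space).
  by rewrite -C0; exact: measurable_cylinder.
have QC : quenched_law w (~` [set X | X 0%N = 0]) = 0%E.
  by rewrite probability_setC // [X in (_ - X)%E]Q0 subee.
have QU (C D : set path_space) : measurable C -> measurable D -> C `&` D = set0 ->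
    quenched_law w (C `|` D) = (quenched_law w C + quenched_law w D)%E by exact: measureU.
rewrite -[LHS]/(quenched_law w E) -[in LHS](setTI E) -(setUv [set X | X 0%N = 0]) setIUl.
rewrite QU; last 3 first.
- exact: measurableI.
- by apply: measurableI => //; exact: measurableC.
- by apply/seteqP; split => // X [[h _] [nh _]]; exact: nh.
rewrite [X in (_ + X)%E](_ : _ = 0%E) ?adde0; last first.
  apply: (subset_measure0 _ _ _ QC).
  - by apply: measurableI => //; exact: measurableC.
  - exact: measurableC.
  - exact: subIsetl.
by [].
Qed.

Lemma iter_step_le n (phi psi : int -> R) x : (forall y, phi y <= psi y) ->
  iter n step phi x <= iter n step psi x.
Proof. by move=> h; elim: n x => // n IH x; apply: step_le; exact: IH. Qed.

(** The mean of [h] increases only when the walk is at [u], and then by at most [p]; in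
    time [n] there are at most [n] such visits. *)
Lemma escape_le (h : int -> R) (u : int) (p : R) n x :
  0 <= h u -> 0 <= p -> (forall y, y != u -> step h y <= h y) -> step h u <= p ->
  iter n step h x <= h x + n%:R * p.
Proof.
move=> hu p0 sup hp.
elim: n x => [|n IH] x; first by rewrite mul0r addr0.
rewrite iterS; apply: (@le_trans _ _ (step (fun y => h y + n%:R * p) x)).
  by apply: step_le; exact: IH.
rewrite stepDc -natr1 mulrDl mul1r addrA addrAC lerD2r.
have [->|xu] := eqVneq x u; first by rewrite -[leLHS]add0r lerD.
by rewrite -[leLHS]addr0 lerD // sup.
Qed.

(** Probability that the walk started at [x <= u] has not reached [u] by time [n]. *)
Fixpoint miss (u : int) (n : nat) (x : int) : R :=
  if n is n'.+1 then (if x < u then step (miss u n') x else 0) else (x < u)%R%:R.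

Lemma step1 (x : int) : step (fun=> 1) x = 1.
Proof. by rewrite /step; ring. Qed.

Lemma step0 (x : int) : step (fun=> 0) x = 0.
Proof. by rewrite /step; ring. Qed.

Lemma miss_ge0 u n x : 0 <= miss u n x.
Proof.
elim: n x => [|n IH] x /=; first exact: ler0n.
by case: ifP => // _; rewrite -(step0 x); apply: step_le; exact: IH.
Qed.

Lemma miss_decr u n x : miss u n.+1 x <= miss u n x.
Proof.
have b1 (b : bool) : (b%:R : R) <= 1 by case: b.
elim: n x => [|n IH] x.
  rewrite [leLHS]/= [leRHS]/=; case: ifP => // _; rewrite -[leRHS](step1 x).
  by apply: step_le; rewrite /= b1.
by rewrite [leLHS]/= [leRHS]/=; case: ifP => // _; apply: step_le; exact: IH.
Qed.

(** The sum is a truncated expected hitting time, and [f] is a supersolution of its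
    recursion. The condition on [f] is required above [N] only: before time [n] the walk
    has no time to come down to [N]. *)
Lemma miss_sum u (N : int) (f : int -> R) :
  (forall x, 0 <= f x) ->
  (forall x, N < x < u -> 1 + step f x <= f x) ->
  forall n x, N + n%:Z <= x -> x <= u -> \sum_(k < n) miss u k x <= f x.
Proof.
move=> f0 sup; elim=> [|n IH] x Nx xu; first by rewrite big_ord0.
rewrite big_ord_recl /=.
have [xltu|] := boolP (x < u); last first.
  by rewrite big1 ?addr0.
apply: le_trans (sup x _); last by lia.
apply: lerD => //.
rewrite (eq_bigr (fun i : 'I_n => step (miss u i) x)); last first.
  by move=> i _; rewrite add0n.
apply: (@le_trans _ _ (step (fun y => \sum_(i < n) miss u i y) x)).
  by rewrite /step !mulr_sumr -big_split.
by apply: step_le; apply: IH; lia.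
Qed.

(** Markov's inequality for the hitting time: [miss u k x] decreases in [k]. *)
Lemma miss_markov u n x : n%:R * miss u n x <= \sum_(k < n) miss u k x.
Proof.
elim: n => [|n IH]; first by rewrite mul0r big_ord0.
rewrite big_ord_recr /= -natr1 mulrDl mul1r; apply: lerD; last exact: miss_decr.
by apply: le_trans IH; rewrite ler_wpM2l // miss_decr.
Qed.

(** Once at [u], the walk is in the bad set with probability at most [n * p] by
    [escape_le], as the indicator [bad] is bounded by [h]. *)
Lemma reach_then_stay (h bad : int -> R) (u : int) (p : R) n x :
  h u = 0 -> 0 <= p -> (forall y, y != u -> step h y <= h y) -> step h u <= p ->
  (forall y, bad y <= h y) -> (forall y, bad y <= 1) ->
  x <= u -> iter n step bad x <= miss u n x + n%:R * p.
Proof.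
move=> hu p0 sup hp badh bad1.
have B m : iter m step bad u <= m%:R * p.
  apply: (le_trans (iter_step_le m u badh)).
  by have := @escape_le h u p m u; rewrite hu add0r; apply.
elim: n x => [|n IH] x xu.
  rewrite mul0r addr0 /=; have [//|] := boolP (x < u).
  rewrite -leNgt => ux; have -> : x = u by lia.
  by apply: (le_trans (badh u)); rewrite hu.
have [->|xnu] := eqVneq x u.
  by apply: (le_trans (B n.+1)); rewrite lerDr miss_ge0.
have xltu : x < u by lia.
rewrite iterS [miss _ _ _]/= xltu.
apply: (@le_trans _ _ (step (fun y => miss u n y + n%:R * p) x)).
  by apply: step_le; apply: IH; lia.
by rewrite stepDc lerD2l ler_wpM2r // ler_nat.
Qed.

End onestep.

Section valley.
Variables (R : realType) (w : env R).
Hypothesis w0 : forall i, site w i != 0.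

Lemma siteM_odds i : site w i * odds w i = 1 - site w i.
Proof. by rewrite /odds mulrC divfK. Qed.

Lemma pprodSl e k : pprod e w k.+1 = odds w (e 0%N) * pprod (e \o S) w k.
Proof. by rewrite /pprod big_ord_recl. Qed.

Lemma psumS e m : psum e w m.+1 = psum e w m + pprod e w m.+1.
Proof. by rewrite /psum big_ord_recr. Qed.

Lemma psumSl e m : psum e w m.+1 = odds w (e 0%N) * (1 + psum (e \o S) w m).
Proof.
rewrite /psum big_ord_recl /= pprodSl pprod0 mulr1 mulrDr mulr1; congr (_ + _).
by rewrite mulr_sumr; apply: eq_bigr => k _; rewrite pprodSl.
Qed.

Lemma leftwS z k : leftw (z + 1) (k.+1) = leftw z k.
Proof. by rewrite /leftw; lia. Qed.

Lemma leftw0 z : leftw (z + 1) 0 = z.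
Proof. by rewrite /leftw; lia. Qed.

(** Expected time to go from [z - 1] to [z], for the walk reflected at
    [z - k - 1]. *)
Definition cross (z : int) (k : nat) : R := 1 + 2 * psum (leftw z) w k.

Lemma cross_ge0 z k : 0 <= cross z k.
Proof. by rewrite addr_ge0 // mulr_ge0 // psum_ge0. Qed.

Lemma cross_rec z k : site w z * cross (z + 1) k.+1 = 1 + (1 - site w z) * cross z k.
Proof.
rewrite /cross psumSl leftw0.
have -> : leftw (z + 1) \o S = leftw z by apply: funext => j; exact: leftwS.
by have := siteM_odds z; set o := odds _ _; set p := site _ _; set q := psum _ _ _ => E;
  rewrite mulrDr mulr1 mulrCA (mulrA p o) E; ring.
Qed.

(** Expected hitting time of [u] from [x] for the walk reflected at [- t - 1]; the walk
    started at 0 does not feel the reflection before time [t]. *)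
Definition hitf (u t : nat) (x : int) : R :=
  \sum_(absz (x + t%:Z) <= k < u + t) cross (k%:Z - t%:Z + 1) k.+1.

Lemma hitf_ge0 u t x : 0 <= hitf u t x.
Proof. by apply: sumr_ge0 => k _; exact: cross_ge0. Qed.

Lemma hitf_super u t x : - t%:Z < x < u%:Z -> 1 + step w (hitf u t) x <= hitf u t x.
Proof.
move=> /andP[tx xu].
pose k := absz (x + t%:Z).
have xk : x = k%:Z - t%:Z by rewrite /k; lia.
have k0 : (0 < k)%N by rewrite /k; lia.
have ku : (k < u + t)%N by rewrite /k; lia.
have e1 : absz (x + 1 + t%:Z) = k.+1 by rewrite /k; lia.
have e2 : absz (x - 1 + t%:Z) = k.-1 by rewrite /k; lia.
have A : hitf u t x = cross (x + 1) k.+1 + hitf u t (x + 1).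
  rewrite /hitf e1 -/k big_ltn //; congr (cross _ _ + _); lia.
have B : hitf u t (x - 1) = cross x k + hitf u t x.
  rewrite /hitf e2 -/k big_ltn; last by lia.
  rewrite prednK //; congr (cross _ _ + _); lia.
have C := cross_rec x k.
rewrite /step B A; move: C; set p := site w x; set a := cross _ _.
set b := cross _ _; set c := hitf _ _ _ => C.
rewrite le_eqVlt; apply/orP; left; apply/eqP.
by transitivity ((1 + (1 - p) * b) + (a - p * a) + c); [ring|rewrite -C; ring].
Qed.

Definition hright (u : int) (c : R) (k : nat) : R := c * psum (rightw u) w k.

(** Increment of the harmonic scale function between [u - j - 1] and [u - j], normalized
    to be 1 between [u - L - 1] and [u - L]. *)
Definition dleft (u : int) (L j : nat) : R :=
  if (j <= L)%N then pprod (leftw (u - j%:Z)) w (L - j) else 0.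

Definition hleft (u : int) (L k : nat) : R := \sum_(j < k) dleft u L j.

(** A function vanishing at [u], superharmonic elsewhere, and at least 1 beyond the
    valley walls: both parts are multiples of the harmonic scale function, the left one
    being made constant below [u - L - 1]. *)
Definition wall (u : int) (c : R) (L : nat) (x : int) : R :=
  if u <= x then hright u c (absz (x - u)) else hleft u L (absz (u - x)).

Lemma dleft_ge0 u L j : 0 <= dleft u L j.
Proof. by rewrite /dleft; case: ifP => // _; exact: pprod_ge0. Qed.

Lemma hleft_ge0 u L k : 0 <= hleft u L k.
Proof. by apply: sumr_ge0 => j _; exact: dleft_ge0. Qed.

Lemma hright_ge0 u c k : 0 <= c -> 0 <= hright u c k.
Proof. by move=> c0; rewrite mulr_ge0 // psum_ge0. Qed.

Lemma wall_ge0 u c L x : 0 <= c -> 0 <= wall u c L x.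
Proof.
by move=> c0; rewrite /wall; case: ifP => _; [exact: hright_ge0|exact: hleft_ge0].
Qed.

Lemma hright0 u c : hright u c 0 = 0.
Proof. by rewrite /hright /psum big_ord0 mulr0. Qed.

Lemma hleft0 u L : hleft u L 0 = 0.
Proof. by rewrite /hleft big_ord0. Qed.

Lemma wall_right u c L k : wall u c L (u + k%:Z) = hright u c k.
Proof. by rewrite /wall ifT; [congr hright; lia|lia]. Qed.

Lemma wall_left u c L k : wall u c L (u - k%:Z) = hleft u L k.
Proof.
rewrite /wall; case: ifPn => h; last by congr hleft; lia.
by have -> : k = 0%N by [lia]; rewrite hleft0 (_ : absz (_) = 0%N) ?hright0 //; lia.
Qed.

Lemma wall_u u c L : wall u c L u = 0.
Proof. by have := wall_right u c L 0; rewrite addr0 hright0. Qed.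

Lemma dleft_rec u L j : site w (u - j.+1%:Z) * dleft u L j >=
  (1 - site w (u - j.+1%:Z)) * dleft u L j.+1.
Proof.
have /andP[p0 p1] := site_itv w (u - j.+1%:Z).
rewrite [dleft u L j.+1]/dleft; case: ifPn => jL; last by rewrite mulr0 mulr_ge0 // dleft_ge0.
rewrite /dleft ltnW // (_ : (L - j = (L - j.+1).+1)%N); last by lia.
rewrite pprodSl mulrA (_ : leftw (u - j%:Z) 0 = u - j.+1%:Z); last by rewrite /leftw; lia.
have -> : leftw (u - j%:Z) \o S = leftw (u - j.+1%:Z).
  by apply: funext => k; rewrite /leftw /=; lia.
by rewrite siteM_odds.
Qed.

Lemma wall_super u c L x : 0 <= c -> x != u -> step w (wall u c L) x <= wall u c L x.
Proof.
move=> c0 xu; rewrite /step; have [h|h] := leP u x.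
  have [k xk] : exists k, x = u + k.+1%:Z by exists (absz (x - u)).-1; lia.
  have -> : x + 1 = u + k.+2%:Z by lia.
  have -> : x - 1 = u + k%:Z by lia.
  rewrite [X in _ <= wall _ _ _ X]xk !wall_right /hright.
  rewrite (psumS _ k.+1) (psumS _ k) (pprodS _ _ k.+1) /=.
  have -> : rightw u k.+1 = x by rewrite /rightw xk.
  have := siteM_odds x; set p := site w x; set o := odds w x.
  set a := psum _ _ _; set b := pprod _ _ _ => E.
  rewrite le_eqVlt; apply/orP; left; apply/eqP.
  transitivity (c * (a + p * b + b * (p * o))); first by ring.
  by rewrite E; ring.
have [k xk] : exists k, x = u - k.+1%:Z by exists (absz (u - x)).-1; lia.
have -> : x + 1 = u - k%:Z by lia.
have -> : x - 1 = u - k.+2%:Z by lia.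
rewrite [X in _ <= wall _ _ _ X]xk !wall_left /hleft !big_ord_recr /=.
have := dleft_rec u L k; rewrite -xk.
by move: (dleft u L k) (dleft u L k.+1) (\sum_(i < _) _) => a b d; nra.
Qed.

Lemma wall_at u c L : 0 <= c -> step w (wall u c L) u <= c + pprod (leftw u) w L.
Proof.
move=> c0; rewrite /step.
have -> : u + 1 = u + 1%:Z by [].
have -> : u - 1 = u - 1%:Z by [].
rewrite wall_right wall_left /hright /psum /hleft !big_ord_recl !big_ord0 !addr0 /=.
rewrite pprodS pprod0 mul1r /dleft leq0n subn0 subr0 /rightw addr0.
have q0 := pprod_ge0 (leftw u) w L; have /andP[p0 p1] := site_itv w u.
rewrite mulrCA siteM_odds; move: q0; move: (pprod _ _ _) (site w u) p0 p1 => q p p0 p1 q0.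
nra.
Qed.

Lemma wall_far u c L x : 0 < c -> (exists2 j, (j < L)%N & 1 <= c * pprod (rightw u) w j.+1) ->
  (L < `|x - u|)%N -> 1 <= wall u c L x.
Proof.
move=> c0 [j jL hj] xL; have [h|h] := leP u x.
  have -> : x = u + (absz (x - u))%:Z by lia.
  rewrite wall_right; apply: (le_trans hj); rewrite /hright ler_pM2l //.
  have jx : (j < `|x - u|)%N by lia.
  rewrite /psum (bigD1 (Ordinal jx)) //= lerDl; apply: sumr_ge0 => i _; exact: pprod_ge0.
have -> : x = u - (absz (x - u))%:Z by lia.
rewrite wall_left /hleft (bigD1 (Ordinal xL)) //= -[leLHS]addr0; apply: lerD.
  by rewrite /dleft leqnn subnn pprod0.
by apply: sumr_ge0 => i _; exact: dleft_ge0.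
Qed.

Lemma hitf_origin u t : hitf u t 0 = \sum_(i < u) cross (i%:Z + 1) (t + i.+1).
Proof.
rewrite /hitf add0r absz_nat -{1}(add0n t) big_addn addnK big_mkord.
apply: eq_bigr => i _; congr (cross _ _); lia.
Qed.

(** The two terms are the failure to reach [u] in time, by Markov's inequality for the
    hitting time, and the exit from the valley after having reached [u]: by [wall_at],
    each visit to [u] raises the mean of [wall] by at most [c + pprod (leftw u) w L],
    where [1 / c] is the height of the right wall. *)
Lemma quenched_valley (u t L : nat) (c : R) : (0 < t)%N -> 0 < c ->
  (exists2 j, (j < L)%N & 1 <= c * pprod (rightw u) w j.+1) ->
  (quenched_law w [set X | (L < `|X t - u%:Z|)%N] <=
    ((\sum_(i < u) cross (i%:Z + 1) (t + i.+1)) / t%:R +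
      t%:R * (c + pprod (leftw u) w L))%:E)%E.
Proof.
move=> t0 c0 hj.
rewrite (quenched_coord w t (fun x => L < `|x - u%:Z|)%N) lee_fin.
have q0 := pprod_ge0 (leftw u) w L.
have c0' := ltW c0.
apply: (le_trans (@reach_then_stay R w (wall u c L) _ u (c + pprod (leftw u) w L) t 0 _ _ _ _ _ _ _)).
- exact: wall_u.
- exact: addr_ge0.
- by move=> y; exact: wall_super.
- exact: wall_at.
- move=> y; case: (boolP (L < _)%N) => h; first exact: wall_far.
  exact: wall_ge0.
- by move=> y; case: (L < _)%N.
- by [].
rewrite lerD2r ler_pdivlMr ?ltr0n // mulrC; apply: (le_trans (miss_markov _ _ _ _)).
rewrite -hitf_origin; apply: (@miss_sum R w u (- t%:Z)) => //.
- by move=> x; exact: hitf_ge0.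
- by move=> x; exact: hitf_super.
- by lia.
Qed.

End valley.

(** * Consequences of the moment hypotheses *)

Section moments.
Variables (R : realType) (P : probability (env R) R) (P_iid : iid_env P) (s : R).
Hypothesis s_gt0 : 0 < s.
Local Open Scope ereal_scope.
Hypotheses (E_log_rho_lt0 : \int[P]_w log_rho w < 0)
  (E_rho_s : \int[P]_w (rho w `^ s) = 1)
  (E_rho_s_log_rho : \int[P]_w (rho w `^ s * log_rho w) < +oo).
Local Notation T := (trans P).

Let blocked := [set w : env R | site w 0 == 0%R].

Let measurable_blocked_fun : measurable_fun setT (fun w : env R => site w 0 == 0%R).
Proof. by apply: measurable_fun_eqr => //; exact: measurable_site. Qed.

Let measurable_blocked : measurable blocked.
Proof. exact: measurable_setb. Qed.

Lemma rho_odds (w : env R) : site w 0 != 0%R -> rho w = (odds w 0)%:E.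
Proof. by rewrite /rho => /negbTE ->. Qed.

Let rho_poweR (w : env R) : rho w `^ s = if site w 0 == 0%R then +oo else (odds w 0 `^ s)%:E.
Proof.
rewrite /rho; case: ifP => _; last by rewrite poweR_EFin.
by rewrite poweRyr // gt_eqF.
Qed.

Let measurable_pwo a : measurable_fun setT (fun w : env R => (odds w 0 `^ a)%:E).
Proof.
by apply/measurable_EFinP; apply: (measurableT_comp (measurable_powR a) (@measurable_odds R 0)).
Qed.

Let measurable_rho_s : measurable_fun setT (fun w : env R => rho w `^ s).
Proof.
rewrite (_ : (fun w => _) = fun w => if site w 0 == 0%R then +oo else (odds w 0 `^ s)%:E).
  exact: measurable_fun_ifT.
by apply/funext => w; exact: rho_poweR.
Qed.

Let rho_s_ge0 (w : env R) : 0 <= rho w `^ s.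
Proof. by rewrite rho_poweR; case: ifP => // _; rewrite lee_fin powR_ge0. Qed.

(** A site value 0 makes [rho] infinite, and [E rho^s] is finite. *)
Lemma prob_blocked0 : P blocked = 0.
Proof.
apply/eqP; rewrite eq_le measure_ge0 andbT leNgt; apply/negP => pos.
pose f (w : env R) := (if site w 0 == 0%R then +oo else 0 : \bar R).
have mf : measurable_fun setT f by exact: measurable_fun_ifT.
have : \int[P]_w f w <= 1.
  rewrite -E_rho_s; apply: ge0_le_integral => //.
  - by move=> w _; rewrite /f; case: ifP.
  - by move=> w _; rewrite /f rho_poweR; case: ifP => // _; rewrite lee_fin powR_ge0.
have -> : \int[P]_w f w = +oo * P blocked.
  rewrite -[X in P X]setIT -integral_indic // -ge0_integralZl //.
  - apply: eq_integral => w _; rewrite /f indicE.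
    case: ifPn => h; first by rewrite mem_set //= mule1.
    by rewrite memNset ?mule0 //; exact/negP.
  - by apply/measurable_EFinP; exact: measurable_indic.
by rewrite gt0_mulye.
Qed.

Lemma prob_blocked i : P [set w : env R | site w i == 0%R] = 0.
Proof.
case: P_iid => mu Pmu; rewrite -prob_blocked0.
have E j : P [set w : env R | site w j == 0%R] = mu [set 0%R].
  have := Pmu [:: j] (fun=> [set 0%R]) isT (fun=> measurable_set1 0%R).
  rewrite big_seq1 => <-; congr (P _); apply/seteqP; split => w /=.
    by move=> /eqP h k; rewrite inE => /eqP ->.
  by move=> /(_ j (mem_head _ _)) /eqP.
by rewrite /blocked !E.
Qed.

Lemma negligible_blocked : P.-negligible [set w : env R | exists i, site w i = 0%R].
Proof.
have mi i : measurable [set w : env R | site w i == 0%R].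
  by apply: measurable_setb; apply: measurable_fun_eqr => //; exact: measurable_site.
pose f n : set (env R) := if unpickle n is Some i then [set w : env R | site w i == 0%R] else set0.
apply: (@negligibleS _ _ _ _ (\bigcup_n f n)).
  by move=> w [i wi]; exists (pickle i) => //; rewrite /f pickleK /= wi.
apply: negligible_bigcup => n; rewrite /f; case: (unpickle n) => [i|]; last exact: negligible_set0.
by exists [set w : env R | site w i == 0%R]; split => //; exact: prob_blocked.
Qed.

Let ae_unblocked (Q : env R -> Prop) : (forall w, site w 0 != 0%R -> Q w) -> {ae P, forall w, Q w}.
Proof.
move=> h; exists blocked; split => //; first exact: prob_blocked0.
move=> w /= nQ; by apply: contrapT => /negP w0; exact: nQ (h w w0).
Qed.

Lemma trans_pw_s : T (pw s) 1 = 1.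
Proof.
rewrite -E_rho_s; apply: ge0_ae_eq_integral => //.
- exact: (nnm_comp 1 0 (pw_nnm s)).
- by move=> w _; exact: nnm_ge0 (pw_nnm s).
- by apply: ae_unblocked => w w0 _; rewrite rho_poweR (negbTE w0) mul1r.
Qed.

Let measurable_log_rho : measurable_fun setT (fun w : env R => log_rho w).
Proof.
rewrite (_ : (fun w => _) = fun w => if site w 0 == 0%R then +oo else
    if (odds w 0 <= 0)%R then -oo else (ln (odds w 0))%:E).
  have mo := @measurable_odds R 0.
  have h1 : measurable_fun setT (fun w : env R => odds w 0 <= 0)%R by apply: measurable_fun_ler.
  have h2 : measurable_fun setT (fun w : env R => (ln (odds w 0))%:E).
    by apply/measurable_EFinP; exact: (measurableT_comp (@measurable_ln R) mo).
  by apply: measurable_fun_ifT => //; exact: measurable_fun_ifT.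
by apply/funext => w; rewrite /log_rho /rho; case: ifP.
Qed.

(** [2 x^(s/2) <= 1 + x^s], with equality for [x = 1] only, and [rho] is not almost
    surely 1 because [log rho] has negative mean. *)
Lemma half_moment : exists r : R, [/\ (0 <= r)%R, (r < 1)%R & T (pw (s / 2)) 1 = r%:E].
Proof.
set I := T (pw (s / 2)) 1.
have I0 : 0 <= I by apply: integral_ge0 => w _; exact: nnm_ge0 (pw_nnm _).
pose D (x : R) : \bar R := ((1 - x `^ (s / 2)) ^+ 2)%:E.
have hD : nnm D.
  split; last by move=> x; rewrite lee_fin sqr_ge0.
  have mp : measurable_fun setT (fun x : R => 1 - x `^ (s / 2))%R.
    apply: measurable_funB; first exact: measurable_cst.
    have [m _] := pw_nnm (s / 2)%R.
    by apply/measurable_EFinP.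
  by apply/measurable_EFinP; exact: measurable_funX.
have hp a := pw_nnm (R := R) a.
have eq2 : T D 1 + (I + I) = 1 + 1.
  rewrite -[X in _ = _ + X]trans_pw_s -[X in _ = X + _](trans_cst P 1%R 1%R) -!trans_add //; last exact: nnm_add.
  by apply: trans_eq => // x x0; rewrite /D /pw -!EFinD (powR_half s_gt0); congr EFin; ring.
have lt2 : 1 + 1 < +oo :> \bar R by exact: ltry.
have TD_ge0 : 0 <= T D 1 by exact: (nnm_ge0 1 (trans_nnm P hD)).
have Ifin : I \is a fin_num.
  rewrite ge0_fin_numE //; apply: le_lt_trans lt2; rewrite -eq2.
  by rewrite (le_trans (leeDl I I0)) // leeDr.
have Dfin : T D 1 \is a fin_num.
  rewrite ge0_fin_numE //; apply: le_lt_trans lt2; rewrite -eq2.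
  by rewrite leeDl // adde_ge0.
exists (fine I); rewrite fineK // fine_ge0 //; split=> //.
have D0 : (0 <= fine (T D 1))%R by exact: fine_ge0.
have eq2' : (fine (T D 1) + (fine I + fine I) = 1 + 1)%R.
  by apply: EFin_inj; rewrite !EFinD !fineK.
rewrite lt_neqAle; apply/andP; split; last by move: eq2' D0; lra.
apply/eqP => I1.
have TD0 : T D 1 = 0.
  rewrite -(fineK Dfin); congr EFin; move: eq2'; rewrite I1; lra.
have mD : measurable_fun setT (fun w : env R => D (1 * odds w 0)%R) by exact: nnm_comp.
have aeD : ae_eq P setT (fun w => D (1 * odds w 0)%R) (cst 0).
  apply/(ae_eq_integral_abs P measurableT mD); rewrite -[RHS]TD0.
  by apply: eq_integral => w _; rewrite gee0_abs // nnm_ge0.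
have aelog : ae_eq P setT (fun w => log_rho w) (cst 0).
  have ab : {ae P, forall w, site w 0 != 0%R} by exact: ae_unblocked.
  apply: filterS2 aeD ab => w h w0 _; move: (h Logic.I); rewrite /D mul1r => -[] /eqP.
  rewrite sqrf_eq0 subr_eq0 => /eqP h1.
  rewrite /log_rho rho_odds //.
  suff -> : odds w 0 = 1%R by rewrite lne1.
  have /eqP := esym h1; rewrite powR_eq1 => /or3P[/eqP //|h2|h2].
    by move: h2; rewrite ltNge odds_ge0.
  by move: h2; rewrite mulf_eq0 invr_eq0 pnatr_eq0 orbF gt_eqF.
move: E_log_rho_lt0; rewrite (ae_eq_integral (cst 0) _ measurableT _ _ aelog) //.
by rewrite integral0 ltxx.
Qed.

Lemma count_pow2_le n (x : R) : (1 <= x)%R ->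
  (\sum_(i < n) (2 ^+ i <= x)%R%:R <= 1 + ln x / ln 2 :> R)%R.
Proof.
move=> x1; have l2 : (0 < ln 2 :> R)%R by rewrite ln_gt0 // ltr1n.
have lx : (0 <= ln x)%R by exact: ln_ge0.
elim: n => [|n IH]; first by rewrite big_ord0 addr_ge0 // divr_ge0 // ltW.
rewrite big_ord_recr /=; have [h|h] := leP (2 ^+ n)%R x; last by rewrite addr0.
have le_n : (\sum_(i < n) (2 ^+ i <= x)%R%:R <= n%:R :> R)%R.
  rewrite -[leRHS](_ : (\sum_(i < n) 1)%R = _); last by rewrite sumr_const card_ord.
  by apply: ler_sum => i _; case: (2 ^+ i <= x)%R.
apply: (@le_trans _ _ (1 + n%:R)%R); first by rewrite addrC lerD2l.
rewrite lerD2l ler_pdivlMr // [leLHS]mulr_natl -lnXn //.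
by rewrite ler_ln ?posrE ?exprn_gt0 // (lt_le_trans ltr01).
Qed.

Let rl (w : env R) : \bar R := rho w `^ s * log_rho w.

Let rlE (w : env R) : (0 < odds w 0)%R -> rl w = (odds w 0 `^ s * ln (odds w 0))%:E.
Proof.
move=> o0; have w0 : site w 0 != 0%R.
  by apply: contraTneq o0; rewrite /odds => ->; rewrite invr0 mulr0 ltxx.
by rewrite /rl rho_poweR (negbTE w0) /log_rho rho_odds //= leNgt o0 /= -EFinM.
Qed.

(** [x^s log x] is bounded below by [- 1 / s], so that the hypothesis on its upper part
    makes it integrable. *)
Let rl_neg (w : env R) : rl^\- w <= (s^-1)%:E.
Proof.
have si : (0 <= s^-1)%R by rewrite invr_ge0 ltW.
rewrite funenegE; have [h0|h0] := ltP 0%R (odds w 0).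
  rewrite rlE // ge_max; apply/andP; split; last by rewrite lee_fin.
  rewrite -EFinN lee_fin.
  set x := odds w 0 in h0 |- *.
  have y0 : (0 < x `^ s)%R by exact: powR_gt0.
  have h : (- ln (x `^ s) <= (x `^ s)^-1 - 1)%R.
    rewrite -lnV ?posrE // -[in leLHS](subrK 1 (x `^ s)^-1)%R addrC le_ln1Dx //.
    by rewrite ltrBrDl subrr invr_gt0.
  rewrite ln_powR in h; set y := (x `^ s)%R in h y0 |- *.
  have h2 : (- (y * (s * ln x)) <= 1)%R.
    rewrite -mulrN; apply: (le_trans (ler_wpM2l (ltW y0) h)).
    by rewrite mulrBr divff ?gt_eqF // mulr1 gerBl ltW.
  rewrite -(ler_pM2l s_gt0) divff ?gt_eqF //.
  by apply: le_trans h2; rewrite mulrN mulrCA.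
have o00 : odds w 0 = 0%R by apply/eqP; rewrite eq_le h0 odds_ge0.
suff rl0 : 0 <= rl w by rewrite max_r ?lee_fin // leeNl oppe0.
rewrite /rl rho_poweR; case: ifPn => w0; last by rewrite o00 powR0 ?gt_eqF // mul0e.
by rewrite /log_rho /rho w0 mule_ge0 //= leey.
Qed.

Let measurable_rl : measurable_fun setT rl.
Proof. exact: (emeasurable_funM measurable_rho_s measurable_log_rho). Qed.

Let integral_rl_pos : \int[P]_w rl^\+ w < +oo.
Proof.
have neg : \int[P]_w rl^\- w < +oo.
  apply: (@le_lt_trans _ _ (\int[P]_w (s^-1)%:E)).
    by apply: ge0_le_integral => //; exact: measurable_funeneg.
  rewrite (expect_cst P (s^-1)%:E); exact: ltry.
have neg0 : 0 <= \int[P]_w rl^\- w by exact: integral_ge0.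
move: E_rho_s_log_rho; rewrite integralE -/rl => lt.
rewrite ltNge leye_eq; apply/eqP => pos.
move: lt; rewrite [X in X - _](_ : _ = +oo) // addye // -?ltNye.
by rewrite ltNye eqe_oppLR /= -ltey.
Qed.

(** Exchanging sum and expectation, the number of powers of two below [x >= 1] is at most
    [1 + log_2 x]. *)
Let tail_moment_sum n : \sum_(i < n) tail_moment P s (2 ^+ i) <=
  1 + (ln 2)^-1%:E * \int[P]_w rl^\+ w.
Proof.
have l2 : (0 < ln 2 :> R)%R by rewrite ln_gt0 // ltr1n.
have hc (i : 'I_n) := cutpw_nnm s (2 ^+ i : R)%R.
rewrite /tail_moment -trans_sum // /trans -[X in X + _]trans_pw_s /trans.
have mpos : measurable_fun setT rl^\+ by exact: measurable_funepos.
rewrite -ge0_integralZl_EFin ?invr_ge0 ?(ltW l2) //.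
have mz : measurable_fun setT (fun w => (ln 2)^-1%:E * rl^\+ w) by exact: measurable_funeM.
have hs := nnm_sum (index_enum 'I_n) hc.
rewrite -ge0_integralD //; last 3 first.
- by move=> w _; exact: nnm_ge0 (pw_nnm s).
- exact: (nnm_comp 1 0 (pw_nnm s)).
- by move=> w _; rewrite mule_ge0 // lee_fin invr_ge0 ltW.
apply: ge0_le_integral => //.
- by move=> w _; exact: (nnm_ge0 _ hs).
- exact: (nnm_comp 1 0 hs).
- by apply: emeasurable_funD => //; exact: (nnm_comp 1 0 (pw_nnm s)).
move=> w _; rewrite mul1r; set x := odds w 0.
have rp0 : 0 <= rl^\+ w by exact: funepos_ge0.
have [x1|x1] := ltP x 1%R.
  rewrite big1; last first.
    move=> i _; rewrite /cutpw leNgt (lt_le_trans x1) //.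
    by rewrite exprn_ege1 // ler1n.
  by rewrite adde_ge0 ?(nnm_ge0 _ (pw_nnm s)) // mule_ge0 // lee_fin invr_ge0 ltW.
have x0 : (0 < x)%R by exact: lt_le_trans x1.
have -> : rl^\+ w = (x `^ s * ln x)%:E.
  rewrite funeposE rlE // max_l // lee_fin mulr_ge0 ?powR_ge0 //; exact: ln_ge0.
have -> : \sum_(i < n) cutpw s (2 ^+ i) x = (x `^ s * \sum_(i < n) (2 ^+ i <= x)%R%:R)%:E.
  rewrite mulr_sumr -sumEFin; apply: eq_bigr => i _; rewrite /cutpw /pw.
  by case: ifP => _; rewrite ?mulr1 ?mulr0.
rewrite /pw -EFinM -EFinD lee_fin.
apply: (le_trans (ler_wpM2l (powR_ge0 x s) (count_pow2_le n x1))).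
by rewrite mulrDr mulr1 lerD2l mulrA mulrC.
Qed.

(** The tail of a convergent series. *)
Lemma tail_moment_small (eps : R) : (0 < eps)%R ->
  exists B : nat, forall J, \sum_(i < J) tail_moment P s (2 ^+ (B + i)) <= eps%:E.
Proof.
move=> eps0; have l2 : (0 < ln 2 :> R)%R by rewrite ln_gt0 // ltr1n.
pose u n : R := (\sum_(i < n) fine (tail_moment P s (2 ^+ i)))%R.
have tfin i : tail_moment P s (2 ^+ i) \is a fin_num by exact: (tail_moment_fin trans_pw_s).
have uE n : (u n)%:E = \sum_(i < n) tail_moment P s (2 ^+ i).
  by rewrite /u -sumEFin; apply: eq_bigr => i _; rewrite fineK.
have pos0 : 0 <= \int[P]_w rl^\+ w by exact: integral_ge0.
pose M := (1 + (ln 2)^-1 * fine (\int[P]_w rl^\+ w))%R.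
have uM n : (u n <= M)%R.
  rewrite -lee_fin uE (le_trans (tail_moment_sum n)) // /M EFinD EFinM fineK //.
  by rewrite ge0_fin_numE.
have hs : has_sup (range u).
  by split; [exists (u 0%N); exists 0%N|exists M => _ [n _ <-]].
have [_ [B _ <-] hB] := sup_adherent eps0 hs.
exists B => J.
have -> : \sum_(i < J) tail_moment P s (2 ^+ (B + i)) = (u (B + J)%N - u B)%:E.
  rewrite /u big_split_ord /= addrAC subrr add0r -sumEFin.
  by apply: eq_bigr => i _; rewrite fineK.
have := ub_le_sup hs.2 (imageT u (B + J)%N).
by rewrite lee_fin; move: hB; lra.
Qed.

End moments.

(** * Traps *)

Section good_sites.
Variable R : realType.

Lemma leftw_inj z : injective (leftw z).
Proof. by move=> i j; rewrite /leftw; lia. Qed.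

Lemma rightw_inj z : injective (rightw z).
Proof. by move=> i j; rewrite /rightw; lia. Qed.

Lemma pprod_rev (w : env R) (u : int) d :
  pprod (leftw (u + d%:Z)) w d = pprod (rightw u) w d.
Proof.
rewrite /pprod (reindex_inj rev_ord_inj) /=; apply: eq_bigr => j _.
by congr odds; rewrite /leftw /rightw; have := ltn_ord j; lia.
Qed.

Lemma pprod_cat e (w : env R) m k :
  pprod e w (m + k) = pprod e w m * pprod (fun j => e (m + j)%N) w k.
Proof. by rewrite /pprod big_split_ord. Qed.

Lemma psum_cat e (w : env R) m k :
  psum e w (m + k) = psum e w m + pprod e w m * psum (fun j => e (m + j)%N) w k.
Proof.
rewrite /psum big_split_ord /=; congr (_ + _); rewrite mulr_sumr.
by apply: eq_bigr => j _; rewrite -pprod_cat addnS.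
Qed.

Lemma psum_ge_term e (w : env R) m k : (k < m)%N -> pprod e w k.+1 <= psum e w m.
Proof.
move=> km; rewrite /psum (bigD1 (Ordinal km)) //= lerDl.
by apply: sumr_ge0 => i _; exact: pprod_ge0.
Qed.

Lemma psum_le e (w : env R) m k : (m <= k)%N -> psum e w m <= psum e w k.
Proof.
move=> mk; rewrite -(subnK mk) addnC psum_cat lerDl mulr_ge0 ?pprod_ge0 //.
exact: psum_ge0.
Qed.

(** Expected time to go from [b] to [b + m] for the walk reflected at [b - 1]; this part
    of the hitting time of [b + m] is a function of the sites from [b] on. *)
Definition blocktime (b m : nat) (w : env R) : R :=
  \sum_(k < m) cross w (b%:Z + k%:Z + 1) k.+1.

(** The conditions on the left of a candidate site [b + m]: it is reached in a mean time
    [tau], and the left wall of its valley is high. The ladder condition serves to make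
    the traps of different sites incompatible. *)
Definition approach (b L m : nat) (tau q : R) (w : env R) : bool :=
  [&& blocktime b m w <= tau, ladder (leftw (b + m)%N) L w & pprod (leftw (b + m)%N) w L < q].

Definition trap (b L m : nat) (tau q y : R) (w : env R) : bool :=
  approach b L m tau q w && ramp (rightw (b + m)%N) y L w.

(** The walk has to climb the ramp at [b + m] in order to reach [b + m'], which takes a
    mean time of at least [2 * y]. *)
Lemma ramp_passed (b m m' : nat) y (w : env R) k : (m <= k)%N -> (k < m')%N ->
  y <= pprod (rightw (b + m)%N) w (k - m).+1 -> 2 * y <= blocktime b m' w.
Proof.
move=> mk km' yk; rewrite /blocktime (bigD1 (Ordinal km')) //=.
apply: (@le_trans _ _ (cross w (b%:Z + k%:Z + 1) k.+1)); last first.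
  by rewrite lerDl; apply: sumr_ge0 => i _; exact: cross_ge0.
have hk : ((k - m) < k.+1)%N by lia.
have h1 := @psum_ge_term (leftw (b%:Z + k%:Z + 1)) w k.+1 (k - m) hk.
have E : leftw (b%:Z + k%:Z + 1) = leftw ((b + m)%N%:Z + (k - m).+1%:Z).
  by congr leftw; lia.
rewrite /cross; rewrite E in h1 *; rewrite pprod_rev in h1.
by have := le_trans yk h1; lra.
Qed.

(** Two different sites cannot both be traps: either the time to reach the second
    one includes the time to climb the ramp of the first one, or the second one
    lies on this ramp and is no ladder point. *)
Lemma trap_unique (b L : nat) (m m' : nat) (tau q y : R) (w : env R) : tau < 2 * y ->
  trap b L m tau q y w -> trap b L m' tau q y w -> m = m'.
Proof.
move=> ty; wlog mm' : m m' / (m < m')%N.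
  move=> H t1 t2; case: (ltngtP m m') => [h|h|//]; first exact: H.
  by symmetry; exact: H.
move=> /andP[_ /rampP[k [kL yk hk]]] /andP[/and3P[bt lad _] _]; exfalso.
have [h|h] := ltnP (m + k) m'.
  have := @ramp_passed b m m' y w (m + k) (leq_addr _ _) h.
  rewrite addKn => /(_ yk) h2.
  by have := lt_le_trans ty (le_trans h2 bt); rewrite ltxx.
have [d dE] : exists d, (m' = m + d.+1)%N by exists (m' - m.+1)%N; lia.
have dk : (d <= k)%N by lia.
have dL : (d.+1 < L.+1)%N by lia.
have := forallP lad (Ordinal dL); rewrite /=.
have -> : (b + m')%N%:Z = (b + m)%N%:Z + d.+1%:Z by lia.
rewrite pprod_rev => h2.
by have := lt_le_trans (hk d dk) h2; rewrite ltxx.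
Qed.

Lemma measurable_cross z k : measurable_fun setT (fun w : env R => cross w z k).
Proof.
apply: measurable_funD => //; apply: measurable_funM => //; exact: measurable_psum.
Qed.

Lemma measurable_blocktime b m : measurable_fun setT (blocktime b m).
Proof. by apply: measurable_sum => k; exact: measurable_cross. Qed.

Lemma measurable_ladder e L : measurable_fun setT (ladder e L : env R -> bool).
Proof.
by apply: measurable_forall => k; apply: measurable_fun_ler => //; exact: measurable_pprod.
Qed.

Lemma measurable_approach (b L m : nat) (tau q : R) : measurable_fun setT (approach b L m tau q).
Proof.
apply: measurable_and.
  by apply: measurable_fun_ler => //; exact: measurable_blocktime.
apply: measurable_and; first exact: measurable_ladder.
by apply: measurable_fun_ltr => //; exact: measurable_pprod.
Qed.

Lemma measurable_trap (b L m : nat) (tau q y : R) : measurable_fun setT (trap b L m tau q y).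
Proof. by apply: measurable_and; [exact: measurable_approach|exact: measurable_ramp]. Qed.

Definition window (b b' : nat) : set int := [set i | b%:Z <= i < b'%:Z].

Lemma rightw_window b m j : (~` window b (b + m)) (rightw (b + m)%N j).
Proof. by rewrite /window /rightw /=; lia. Qed.

Lemma approach_dep (b L m : nat) (tau q : R) : (L <= m)%N ->
  depends_on (window b (b + m)) (approach b L m tau q).
Proof.
move=> Lm w w' h.
have hp k : (k <= L)%N -> pprod (leftw (b + m)%N) w k = pprod (leftw (b + m)%N) w' k.
  move=> kL; apply: (pprod_dep _ h) => j jk; rewrite /window /leftw /=; lia.
rewrite /approach; congr [&& _, _ & _].
- congr (_ <= _); apply: eq_bigr => k _; rewrite /cross; congr (1 + 2 * _).
  apply: (psum_dep _ h) => j jk; rewrite /window /leftw /=; have := ltn_ord k; lia.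
- by apply: eq_forallb => k; rewrite hp // -ltnS.
- by rewrite hp.
Qed.

Lemma ramp_dep e y L (I : set int) : (forall j, (j < L)%N -> I (e j)) ->
  depends_on I (ramp e y L : env R -> bool).
Proof.
move=> hI w w' h.
have hp k : (k <= L)%N -> pprod e w k = pprod e w' k.
  by move=> kL; apply: (pprod_dep _ h) => j jk; apply: hI; exact: leq_trans jk kL.
apply: eq_existsb => k; rewrite hp ?ltn_ord //; congr (_ && _).
by apply: eq_forallb => j; rewrite hp ?ltn_ord.
Qed.

Definition trapped b L n (tau q y : R) : set (env R) :=
  [set w | [exists i : 'I_n, trap b L (L + i) tau q y w]].

Lemma measurable_trapped (b L n : nat) tau q y : measurable (trapped b L n tau q y).
Proof.
by apply: measurable_setb; apply: measurable_exists => i; exact: measurable_trap.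
Qed.

Lemma trapped_dep (b L n : nat) tau q y : depends_on (window b (b + (L + n + L))) (trapped b L n tau q y).
Proof.
move=> w w' h; rewrite /trapped /=; congr is_true; apply: eq_existsb => i.
have hi := ltn_ord i.
congr (_ && _).
  apply: approach_dep (leq_addr _ _) _ _ _ => j; rewrite /window /= => jw; apply: h.
  by rewrite /window /=; lia.
by apply: ramp_dep h => j jL; rewrite /window /rightw /=; lia.
Qed.

Variables (P : probability (env R) R) (P_iid : iid_env P) (s r : R).
Hypotheses (s_gt0 : 0 < s) (s_lt1 : s < 1) (r_ge0 : 0 <= r) (r_lt1 : r < 1).
Hypotheses (Es : trans P (pw s) 1 = 1%E) (Er : trans P (pw (s / 2)) 1 = r%:E).

Lemma blocktime_tail (b m : nat) (tau : R) : m%:R <= tau / 2 -> 4 <= tau ->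
  (P [set w | (tau < blocktime b m w)%R] <= (m%:R * (tail_bound s r * (tau / 4) `^ (- s)))%:E)%E.
Proof.
move=> mt t4.
have a1 : 1 <= tau / 4 by rewrite ler_pdivlMr // mul1r.
apply: le_trans (@psum_tail R P P_iid s r s_gt0 s_lt1 r_ge0 r_lt1 Es Er m
  (fun k => leftw (b%:Z + k%:Z + 1)) (fun k => k.+1) (tau / 4) (fun k => @leftw_inj _) a1).
apply: le_measure; rewrite ?inE.
- by apply: measurable_setb; apply: measurable_fun_ltr => //; exact: measurable_blocktime.
- apply: measurable_setb; apply: measurable_fun_ler => //.
  by apply: measurable_sum => i; exact: measurable_psum.
move=> w /=; rewrite /blocktime /cross big_split /= sumr_const card_ord -mulr_sumr.
by move: mt; set S := \sum_(_ < _) _; lra.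
Qed.

Variable c0 : R.
Hypotheses (c0_gt0 : 0 < c0) (Hc0 : forall (e : nat -> int) J k,
  injective e -> (0 < J)%N -> (2 ^+ J) `^ s * r ^+ k.+1 <= (1 - r) / 4 ->
  ((c0 * (2 ^+ J) `^ (- s))%:E <= P [set w | ramp e (2 ^+ J) k.+1 w])%E).

(** The conditions on the left and on the right of the site [b + m] are independent.
    The ladder condition fails with probability at most [r]; the two other conditions on
    the left share the remaining margin [1 - r]. *)
Lemma prob_trap (b L m : nat) (tau q : R) J : (0 < L)%N -> (L <= m)%N -> (0 < J)%N ->
  m%:R <= tau / 2 -> 4 <= tau -> 0 < q ->
  m%:R * (tail_bound s r * (tau / 4) `^ (- s)) <= (1 - r) / 4 ->
  q `^ (- (s / 2)) * r ^+ L <= (1 - r) / 4 ->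
  (2 ^+ J) `^ s * r ^+ L <= (1 - r) / 4 ->
  (((1 - r) / 4 * (c0 * (2 ^+ J) `^ (- s)))%:E <= P [set w | trap b L m tau q (2 ^+ J) w])%E.
Proof.
move=> L0 Lm J0 mt t4 q0 ha hc hd.
pose A := [set w : env R | approach b L m tau q w]; pose B := [set w : env R | ramp (rightw (b + m)%N) (2 ^+ J) L w].
have mA : measurable A by apply: measurable_setb; exact: measurable_approach.
have mB : measurable B by apply: measurable_setb; exact: measurable_ramp.
have -> : [set w | trap b L m tau q (2 ^+ J) w] = A `&` B.
  by apply/seteqP; split => w /=; rewrite /trap => /andP.
rewrite (@indep_sets R P P_iid (window b (b + m)) A B) //; last 2 first.
- by move=> w w' h; rewrite /A /= (approach_dep _ _ Lm h).
- move=> w w' h; rewrite /B /=; congr is_true; apply: (ramp_dep _ _ h) => j jL.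
  exact: rightw_window.
have r4 : 0 <= (1 - r) / 4 by rewrite divr_ge0 // subr_ge0 ltW.
rewrite EFinM; apply: lee_pmul.
- by rewrite lee_fin.
- by rewrite lee_fin mulr_ge0 ?powR_ge0 // ltW.
- pose A1 := [set w : env R | tau < blocktime b m w].
  pose A2 := [set w : env R | ~~ ladder (leftw (b + m)%N) L w].
  pose A3 := [set w : env R | q <= pprod (leftw (b + m)%N) w L].
  have mA1 : measurable A1.
    by apply: measurable_setb; apply: measurable_fun_ltr => //; exact: measurable_blocktime.
  have mA2 : measurable A2.
    by apply: measurable_setb; apply: measurable_neg; exact: measurable_ladder.
  have mA3 : measurable A3.
    by apply: measurable_setb; apply: measurable_fun_ler => //; exact: measurable_pprod.
  have h1 : (P A1 <= ((1 - r) / 4)%:E)%E.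
    by apply: (le_trans (blocktime_tail b mt t4)); rewrite lee_fin.
  have h2 : (P A2 <= r%:E)%E.
    exact: (prob_not_ladder P_iid s_gt0 r_ge0 Es Er L (@leftw_inj _)).
  have h3 : (P A3 <= ((1 - r) / 4)%:E)%E.
    apply: (le_trans (prob_pprod_gt P_iid s_gt0 r_ge0 Er L (@leftw_inj _) q0)).
    by rewrite lee_fin.
  have sub : ~` A `<=` A1 `|` A2 `|` A3.
    move=> w /= /negP; rewrite /approach !negb_and -ltNge -leNgt.
    by move=> /or3P[h|h|h]; [left; left|left; right|right].
  have hU : (P (~` A) <= ((1 - r) / 4 + r + (1 - r) / 4)%:E)%E.
    apply: (le_trans (le_measure P _ _ sub)); rewrite ?inE.
    - exact: measurableC.
    - by do 2?apply: measurableU.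
    apply: (le_trans (measureU2 P (measurableU _ _ mA1 mA2) mA3)).
    rewrite EFinD; apply: leeD => //.
    apply: (le_trans (measureU2 P mA1 mA2)).
    by rewrite EFinD; exact: leeD.
  have fA : P A \is a fin_num by exact: fin_num_measure.
  move: hU; rewrite probability_setC // -(fineK fA) -EFinB !lee_fin.
  by lra.
- have := @Hc0 (rightw (b + m)%N) J L.-1 (@rightw_inj _) J0.
  by rewrite prednK // => /(_ hd).
Qed.

(** The events are disjoint by [trap_unique], so that their probabilities add up. *)
Lemma prob_trapped (b L n : nat) (tau q : R) J : (0 < L)%N -> (0 < J)%N -> tau < 2 * 2 ^+ J ->
  (L + n)%:R <= tau / 2 -> 4 <= tau -> 0 < q ->
  (L + n)%:R * (tail_bound s r * (tau / 4) `^ (- s)) <= (1 - r) / 4 ->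
  q `^ (- (s / 2)) * r ^+ L <= (1 - r) / 4 ->
  (2 ^+ J) `^ s * r ^+ L <= (1 - r) / 4 ->
  ((n%:R * ((1 - r) / 4 * (c0 * (2 ^+ J) `^ (- s))))%:E <= P (trapped b L n tau q (2 ^+ J)))%E.
Proof.
move=> L0 J0 ty mt t4 q0 ha hc hd.
pose F i := [set w : env R | trap b L (L + i) tau q (2 ^+ J) w].
have mF i : measurable (F i) by apply: measurable_setb; exact: measurable_trap.
have -> : trapped b L n tau q (2 ^+ J) = \big[setU/set0]_(i < n) F i.
  rewrite -bigcup_mkord; apply/seteqP; split => w /=.
    by move=> /existsP[i ti]; exists (val i) => //=.
  by move=> [i /= ilt ti]; apply/existsP; exists (Ordinal ilt).
rewrite (measure_semi_additive_ord P (F := fun i : 'I_n => F i)) //; last 2 first.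
- move=> i j _ _ [w [/= ti tj]]; apply: val_inj => /=.
  by have /addnI := trap_unique ty ti tj.
- exact: bigsetU_measurable.
apply: (@le_trans _ _ (\sum_(i < n) ((1 - r) / 4 * (c0 * (2 ^+ J) `^ (- s)))%:E)%E).
  by rewrite sumEFin lee_fin sumr_const card_ord [leLHS]mulr_natl.
have K0 : 0 <= tail_bound s r by exact: tail_bound_ge0.
apply: lee_sum => i _; apply: prob_trap => //.
- exact: leq_addr.
- by apply: le_trans mt; rewrite ler_nat leq_add2l ltnW.
- apply: le_trans ha; apply: ler_wpM2r; first by rewrite mulr_ge0 ?powR_ge0.
  by rewrite ler_nat leq_add2l ltnW.
Qed.

End good_sites.

(** * Localization in a trap *)

Section localization.
Variable R : realType.

(** Expected hitting time of [b], for the walk reflected at [- t - 1]. *)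
Definition past (b t : nat) (w : env R) : R :=
  \sum_(i < b) cross w (i%:Z + 1) (t + i.+1).

(** A product of [rho] read leftwards from a site beyond [b] factors at [b], which
    separates the sites on the two sides of [b] in the mixed term. *)
Lemma time_split (b m t : nat) (w : env R) :
  \sum_(i < b + m) cross w (i%:Z + 1) (t + i.+1) =
  past b t w + blocktime b m w + 2 * (psum (leftw b) w (t + b) * psum (rightw b) w m).
Proof.
rewrite big_split_ord /= -/(past b t w) -addrA; congr (_ + _).
rewrite /blocktime [psum (rightw b) w m]/psum !mulr_sumr -big_split /=.
apply: eq_bigr => k _; rewrite /cross.
have -> : (t + (b + k).+1 = k.+1 + (t + b))%N by lia.
have -> : (b + k)%N%:Z + 1 = b%:Z + k.+1%:Z by lia.
rewrite psum_cat pprod_rev.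
have -> : (fun j => leftw (b%:Z + k.+1%:Z) (k.+1 + j)%N) = leftw b.
  by apply/funext => j; rewrite /leftw; lia.
by ring.
Qed.

(** The event on which the sites left of [b] delay the walk too much. The two factors of
    the mixed term of [time_split] are bounded separately by [v]. *)
Definition excess (b t M : nat) (tau v : R) (w : env R) : bool :=
  [|| tau / 2 < past b t w, v <= psum (leftw b) w (t + b) | v <= psum (rightw b) w M].

Lemma measurable_excess b t M (tau v : R) : measurable_fun setT (excess b t M tau v).
Proof.
have mp := @measurable_psum R.
apply: measurable_or.
  by apply: measurable_fun_ltr => //; apply: measurable_sum => i; exact: measurable_cross.
by apply: measurable_or; apply: measurable_fun_ler.
Qed.

Lemma trap_localizes (b L m M t : nat) (K tau q y v : R) (w : env R) :
  (forall i, site w i != 0) -> (0 < t)%N -> (m <= M)%N -> 0 < K ->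
  0 < y -> tau = t%:R / (2 * K) -> 2 * v ^+ 2 <= tau / 2 ->
  K * t%:R <= y -> q <= (K * t%:R)^-1 ->
  trap b L m tau q y w -> ~~ excess b t M tau v w ->
  (quenched_law w [set X | (L < `|X t - (b + m)%N%:Z|)%N] <= (3 / K)%:E)%E.
Proof.
move=> w0 t0 mM K0 y0 tauE vtau Ky qK /andP[/and3P[bt lad qq] /rampP[k [kL yk _]]].
rewrite /excess !negb_or -leNgt -!ltNge => /and3P[pt lv rv].
have t0' : 0 < t%:R :> R by rewrite ltr0n.
have yi : 0 < y^-1 by rewrite invr_gt0.
have hj : exists2 j, (j < L)%N & 1 <= y^-1 * pprod (rightw (b + m)%N) w j.+1.
  by exists k => //; rewrite mulrC ler_pdivlMr // mul1r.
apply: (le_trans (quenched_valley w0 t0 yi hj)); rewrite lee_fin time_split.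
have v0 : 0 <= v by apply: ltW; apply: le_lt_trans lv; exact: psum_ge0.
have pr : psum (leftw b) w (t + b) * psum (rightw b) w m <= v ^+ 2.
  rewrite expr2; apply: ler_pM; rewrite ?psum_ge0 //; first exact: ltW.
  by apply: (le_trans (psum_le _ _ mM)); exact: ltW.
have S1 : past b t w + blocktime b m w +
    2 * (psum (leftw b) w (t + b) * psum (rightw b) w m) <= 2 * tau by lra.
have S2 : (past b t w + blocktime b m w +
    2 * (psum (leftw b) w (t + b) * psum (rightw b) w m)) / t%:R <= K^-1.
  rewrite ler_pdivrMr //; apply: (le_trans S1); rewrite tauE invfM.
  by rewrite le_eqVlt; apply/orP; left; apply/eqP; field; rewrite gt_eqF.
have Kt0 : 0 < K * t%:R by exact: mulr_gt0.
have S3 : t%:R * (y^-1 + pprod (leftw (b + m)%N) w L) <= 2 / K.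
  have h1 : y^-1 <= (K * t%:R)^-1 by rewrite lef_pV2.
  have h2 : pprod (leftw (b + m)%N) w L <= (K * t%:R)^-1 by exact: le_trans (ltW qq) qK.
  apply: (le_trans (ler_wpM2l (ltW t0') (lerD h1 h2))).
  by rewrite le_eqVlt; apply/orP; left; apply/eqP; field; rewrite !gt_eqF.
by apply: (le_trans (lerD S2 S3)); rewrite le_eqVlt; apply/orP; left; apply/eqP; field; rewrite gt_eqF.
Qed.

End localization.

(** * Choice of the scales *)

Section asymptotics.
Variable R : realType.

Definition eventually_large (Q : R -> Prop) := exists X : R, forall x, X <= x -> Q x.

Lemma eventually_and Q1 Q2 : eventually_large Q1 -> eventually_large Q2 ->
  eventually_large (fun x => Q1 x /\ Q2 x).
Proof.
move=> [X hX] [Y hY]; exists (Num.max X Y) => x; rewrite ge_max => /andP[h1 h2].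
by split; [exact: hX|exact: hY].
Qed.

Lemma eventually_ge (c : R) : eventually_large (fun x => c <= x).
Proof. by exists c. Qed.

Lemma eventually_expR (a c : R) : 0 < a -> eventually_large (fun x => c <= expR (a * x)).
Proof.
move=> a0; exists (c / a) => x; rewrite ler_pdivrMr // mulrC => h.
by apply: le_trans (expR_ge1Dx _); apply: (le_trans h); rewrite lerDr.
Qed.

Lemma eventually_sqr_expR (a c : R) : 0 < a -> 0 < c ->
  eventually_large (fun x => x ^+ 2 <= c * expR (a * x)).
Proof.
move=> a0 c0; pose b := a / 3; have b0 : 0 < b by rewrite divr_gt0.
exists (Num.max 0 (c * b ^+ 3)^-1) => x; rewrite ge_max => /andP[x0 xc].
have cb : 0 < c * b ^+ 3 by rewrite mulr_gt0 ?exprn_gt0.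
have h : (b * x) ^+ 3 <= expR (a * x).
  have -> : a * x = 3%:R * (b * x) by rewrite /b; field.
  rewrite expRM_natl; apply: lerXn2r; rewrite ?nnegrE ?expR_ge0 //.
    exact: mulr_ge0 (ltW b0) x0.
  by apply: le_trans (expR_ge1Dx _); rewrite lerDr.
apply: le_trans (ler_wpM2l (ltW c0) h).
have -> : c * (b * x) ^+ 3 = (c * b ^+ 3 * x) * x ^+ 2 by ring.
rewrite -[leLHS]mul1r ler_wpM2r ?sqr_ge0 //.
by rewrite -ler_pdivrMl // mulr1.
Qed.

Lemma eventually_gauss (a b c e : R) : 0 < a -> 0 < e ->
  eventually_large (fun x => expR (b * x + c - a * x ^+ 2) <= e).
Proof.
move=> a0 e0; pose C := c - ln e.
exists (Num.max 1 ((`|b| + `|C|) / a)) => x; rewrite ge_max => /andP[x1 xa].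
rewrite -[leRHS]lnK ?posrE // ler_expR.
have x0 : 0 < x by exact: lt_le_trans x1.
have h : (`|b| + `|C|) * x <= a * x ^+ 2.
  by rewrite expr2 mulrA ler_wpM2r ?(ltW x0) // mulrC -ler_pdivrMr.
have h1 : b * x <= `|b| * x by rewrite ler_wpM2r ?(ltW x0) // ler_norm.
have h2 : C <= `|C| * x by apply: (le_trans (ler_norm _)); rewrite ler_peMr.
by move: h h1 h2; rewrite /C mulrDl; lra.
Qed.

Variables (s r Ks c0 : R).
Hypotheses (s_gt0 : 0 < s) (s_lt1 : s < 1) (r_ge0 : 0 <= r) (r_lt1 : r < 1)
  (Ks_ge0 : 0 <= Ks) (c0_gt0 : 0 < c0).

(** The number [n] of candidates is [theta * t ^ s], where [theta] is small enough for
    the time to reach them to be at most [tau] with high probability, and the height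
    [2 ^ J] is the power of two between [K t] and [2 K t]. The width [L] is of order
    [delta * (ln t) ^ 2], so that [r ^ L] is smaller than any power of [t]. *)
Lemma scale_parameters (K delta : R) : 1 <= K -> 0 < delta ->
  exists2 p0 : R, 0 < p0 & eventually_large (fun x => forall t : R, 0 < t -> ln t = x ->
    exists L n J : nat, let tau := t / (2 * K) in let q := (K * t)^-1 in
    [/\ (0 < L)%N, (0 < J)%N, tau < 2 * 2 ^+ J, K * t <= 2 ^+ J & L%:R <= delta * x ^+ 2] /\
    [/\ (L + n)%:R <= tau / 2, 4 <= tau, (L + n)%:R * (Ks * (tau / 4) `^ (- s)) <= (1 - r) / 4,
        q `^ (- (s / 2)) * r ^+ L <= (1 - r) / 4 & (2 ^+ J) `^ s * r ^+ L <= (1 - r) / 4] /\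
    p0 <= n%:R * ((1 - r) / 4 * (c0 * (2 ^+ J) `^ (- s)))).
Proof.
move=> K1 d0; have K0 : 0 < K by exact: lt_le_trans K1.
have r1 : 0 < 1 - r by rewrite subr_gt0.
have Ks1 : 0 < Ks + 1 by rewrite ltr_wpDl.
pose theta := (1 - r) / (64 * K * (Ks + 1)).
have th0 : 0 < theta by rewrite /theta divr_gt0 // !mulr_gt0.
exists (theta * (1 - r) * c0 / (16 * K)); first by rewrite !(divr_gt0, mulr_gt0).
pose r' := Num.max r 2^-1.
have r'0 : 0 < r' by rewrite /r' lt_max invr_gt0 ltr0n orbT.
have r'1 : r' < 1 by rewrite /r' gt_max r_lt1 invf_lt1 ?ltr1n.
pose la := - ln r'; have la0 : 0 < la by rewrite /la oppr_gt0 ln_lt0 // r'0.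
have [X HX] : eventually_large (fun x =>
  ((1 <= x /\ 2 <= delta * x ^+ 2) /\
  (x ^+ 2 <= (theta / delta) * expR (s * x) /\ 2 / theta <= expR (s * x))) /\
  ((8 * K * theta <= expR ((1 - s) * x) /\ 8 * K <= expR (1 * x)) /\
   expR (1 * x + (ln (2 * K) + 2 * la) - (la * delta) * x ^+ 2) <= (1 - r) / 4)).
  apply: eventually_and; [apply: eventually_and; apply: eventually_and|apply: eventually_and].
  - exact: eventually_ge.
  - exists (Num.max 1 (2 / delta)) => x; rewrite ge_max => /andP[x1 xd].
    have h : 2 <= delta * x by rewrite mulrC -ler_pdivrMr.
    apply: (le_trans h); rewrite ler_wpM2l ?(ltW d0) // expr2 ler_peMr //.
    exact: le_trans x1.
  - by apply: eventually_sqr_expR => //; exact: divr_gt0.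
  - exact: eventually_expR.
  - by apply: eventually_and; apply: eventually_expR; rewrite // subr_gt0.
  - by apply: eventually_gauss; [exact: mulr_gt0|exact: divr_gt0].
exists X => x /HX [[[x1 dx] [xE thE]] [[KE Kt] G]] t t0 lt.
have tE : t = expR x by rewrite -lt lnK.
have tsE : t `^ s = expR (s * x) by rewrite /powR gt_eqF // lt.
rewrite -tsE in xE thE; rewrite mul1r -tE in Kt.
have t1sE : t `^ (1 - s) = expR ((1 - s) * x) by rewrite /powR gt_eqF // lt.
have ts0 : 0 < t `^ s by exact: powR_gt0.
have tss : t `^ s * t `^ (1 - s) = t.
  rewrite -powRD; first by rewrite subrKC powRr1 // ltW.
  by apply/implyP => _; rewrite gt_eqF.
rewrite -t1sE in KE.
have Kt1 : 1 < K * t by nra.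
have [J yl yu] : exists2 J, K * t <= 2 ^+ J & 2 ^+ J <= 2 * (K * t) :> R.
  have [N aN] : exists N, K * t < 2 ^+ N.
    exists (Num.truncn (K * t)).+1; apply: lt_le_trans (truncnS_gt _) _.
    by rewrite -natrX ler_nat ltnW // ltn_expl.
  have [j h1 h2] := dyadic (ltW Kt1) aN.
  exists j.+1; first by rewrite exprS ltW.
  by rewrite exprS ler_pM2l.
have J0 : (0 < J)%N.
  by case: (J) yl => // /(lt_le_trans Kt1); rewrite expr0 ltxx.
have D0 : 0 <= delta * x ^+ 2 by rewrite mulr_ge0 ?sqr_ge0 // ltW.
have [l T1 T2] : exists2 l, l.+2%:R <= delta * x ^+ 2 & delta * x ^+ 2 < l.+3%:R.
  have : (2 <= Num.truncn (delta * x ^+ 2))%N by rewrite truncn_ge_nat.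
  have := truncn_itv D0; case: (Num.truncn _) => [|[|l]] // /andP[h1 h2] _.
  by exists l.
pose L := l.+1.
have Ldx : L%:R <= delta * x ^+ 2 by apply: le_trans T1; rewrite ler_nat.
have Llow : delta * x ^+ 2 - 2 <= L%:R by move: T2; rewrite /L -!natr1; lra.
have L0 : (0 < L)%N by [].
pose n := Num.truncn (theta * t `^ s).
have th_ts : 0 <= theta * t `^ s by rewrite mulr_ge0 ?ltW.
have := truncn_itv th_ts; rewrite -/n => /andP[n1 n2].
have nlow : theta * t `^ s / 2 <= n%:R.
  have : 2 <= theta * t `^ s by rewrite mulrC -ler_pdivrMr.
  by move: n2; rewrite -natr1; lra.
have Lup : L%:R <= theta * t `^ s.
  apply: (le_trans Ldx); rewrite -ler_pdivlMl // mulrA (mulrC delta^-1).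
  exact: xE.
have Ln : (L + n)%:R <= 2 * (theta * t `^ s) by rewrite natrD; lra.
have rL : 2 * K * t * r ^+ L <= (1 - r) / 4.
  apply: le_trans G.
  have h1 : r ^+ L <= r' ^+ L.
    by rewrite lerXn2r ?nnegrE ?(ltW r'0) // /r' le_max lexx.
  have h2 : r' ^+ L = expR (- la * L%:R).
    by rewrite /la opprK expRM_natr lnK.
  have K2 : 0 < 2 * K * t by rewrite !mulr_gt0.
  apply: (le_trans (ler_wpM2l (ltW K2) h1)); rewrite h2.
  rewrite -{1}[2 * K]lnK ?posrE ?mulr_gt0 // tE -!expRD ler_expR mul1r.
  have := ler_wpM2l (ltW la0) Llow; lra.
exists L, n, J; split; [split|split] => //.
- have : t / (2 * K) <= K * t by rewrite ler_pdivrMr ?mulr_gt0 //; nra.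
  move=> h; apply: (le_lt_trans (le_trans h yl)).
  by rewrite ltr_pMl ?exprn_gt0 // ltr1n.
- split.
  + apply: (le_trans Ln); rewrite ler_pdivlMr // ler_pdivlMr ?mulr_gt0 //.
    by rewrite -{2}tss; nra.
  + by rewrite ler_pdivlMr ?mulr_gt0 //; lra.
  + apply: (@le_trans _ _ (2 * (theta * t `^ s) * (Ks * (8 * K * t `^ (- s))))).
      apply: ler_pM => //; first by rewrite mulr_ge0 ?powR_ge0.
      rewrite ler_wpM2l //.
      have -> : t / (2 * K) / 4 = (8 * K)^-1 * t by field; rewrite gt_eqF.
      rewrite powRM ?invr_ge0 ?mulr_ge0 ?(ltW K0) ?(ltW t0) //.
      rewrite ler_wpM2r ?powR_ge0 //.
      have K8 : 1 <= 8 * K by lra.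
      rewrite -powR_inv1 ?(le_trans ler01) // -powRrM mulN1r opprK.
      rewrite -[leRHS]powRr1 ?(le_trans ler01) //.
      by apply: ler_powR => //; exact: ltW.
    rewrite powRN.
    have -> : 2 * (theta * t `^ s) * (Ks * (8 * K / t `^ s)) = (1 - r) / 4 * (Ks / (Ks + 1)).
      by rewrite /theta; field; rewrite !gt_eqF.
    rewrite ler_piMr //; first by rewrite divr_ge0 // ltW.
    by rewrite ler_pdivrMr // mul1r lerDl.
  + apply: le_trans rL; rewrite ler_wpM2r ?exprn_ge0 //.
    have Kt0 : 0 <= K * t by exact: ltW (lt_trans ltr01 Kt1).
    rewrite -[(K * t)^-1](powR_inv1 Kt0) -powRrM mulN1r opprK.
    apply: (@le_trans _ _ ((K * t) `^ 1)).
      by apply: ler_powR; [exact: ltW|move: s_gt0 s_lt1; lra].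
    by rewrite powRr1 // -mulrA ler_peMl ?ler1n.
  + apply: le_trans rL; rewrite ler_wpM2r ?exprn_ge0 //.
    apply: (@le_trans _ _ ((2 ^+ J) `^ 1)).
      by apply: ler_powR; [rewrite exprn_ege1 // ler1n|exact: ltW].
    by rewrite powRr1 ?exprn_ge0 // -mulrA.
- have y0 : 0 < 2 ^+ J :> R by rewrite exprn_gt0.
  have hy : (2 * K)^-1 * (t `^ s)^-1 <= (2 ^+ J) `^ (- s).
    rewrite powRN -invfM lef_pV2 ?posrE ?powR_gt0 ?mulr_gt0 //.
    apply: (@le_trans _ _ ((2 * (K * t)) `^ s)).
      by rewrite ge0_ler_powR ?nnegrE ?(ltW s_gt0) ?(ltW y0) ?mulr_ge0 ?(ltW K0) ?(ltW t0).
    rewrite mulrA powRM ?mulr_ge0 ?(ltW K0) ?(ltW t0) //.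
    rewrite ler_wpM2r ?(ltW ts0) //.
    rewrite -[leRHS]powRr1 ?mulr_ge0 ?(ltW K0) //; apply: ler_powR; last exact: ltW.
    lra.
  have cr : 0 <= (1 - r) / 4 * c0 by rewrite mulr_ge0 ?divr_ge0 // ltW.
  apply: (@le_trans _ _ (theta * t `^ s / 2 * ((1 - r) / 4 * (c0 * ((2 * K)^-1 * (t `^ s)^-1))))).
    by rewrite le_eqVlt; apply/orP; left; apply/eqP; field; rewrite !gt_eqF.
  apply: ler_pM => //.
  + by rewrite divr_ge0.
  + by rewrite mulrA mulr_ge0 // mulr_ge0 // invr_ge0 ?mulr_ge0 // ltW.
  + by rewrite !mulrA -mulrA ler_wpM2l.
Qed.

End asymptotics.

(** * Localization at a large scale *)

Definition localized (R : realType) (eps delta : R) (N : nat) (w : env R) : Prop :=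
  exists t u : nat, [/\ (N <= t)%N, (N <= u)%N &
    ((1 - eps)%:E <= quenched_law w [set X | (((X t)%:~R - u%:R) / ln (t%:R : R) ^+ 2
                          \in `[- delta, delta])%R])%E].

Lemma localizedI (R : realType) (eps delta : R) (N t u L : nat) (w : env R) :
  (N <= t)%N -> (N <= u)%N -> 0 < ln (t%:R : R) ^+ 2 ->
  L%:R <= delta * ln (t%:R : R) ^+ 2 ->
  (quenched_law w [set X | (L < `|X t - u%:Z|)%N] <= eps%:E)%E ->
  localized eps delta N w.
Proof.
move=> Nt Nu l0 Ld hq; exists t, u; split => //.
pose A (z : int) := (z%:~R - u%:R) / ln (t%:R : R) ^+ 2 \in `[- delta, delta]%R.
have mA : measurable ([set X | A (X t)] : set path_space) by exact: measurable_coord.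
have mF : measurable ([set X | (L < `|X t - u%:Z|)%N] : set path_space).
  exact: (measurable_coord t (fun x => (L < `|x - u%:Z|)%N)).
have sub : ~` [set X | A (X t)] `<=` [set X | (L < `|X t - u%:Z|)%N].
  move=> X /= /negP nA; rewrite ltnNge; apply: contra nA => h.
  rewrite /A in_itv /= -ler_norml normrM normfV (gtr0_norm l0) ler_pdivrMr //.
  apply: le_trans Ld; have -> : u%:R = (u%:Z)%:~R :> R by [].
  by rewrite -intrB -intr_norm -[L%:R]/((L%:Z)%:~R) ler_int -abszE lez_nat.
have hC : (quenched_law w (~` [set X | A (X t)]) <= eps%:E)%E.
  exact: le_trans (le_measure _ (mem_set (measurableC mA)) (mem_set mF) sub) hq.
have fA : quenched_law w [set X | A (X t)] \is a fin_num by exact: fin_num_measure.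
move: hC; rewrite probability_setC // -[X in (_ - X)%E](fineK fA) -EFinB lee_fin => hC.
by rewrite -[leRHS](fineK fA) lee_fin; move: hC; lra.
Qed.

Section infinitely_often.
Variables (R : realType) (P : probability (env R) R) (P_iid : iid_env P) (s r : R).
Hypotheses (s_gt0 : 0 < s) (s_lt1 : s < 1) (r_ge0 : 0 <= r) (r_lt1 : r < 1).
Hypotheses (Es : trans P (pw s) 1 = 1%E) (Er : trans P (pw (s / 2)) 1 = r%:E).
Hypothesis tail_moment_small : forall eps : R, (0 < eps)%R ->
  exists B : nat, forall J, (\sum_(i < J) tail_moment P s (2 ^+ (B + i)) <= eps%:E)%E.
Let K_ge0 : 0 <= tail_bound s r.
Proof. exact: tail_bound_ge0. Qed.

Lemma powR_small (eps : R) : 0 < eps -> exists2 Y : R, 1 <= Y &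
  forall y, Y <= y -> y `^ (- s) <= eps.
Proof.
move=> e0; exists (Num.max 1 (eps `^ (- s^-1))); first by rewrite le_max lexx.
move=> y; rewrite ge_max => /andP[y1 ye].
have y0 : 0 < y by exact: lt_le_trans y1.
have p0 : 0 < eps `^ (- s^-1) by exact: powR_gt0.
have h : (eps `^ (- s^-1)) `^ s <= y `^ s.
  by rewrite ge0_ler_powR ?nnegrE // ltW.
rewrite powRN -[leRHS]invrK lef_pV2 ?posrE ?powR_gt0 ?invr_gt0 //.
by apply: le_trans h; rewrite -powRrM mulNr mulVf ?gt_eqF // powR_inv1 // ltW.
Qed.

(** For fixed [b] the bound tends to 0 as [tau] and [v] grow, uniformly in [t] and
    [M]. *)
Lemma prob_excess (b t M : nat) (tau v : R) : b%:R <= tau / 4 -> 8 <= tau -> 1 <= v ->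
  (P [set w | excess b t M tau v w] <=
    (b%:R * (tail_bound s r * (tau / 8) `^ (- s)) + (tail_bound s r * v `^ (- s) + tail_bound s r * v `^ (- s)))%:E)%E.
Proof.
move=> bt t8 v1.
have T := @psum_tail R P P_iid s r s_gt0 s_lt1 r_ge0 r_lt1 Es Er.
pose A1 := [set w : env R | tau / 2 < past b t w].
pose A2 := [set w : env R | v <= psum (leftw b) w (t + b)].
pose A3 := [set w : env R | v <= psum (rightw b) w M].
have mA1 : measurable A1.
  apply: measurable_setb; apply: measurable_fun_ltr => //.
  by apply: measurable_sum => i; exact: measurable_cross.
have mp := @measurable_psum R.
have mA2 : measurable A2 by apply: measurable_setb; apply: measurable_fun_ler.
have mA3 : measurable A3 by apply: measurable_setb; apply: measurable_fun_ler.
have E : [set w | excess b t M tau v w] = A1 `|` (A2 `|` A3).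
  apply/seteqP; split => w /=; rewrite /excess.
    by move=> /or3P[h|h|h]; [left|right; left|right; right].
  by move=> [h|[h|h]]; apply/or3P; [constructor 1|constructor 2|constructor 3].
have m23 : measurable (A2 `|` A3) by exact: measurableU.
rewrite E; apply: (le_trans (measureU2 P mA1 m23)).
rewrite EFinD; apply: leeD; last first.
  apply: (le_trans (measureU2 P mA2 mA3)); rewrite EFinD; apply: leeD.
    have := T 1%N (fun=> leftw b) (fun=> (t + b)%N) v (fun=> @leftw_inj _) v1.
    by rewrite mul1r; under eq_set do rewrite big_ord1.
  have := T 1%N (fun=> rightw b) (fun=> M) v (fun=> @rightw_inj _) v1.
  by rewrite mul1r; under eq_set do rewrite big_ord1.
have t1 : 1 <= tau / 8 by rewrite ler_pdivlMr // mul1r.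
apply: le_trans (T b (fun i => leftw (i%:Z + 1)) (fun i => (t + i.+1)%N) (tau / 8) (fun i => @leftw_inj _) t1).
apply: le_measure; rewrite ?inE //.
  apply: measurable_setb; apply: measurable_fun_ler => //.
  exact: measurable_sum.
move=> w; rewrite /A1 /past /cross /= big_split /= sumr_const card_ord -mulr_sumr.
by move: bt; set S := \sum_(_ < _) _; lra.
Qed.

(** The good event [G] is the presence of a trap in the window, and the exceptional one
    [E] is the delay caused by the sites left of [b]. Since [p0] depends neither on [b]
    nor on [eta], the statement can be iterated with disjoint windows. *)
Lemma scale (K delta : R) : 1 <= K -> 0 < delta -> exists2 p0 : R, 0 < p0 &
  forall (b N : nat) (eta : R), 0 < eta -> (N <= b)%N ->
  exists b' (G E : set (env R)), [/\ (b <= b')%N, measurable G, measurable E &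
    depends_on (window b b') G] /\
    [/\ (p0%:E <= P G)%E, (P E <= eta%:E)%E &
     forall w, (forall i, site w i != 0) -> G w -> ~ E w -> localized (3 / K) delta N w].
Proof.
move=> K1 d0; have K0 : 0 < K by exact: lt_le_trans K1.
have [c0 c0_gt0 Hc0] := prob_ramp P_iid s_gt0 s_lt1 r_ge0 r_lt1 Es Er tail_moment_small.
have [p0 p00 [X HX]] := scale_parameters s_gt0 s_lt1 r_ge0 r_lt1 K_ge0 c0_gt0 K1 d0.
exists p0 => // b N eta eta0 Nb.
pose e1 := eta / ((b%:R + 2) * (tail_bound s r + 1)).
have b2 : 0 < b%:R + 2 :> R by rewrite ltr_wpDl.
have K1' : 0 < tail_bound s r + 1 by rewrite ltr_wpDl.
have e10 : 0 < e1 by rewrite divr_gt0 // mulr_gt0.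
have [Y Y1 HY] := powR_small e10.
have Y0 : 0 < Y by exact: lt_le_trans Y1.
(* [t] is taken beyond the threshold [X] on its logarithm, and so large that
   [tau / 8] and [v] exceed [Y], the threshold beyond which the tails are below [e1]. *)
pose M0 := N%:R + expR X + 2 * K * (8 * (Y ^+ 2 + Y + b%:R)) : R.
have Y2 : 0 <= Y ^+ 2 by exact: sqr_ge0.
have KY : 0 <= 2 * K * (8 * (Y ^+ 2 + Y + b%:R)).
  by rewrite !mulr_ge0 ?addr_ge0 // ltW.
have eX := expR_gt0 X.
have M00 : 0 <= M0 by rewrite !addr_ge0 // ltW.
pose t := (Num.truncn M0).+1.
have tM : M0 < t%:R by exact: truncnS_gt.
have t0 : 0 < t%:R :> R by rewrite ltr0n.
have Nt : (N <= t)%N.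
  by rewrite -(ler_nat R); apply: ltW; apply: le_lt_trans tM; rewrite /M0 -addrA lerDl addr_ge0 // ltW.
have Xt : X <= ln (t%:R : R).
  rewrite -(expRK X) ler_ln ?posrE ?expR_gt0 //; apply: ltW; apply: le_lt_trans tM.
  by rewrite /M0 addrAC lerDr addr_ge0.
have [L [n [J /= [[L0 J0 ty Ky Ld] [[mt t4 ha hc hd] hp0]]]]] := HX _ Xt t%:R t0 erefl.
set tau := t%:R / (2 * K) in ty mt t4 ha *.
set q := (K * t%:R)^-1 in hc *.
have tauM : 8 * (Y ^+ 2 + Y + b%:R) <= tau.
  rewrite ler_pdivlMr ?mulr_gt0 // mulrC; apply: ltW; apply: le_lt_trans tM.
  by rewrite /M0 lerDr addr_ge0 // ltW.
have bn : 0 <= b%:R :> R by [].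
have Y1' : 1 <= Y ^+ 2 by rewrite exprn_ege1.
(* The mixed term of [time_split] is at most [2 * v ^+ 2 = tau / 2]. *)
pose v := Num.sqrt tau / 2.
have tau0 : 0 <= tau by apply: le_trans tauM; rewrite mulr_ge0 // !addr_ge0 // ltW.
have vY : Y <= v.
  have Y2' : 0 <= Y * 2 by rewrite mulr_ge0 // ltW.
  rewrite ler_pdivlMr // -[leLHS](ger0_norm Y2') -sqrtr_sqr ler_sqrt //.
  by apply: le_trans tauM; rewrite exprMn; lra.
have q0 : 0 < q by rewrite invr_gt0 mulr_gt0.
exists (b + (L + n + L))%N, (trapped b L n tau q (2 ^+ J)), [set w | excess b t (L + n) tau v w].
split; first split.
- exact: leq_addr.
- exact: measurable_trapped.
- by apply: measurable_setb; exact: measurable_excess.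
- exact: trapped_dep.
split.
- apply: le_trans (prob_trapped P_iid s_gt0 s_lt1 r_ge0 r_lt1 Es Er c0_gt0 Hc0 b L0 J0 ty mt t4 q0 ha hc hd).
  by rewrite lee_fin.
- apply: (le_trans (prob_excess _ _ _ _ _)) => //; [lra|lra|exact: le_trans vY|].
  have h1 : (tau / 8) `^ (- s) <= e1 by apply: HY; lra.
  have h2 : v `^ (- s) <= e1 by exact: HY.
  rewrite lee_fin.
  apply: (@le_trans _ _ ((b%:R + 2) * ((tail_bound s r + 1) * e1))).
    have h3 : tail_bound s r * (tau / 8) `^ (- s) <= (tail_bound s r + 1) * e1.
      by apply: ler_pM; rewrite ?powR_ge0 ?lerDl.
    have h4 : tail_bound s r * v `^ (- s) <= (tail_bound s r + 1) * e1.
      by apply: ler_pM; rewrite ?powR_ge0 ?lerDl.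
    by have := ler_wpM2l bn h3; lra.
  by rewrite mulrA /e1 mulrC divfK // gt_eqF // mulr_gt0.
- move=> w w0 /existsP[i ti] /negP nE.
  have hl : 0 < ln (t%:R : R) ^+ 2.
    rewrite -(pmulr_rgt0 _ d0); apply: lt_le_trans Ld; by rewrite ltr0n.
  apply: (@localizedI _ _ _ _ t (b + (L + i))%N L) => //.
    exact: leq_trans Nb (leq_addr _ _).
  apply: (trap_localizes w0 (ltn0Sn _) _ K0 _ erefl _ Ky (lexx _) ti nE).
  + by rewrite leq_add2l ltnW.
  + by rewrite exprn_gt0.
  + have hv (x : R) : 0 <= x -> 2 * (Num.sqrt x / 2) ^+ 2 = x / 2.
      by move=> x0; rewrite exprMn sqr_sqrtr //; field.
    by rewrite hv.
Qed.

End infinitely_often.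

(** * Almost sure localization *)

Section almost_sure.
Variables (R : realType) (P : probability (env R) R).

Lemma negligible_cover (A : set (env R)) :
  (forall eta : R, 0 < eta -> exists H, [/\ measurable H, (P H <= eta%:E)%E & A `<=` H]) ->
  P.-negligible A.
Proof.
move=> cov.
have cov' n : exists H, [/\ measurable H, (P H <= (n.+1%:R^-1)%:E)%E & A `<=` H].
  by apply: cov; rewrite invr_gt0.
have [H HH] := choice cov'.
exists (\bigcap_n H n); split.
- by apply: bigcapT_measurable => n; have [] := HH n.
- apply/eqP; rewrite eq_le measure_ge0 andbT; apply/lee_addgt0Pr => e e0; rewrite add0e.
  have [n ne] : exists n, n.+1%:R^-1 <= e.
    exists (Num.truncn e^-1); rewrite -[leRHS]invrK lef_pV2 ?posrE ?invr_gt0 //.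
    by apply: ltW; exact: truncnS_gt.
  have [mH Hn _] := HH n; apply: le_trans (le_trans Hn _); last by rewrite lee_fin.
  apply: le_measure; rewrite ?inE //; last by move=> w; exact.
  by apply: bigcapT_measurable => k; have [] := HH k.
- by move=> w Aw n _; have [_ _] := HH n; exact.
Qed.

Hypothesis P_iid : iid_env P.
Variables (N : nat) (good : set (env R)) (p0 : R).
Hypotheses (p0_gt0 : 0 < p0)
  (unblocked : P.-negligible [set w : env R | exists i, site w i = 0])
  (Hscale : forall (b : nat) (eta : R), 0 < eta -> (N <= b)%N ->
    exists b' (G E : set (env R)), [/\ (b <= b')%N, measurable G, measurable E &
      depends_on (window b b') G] /\
      [/\ (p0%:E <= P G)%E, (P E <= eta%:E)%E &
       forall w, (forall i, site w i != 0) -> G w -> ~ E w -> good w]).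

(** Successive scales use disjoint windows of sites, hence fail independently. The
    exceptional events accumulate in [E], and are given half of [eta] at each scale. *)
Lemma failures m (eta : R) : 0 < eta -> exists b (F E : set (env R)),
  [/\ (N <= b)%N, measurable F, measurable E & depends_on [set i | i < b%:Z] F] /\
  [/\ (P F <= ((1 - p0) ^+ m)%:E)%E, (P E <= eta%:E)%E &
    forall w, (forall i, site w i != 0) -> ~ good w -> F w \/ E w].
Proof.
elim: m eta => [|m IH] eta e0.
  exists N, setT, set0; split; split => //.
  - by rewrite expr0 probability_le1.
  - by rewrite measure0 lee_fin ltW.
  - by move=> w _ _; left.
have e2 : 0 < eta / 2 by rewrite divr_gt0.
have [b [F [E [[Nb mF mE dF] [PF PE cov]]]]] := IH _ e2.
have [b' [G [E' [[bb mG mE' dG] [PG PE' hG]]]]] := Hscale e2 Nb.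
exists b', (F `&` ~` G), (E `|` E'); split; split.
- exact: leq_trans Nb bb.
- by apply: measurableI => //; exact: measurableC.
- exact: measurableU.
- move=> w w' h; have -> : (F `&` ~` G) w = (F w /\ ~ G w) by [].
  rewrite (dF w w'); last by move=> i /= ib; apply: h => /=; lia.
  rewrite (dG w w') // => i; rewrite /window /= => ib; apply: h => /=; lia.
- have mG' : measurable (~` G) by exact: measurableC.
  rewrite (indep_sets (I := [set i | i < b%:Z]) P_iid mF mG' dF); last first.
    move=> w w' h; have -> : (~` G) w = (~ G w) by [].
    rewrite (dG w w') // => i; rewrite /window /= => ib; apply: h => /=; lia.
  have fG : P G \is a fin_num by exact: fin_num_measure.
  rewrite exprSr EFinM; apply: lee_pmul => //.
  rewrite probability_setC // EFinB; apply: leeB => //.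
- apply: (le_trans (measureU2 P mE mE')); rewrite [eta]splitr EFinD; exact: leeD.
- move=> w w0 ng; have [Fw|Ew] := cov w w0 ng; last by right; left.
  have [E'w|nE'] := pselect (E' w); first by right; right.
  by left; split => // Gw; apply: ng; exact: hG.
Qed.

Lemma negligible_not_good : P.-negligible [set w | ~ good w].
Proof.
apply: (@negligibleS _ _ _ _ ([set w : env R | exists i, site w i = 0] `|`
   [set w | (forall i, site w i != 0) /\ ~ good w])).
  move=> w ng; have [h|h] := pselect (exists i, site w i = 0); [by left|right].
  by split => // i; apply/eqP => wi; apply: h; exists i.
apply: negligibleU => //; apply: negligible_cover => eta e0.
have e2 : 0 < eta / 2 by rewrite divr_gt0.
have p01 : p0 <= 1.
  have [b' [G [E [[_ mG _ _] [PG _ _]]]]] := Hscale e2 (leqnn N).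
  by rewrite -lee_fin; apply: le_trans PG _; exact: probability_le1.
have [m hm] : exists m, (1 - p0) ^+ m <= eta / 2.
  have cvg0 : (1 - p0) ^+ n @[n --> \oo] --> 0.
    by apply: cvg_expr; rewrite ger0_norm ?subr_ge0 // gtrBl.
  have /cvgrPdist_le /(_ _ e2) [n _ hn] := cvg0.
  exists n; have := hn n (leqnn n); rewrite /= sub0r normrN ger0_norm //.
  by rewrite exprn_ge0 // subr_ge0.
have [b [F [E [[_ mF mE _] [PF PE cov]]]]] := failures m e2.
exists (F `|` E); split; first exact: measurableU.
- apply: (le_trans (measureU2 P mF mE)); rewrite [eta]splitr EFinD; apply: leeD => //.
  by apply: (le_trans PF); rewrite lee_fin.
- by move=> w [w0 ng]; exact: cov.
Qed.

End almost_sure.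

Unset Implicit Arguments.

Theorem theorem1p2 (R : realType) (P : probability (env R) R) (s : R)
  (P_iid : iid_env P)
  (E_log_rho_lt0 : (\int[P]_w log_rho w < 0)%E)
  (s_gt0 : 0 < s)
  (E_rho_s : (\int[P]_w (rho w `^ s) = 1)%E)
  (log_rho_nonlattice : nonlattice_log_rho P)
  (E_rho_s_log_rho : (\int[P]_w (rho w `^ s * log_rho w) < +oo)%E)
  (s_lt1 : s < 1) :
  {ae P, forall w, exists t u : nat -> R,
    [/\ forall m, 0 <= t m,
        t @ \oo --> +oo,
        u @ \oo --> +oo &
        forall delta : R, 0 < delta ->
          quenched_law w [set X | ((X (Num.truncn (t m)))%:~R - u m) / ln (t m) ^+ 2
                          \in `[- delta, delta]] @[m --> \oo] --> 1%E]}.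
Proof.
have [r [r_ge0 r_lt1 Er]] := half_moment s_gt0 E_log_rho_lt0 E_rho_s.
have Es := trans_pw_s s_gt0 E_rho_s.
have tsmall := tail_moment_small s_gt0 E_rho_s E_rho_s_log_rho.
have nb := negligible_blocked P_iid s_gt0 E_rho_s.
have loc m : {ae P, forall w, localized (m.+1%:R^-1) (m.+1%:R^-1) m w}.
  have m0 : 0 < m.+1%:R^-1 :> R by rewrite invr_gt0.
  (* [scale] misses the localization with probability at most [3 / K]. *)
  pose K : R := 3 * m.+1%:R.
  have K1 : 1 <= K by rewrite /K -natrM ler1n.
  have KE : 3 / K = m.+1%:R^-1 by rewrite /K invfM mulrA divff ?mul1r.
  have [p0 p00 Hs] := scale P_iid s_gt0 s_lt1 r_ge0 r_lt1 Es Er tsmall K1 m0.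
  rewrite KE in Hs.
  apply: (@negligible_not_good R P P_iid m (localized (m.+1%:R^-1) (m.+1%:R^-1) m) p0 p00 nb).
  by move=> b eta; exact: Hs.
have {}loc : {ae P, forall w, forall m, localized (m.+1%:R^-1) (m.+1%:R^-1) m w}.
  exact: ae_foralln loc.
apply: filterS loc => w loc.
have [tu htu] := choice (fun m => let: ex_intro t (ex_intro u h) := loc m in
  ex_intro (fun p : nat * nat => [/\ (m <= p.1)%N, (m <= p.2)%N &
    ((1 - m.+1%:R^-1)%:E <= quenched_law w [set X | (((X p.1)%:~R - p.2%:R) / ln (p.1%:R : R) ^+ 2
                          \in `[- m.+1%:R^-1, m.+1%:R^-1])%R])%E]) (t, u) h).
exists (fun m => (tu m).1%:R), (fun m => (tu m).2%:R); split => //.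
- apply/cvgryPge => A; near=> m.
  have [h _ _] := htu m; apply: (@le_trans _ _ m%:R); last by rewrite ler_nat.
  by near: m; exact: nbhs_infty_ger.
- apply/cvgryPge => A; near=> m.
  have [_ h _] := htu m; apply: (@le_trans _ _ m%:R); last by rewrite ler_nat.
  by near: m; exact: nbhs_infty_ger.
move=> delta d0.
have inv0 : (m.+1%:R^-1 : R) @[m --> \oo] --> 0 by exact: cvg_harmonic.
have lb : (1 - m.+1%:R^-1)%:E @[m --> \oo] --> (1%E : \bar R).
  apply: cvg_EFin; first by near=> m.
  by rewrite -[X in _ --> X]subr0; apply: cvgB => //; exact: cvg_cst.
apply: (squeeze_cvge _ lb (cvg_cst 1%E)).
near=> m.
have -> : Num.truncn ((tu m).1%:R : R) = (tu m).1.
  by apply: truncn_def; rewrite lexx ltr_nat ltnSn.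
have [_ _ h] := htu m.
pose ev (e : R) := [pred x : int | (x%:~R - (tu m).2%:R) / ln ((tu m).1%:R : R) ^+ 2
                                      \in `[- e, e]].
have mev e := measurable_coord (tu m).1 (ev e).
apply/andP; split; last by apply: probability_le1; exact: mev delta.
apply: (le_trans h); apply: le_measure; rewrite ?inE; [exact: mev|exact: mev|].
have me : m.+1%:R^-1 <= delta.
  near: m; have /cvgrPdist_le /(_ _ d0) := inv0; apply: filterS => m.
  by rewrite sub0r normrN ger0_norm.
move=> X /=; rewrite !in_itv /= => /andP[h1 h2].
by rewrite (le_trans h2 me) andbT; apply: le_trans h1; rewrite lerN2.
Unshelve. all: by end_near. Qed.
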